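(* Suppose a connected Lie group $G$ acts continuously with finite stabilisers on a path-connected topological space $U$. Let $k$ be the maximum integer such that $H^k(G,\mathbb Z)\neq0$. Suppose there is a class $a\in H^k(U,\mathbb Z)$ such that for some (and hence for every) $G$-orbit map $O\colon G\to U$ the pullback $O^*(a)$ generates a subgroup of $H^k(G,\mathbb Z)\cong\mathbb Z$ of index $m$. Then for every $x\in U$ the order of the stabiliser $G_x$ divides $m$.
   Context: For $x\in U$ the orbit map is $O\colon G\to U$, $g\mapsto g\cdot x$; since $U$ is path connected, all orbit maps are homotopic. *)

(* Defs.v *)
From HB Require Import structures.
From mathcomp Require Import all_boot all_order all_algebra.
From mathcomp Require Import generic_quotient ring_quotient.
From mathcomp Require Import all_classical all_reals all_analysis.
Import Order.TTheory GRing.Theory Num.Theory.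
Import numFieldNormedType.Exports.

Set Implicit Arguments.
Unset Strict Implicit.
Unset Printing Implicit Defensive.

Local Open Scope classical_set_scope.
Local Open Scope ring_scope.
Local Open Scope quotient_scope.

Lemma continuous_mx (R : realType) (T : topologicalType) (m n : nat)
    (f : T -> 'M[R]_(m, n)) :
  (forall i j, continuous (fun x => f x i j)) -> continuous f.
Proof.
move=> cf x A [P PA sA].
have : \forall y \near x, forall i j, P i j (f y i j).
  apply: (@filter_forall _ _ (fun i y => forall j, P i j (f y i j))) => i.
  apply: (@filter_forall _ _ (fun j y => P i j (f y i j))) => j.
  exact: cf (PA i j).
by apply: filterS => y Py; exact: sA.
Qed.

Section Simplices.
Variable R : realType.

(* Barycentric coordinates. The coercion of a set to [set_type] makes
   [simplex n] a topological space with the subspace topology. *)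
Definition simplex (n : nat) : set 'rV[R]_n.+1 :=
  [set x | (forall i, 0 <= x ord0 i) /\ \sum_i x ord0 i = 1].

Arguments simplex : clear implicits.

Definition face_row (n : nat) (i : 'I_n.+2) (x : 'rV[R]_n.+1) : 'rV[R]_n.+2 :=
  \row_j (if unlift i j is Some k then x ord0 k else 0).

Lemma face_row_simplex (n : nat) (i : 'I_n.+2) (x : 'rV[R]_n.+1) :
  simplex n x -> simplex n.+1 (face_row i x).
Proof.
move=> [x0 x1]; split=> [j|].
  by rewrite mxE; case: unliftP.
rewrite (bigD1 i)//= mxE unlift_none add0r -x1.
rewrite (reindex_omap (lift i) (unlift i))/=; last first.
  by move=> j; case: unliftP => [k ->|->]; rewrite ?eqxx.
apply: eq_big => [k|k _]; last by rewrite mxE liftK.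
by rewrite liftK eqxx andbT eq_sym neq_lift.
Qed.

Definition face (n : nat) (i : 'I_n.+2) (x : simplex n) : simplex n.+1 :=
  exist _ (face_row i (set_val x)) (mem_set (face_row_simplex i (set_valP x))).

Lemma face_row_continuous (n : nat) (i : 'I_n.+2) :
  continuous (@face_row n i).
Proof.
apply: continuous_mx => a b.
have -> : (fun x => face_row i x a b) =
    if unlift i b is Some k then fun x : 'rV[R]_n.+1 => x ord0 k else cst 0.
  by apply/funext => x; rewrite mxE; case: unliftP.
case: (unlift i b) => [k|]; first exact: coord_continuous.
exact: cst_continuous.
Qed.

Lemma face_continuous (n : nat) (i : 'I_n.+2) : continuous (@face n i).
Proof.
apply: (@continuous_comp_initial _ _ _ set_val) => x.
apply: (@continuous_comp _ _ _ set_val (face_row i)).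
  exact: initial_continuous.
exact: face_row_continuous.
Qed.

HB.instance Definition _ (n : nat) (i : 'I_n.+2) :=
  isContinuous.Build _ _ (@face n i) (@face_continuous n i).

End Simplices.
Arguments simplex : clear implicits.

Notation cochain R n X := (continuousType (simplex R n) X -> int).

Section Cohomology.
Variable R : realType.

Definition coboundary (n : nat) (X : topologicalType) (phi : cochain R n X) :
    cochain R n.+1 X :=
  fun s => \sum_(i < n.+2) (-1) ^+ i * phi (s \o @face R n i).

Lemma coboundaryB (n : nat) (X : topologicalType) :
  {morph @coboundary n X : phi psi / phi - psi}.
Proof.
move=> phi psi; apply/funext => s /=.
rewrite /coboundary !fctE -sumrB.
by apply: eq_bigr => i _; rewrite -mulrBr.
Qed.

Definition cocycle (n : nat) (X : topologicalType) : {pred cochain R n X} :=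
  [pred phi | coboundary phi == 0].

Lemma cocycleE (n : nat) (X : topologicalType) (phi : cochain R n X) :
  (phi \in @cocycle n X) = (coboundary phi == 0).
Proof. by []. Qed.

Fact cocycle_zmod_closed (n : nat) (X : topologicalType) :
  zmod_closed (@cocycle n X).
Proof.
have d0 : coboundary 0 = 0 :> cochain R n.+1 X.
  by rewrite -[X in coboundary X](subrr 0) coboundaryB subrr.
split=> [|phi psi]; rewrite !cocycleE ?d0// => /eqP p /eqP q.
by rewrite coboundaryB p q subrr.
Qed.

HB.instance Definition _ (n : nat) (X : topologicalType) :=
  GRing.isZmodClosed.Build _ (@cocycle n X) (@cocycle_zmod_closed n X).

Record cocycles (n : nat) (X : topologicalType) := Cocycle {
  cocycle_val :> cochain R n X;
  cocycle_valP : cocycle_val \in @cocycle n X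
}.

HB.instance Definition _ (n : nat) (X : topologicalType) :=
  [isSub for @cocycle_val n X].
HB.instance Definition _ (n : nat) (X : topologicalType) :=
  [Choice of cocycles n X by <:].
HB.instance Definition _ (n : nat) (X : topologicalType) :=
  [SubChoice_isSubZmodule of cocycles n X by <:].

(* The cochain group in degree -1 is 0. *)
Definition is_coboundary (n : nat) (X : topologicalType) :
    cochain R n X -> Prop :=
  if n is n'.+1 then fun phi => exists psi : cochain R n' X, phi = coboundary psi
  else fun phi => phi = 0.

Definition coboundaries (n : nat) (X : topologicalType) :
    {pred cocycles n X} :=
  fun z => `[< is_coboundary (z : cochain R n X) >].

Fact coboundaries_zmod_closed (n : nat) (X : topologicalType) :
  zmod_closed (@coboundaries n X).
Proof.
split=> [|z w].
  apply/asboolP; case: n => [//|n]/=.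
  exists 0; by rewrite -[X in coboundary X](subrr 0) coboundaryB subrr.
case: n z w => [|n] z w /asboolP/= zP /asboolP/= wP; apply/asboolP => /=.
  by rewrite zP wP subrr.
case: zP => p ->; case: wP => q ->.
by exists (p - q); rewrite coboundaryB.
Qed.

HB.instance Definition _ (n : nat) (X : topologicalType) :=
  GRing.isZmodClosed.Build _ (@coboundaries n X) (@coboundaries_zmod_closed n X).

Definition cohomology (n : nat) (X : topologicalType) : Type :=
  Quotient.quot (@coboundaries n X).

Section Pullback.
Variables (X Y : topologicalType) (f : continuousType X Y).

Definition cochain_pullback (n : nat) (phi : cochain R n Y) : cochain R n X :=
  fun s => phi (f \o s).

Lemma coboundary_pullback (n : nat) (phi : cochain R n Y) :
  coboundary (cochain_pullback phi) = cochain_pullback (coboundary phi).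
Proof.
apply/funext => s; apply: eq_bigr => i _.
by congr (_ * phi _); apply/continuousEP.
Qed.

Fact cocycle_pullback_subproof (n : nat) (z : cocycles n Y) :
  cochain_pullback z \in @cocycle n X.
Proof.
rewrite cocycleE coboundary_pullback; apply/eqP/funext => s.
by have := cocycle_valP z; rewrite cocycleE /cochain_pullback => /eqP ->.
Qed.

Definition cocycle_pullback (n : nat) (z : cocycles n Y) : cocycles n X :=
  Cocycle (cocycle_pullback_subproof z).

(* The class of the pullback of a representative cocycle; it does not depend on
   the representative, by [pullback_pi]. *)
Definition pullback (n : nat) (a : cohomology n Y) : cohomology n X :=
  \pi_(cohomology n X) (cocycle_pullback (repr a)).

Lemma pullback_pi (n : nat) (z : cocycles n Y) :
  pullback (\pi_(cohomology n Y) z) =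
  \pi_(cohomology n X) (cocycle_pullback z).
Proof.
have /eqP : repr (\pi_(cohomology n Y) z) = z %[mod cohomology n Y].
  by rewrite reprK.
rewrite -[_ == _]Quotient.idealrBE => /asboolP zb.
apply/eqP; rewrite /pullback -[_ == _]Quotient.idealrBE; apply/asboolP.
case: n z zb => [|n] z /= => [zb|[psi zb]].
  by apply/funext => s; rewrite -[LHS]/((_ - _ : cochain R 0 Y) _) zb.
exists (cochain_pullback psi); rewrite coboundary_pullback -zb.
by apply/funext.
Qed.

End Pullback.
End Cohomology.

Definition cyclic_subgroup (A : zmodType) (b : A) : set A :=
  [set b *~ z | z in [set: int]].

Definition coset (A : zmodType) (S : set A) (x : A) : set A :=
  [set x + s | s in S].

Definition has_index (A : zmodType) (S : set A) (m : nat) : Prop :=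
  ([set coset S x | x in [set: A]] #= `I_m)%card.

(* [Ck_on k D f] is meaningful when [D] is open; the directional derivative
   ['D_v f x] then only depends on [f] near [x]. *)
Fixpoint Ck_on (R : realType) (V W : normedModType R) (k : nat) (D : set V)
    (f : V -> W) : Prop :=
  if k is k'.+1 then
    (forall x, D x -> differentiable f x) /\ (forall v, Ck_on k' D ('D_v f))
  else forall x, D x -> {for x, continuous f}.

Definition smooth_on (R : realType) (V W : normedModType R) (D : set V)
    (f : V -> W) : Prop :=
  forall k, Ck_on k D f.

(* [chart_map] is a homeomorphism from the open set [chart_dom] onto the open
   set [chart_cod], with inverse [chart_inv]; the values of [chart_map] off
   [chart_dom] and of [chart_inv] off [chart_cod] are irrelevant. *)
Record chart (R : realType) (d : nat) (M : topologicalType) := Chart {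
  chart_dom : set M;
  chart_cod : set 'rV[R]_d;
  chart_map : M -> 'rV[R]_d;
  chart_inv : 'rV[R]_d -> M;
  chart_dom_open : open chart_dom;
  chart_cod_open : open chart_cod;
  chart_map_cod : forall x, chart_dom x -> chart_cod (chart_map x);
  chart_inv_dom : forall y, chart_cod y -> chart_dom (chart_inv y);
  chart_mapK : forall x, chart_dom x -> chart_inv (chart_map x) = x;
  chart_invK : forall y, chart_cod y -> chart_map (chart_inv y) = y;
  chart_map_continuous : {within chart_dom, continuous chart_map};
  chart_inv_continuous : {within chart_cod, continuous chart_inv}
}.

(* Real, finite dimensional, Hausdorff and second countable. Continuity of the
   operations is required separately: it makes the sets on which their chart
   expressions are required to be smooth open. *)
HB.mixin Record isLieGroup (R : realType) (d : nat) G
    of Group G & Topological G := {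
  lie_hausdorff : hausdorff_space G;
  lie_second_countable : @second_countable G;
  lie_mul_continuous : continuous (fun p : G * G => (p.1 * p.2)%g);
  lie_inv_continuous : continuous (fun x : G => (x^-1)%g);
  lie_atlas : set (chart R d G);
  lie_atlas_cover : forall x : G, exists2 c, lie_atlas c & chart_dom c x;
  lie_transition_smooth : forall c c', lie_atlas c -> lie_atlas c' ->
    smooth_on [set y | chart_cod c y /\ chart_dom c' (chart_inv c y)]
      (fun y => chart_map c' (chart_inv c y));
  lie_mul_smooth : forall c1 c2 c3,
    lie_atlas c1 -> lie_atlas c2 -> lie_atlas c3 ->
    smooth_on
      [set p : 'rV[R]_d * 'rV[R]_d | [/\ chart_cod c1 p.1, chart_cod c2 p.2 &
        chart_dom c3 (chart_inv c1 p.1 * chart_inv c2 p.2)%g]]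
      (fun p : 'rV[R]_d * 'rV[R]_d =>
         chart_map c3 (chart_inv c1 p.1 * chart_inv c2 p.2)%g);
  lie_inv_smooth : forall c c', lie_atlas c -> lie_atlas c' ->
    smooth_on [set y | chart_cod c y /\ chart_dom c' (chart_inv c y)^-1%g]
      (fun y => chart_map c' (chart_inv c y)^-1%g)
}.

#[short(type="lieGroupType")]
HB.structure Definition LieGroup (R : realType) (d : nat) :=
  {G of isLieGroup R d G & Group G & Topological G}.

Record continuous_action (R : realType) (d : nat) (G : lieGroupType R d)
    (U : topologicalType) := ContinuousAction {
  act :> G -> U -> U;
  act1 : forall x, act 1%g x = x;
  actM : forall g h x, act (g * h)%g x = act g (act h x);
  act_continuous : continuous (fun p : G * U => act p.1 p.2)
}.

Definition stabiliser (R : realType) (d : nat) (G : lieGroupType R d)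
    (U : topologicalType) (a : continuous_action G U) (x : U) : set G :=
  [set g | a g x = x].

Lemma orbit_continuous (R : realType) (d : nat) (G : lieGroupType R d)
    (U : topologicalType) (a : continuous_action G U) (x : U) :
  continuous (fun g => a g x).
Proof.
move=> g; apply: (@continuous_comp _ _ _ (fun g : G => (g, x))
  (fun p : G * U => a p.1 p.2)); last exact: act_continuous.
by apply: cvg_pair => //=; exact: cvg_cst.
Qed.

Definition orbit_map (R : realType) (d : nat) (G : lieGroupType R d)
    (U : topologicalType) (a : continuous_action G U) (x : U) :
    continuousType G U :=
  mkcts (@orbit_continuous R d G U a x).

Definition path_connected (R : realType) (U : topologicalType) : Prop :=
  forall x y : U, exists gamma : R -> U,
    [/\ {within `[0, 1], continuous gamma}, gamma 0 = x & gamma 1 = y].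

(* Main.v *)
Require Import Defs.
From HB Require Import structures.
From mathcomp Require Import all_boot all_order all_algebra.
From mathcomp Require Import finmap.
From mathcomp Require Import generic_quotient ring_quotient.
From mathcomp Require Import all_classical all_reals all_analysis.
From mathcomp Require Import zify ring.
Import Order.TTheory GRing.Theory Num.Theory.
Import numFieldNormedType.Exports.
Set Implicit Arguments.
Unset Strict Implicit.
Unset Printing Implicit Defensive.
Local Open Scope classical_set_scope.
Local Open Scope ring_scope.

(* Let n be the order of G_x. As orbit maps are homotopic, the class O^*(a) is
   represented by the pullback phi along the orbit map at x, which is invariant
   under right translation by G_x.

   Divisibility by n. G is covered by finitely many families (colours) of open
   sets, each with a G_x-equivariant function G -> G_x constant on its members.
   Since H^j(G) = 0 for j > k, a dimension shift along the colours shows that an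
   invariant k-cocycle is a sum over h in G_x of the right translates of one
   cocycle psi. Translations are homotopic to the identity, so [phi] = n [psi].

   Infinite order. If [psi] had finite order, the exponent of H^k(G) would be
   bounded, so there would be a prime l, a class [a] outside l H^k(G), and
   [a'] <> 0 with l a' = d u. Take a chain z, a cycle modulo l, with z(a) prime to
   l, and evaluate on z, in the first factor of G x G, the cochain
   Psi = pr_1^* u cup (g h^-1)^* a and its pullback under (g, h) |-> (g h, h).
   Because H^j(G x Delta^i) = 0 for j > k, the two results differ by a coboundary
   modulo l; modulo l and coboundaries the first is a cocycle and the second is
   z(a) u. Applying d and dividing by l, z(a) a' is a coboundary: contradiction.

   Hence every coset of <[psi]> consists of n cosets of <n [psi]>, and n divides
   the index m. *)

(** On [H^k(G)] only non-vanishing and a finite index are assumed, not an isomorphism with Z, so the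
    infinite order of [[psi]] has to be derived. No fundamental class or Kuenneth formula is at
    hand; both halves compute with cochains, from vanishing above [k] and the homotopies that
    connectedness provides. For divisibility, equivariant cochains replace cochains on the quotient
    by [G_x], and what is needed is their exactness above degree [k]. An equivariant map from [G] to
    [G_x] would give it at once, but on a connected group it is not continuous when [G_x] is
    non-trivial. Each colour supplies one that is constant on the members of that colour, at the
    price of one more coefficient module. Once all colours are used, the cocycle vanishes on small
    simplices, and iterated subdivision yields an equivariant primitive. For the torsion, the shear
    stands in for an orientation: the slant product with [z] along the first factor sees only the
    action of translations on [H^k(G)], and this is trivial. *)

Lemma fct_subE (T : Type) (V : zmodType) (f g : T -> V) x :
  (f - g) x = f x - g x.
Proof. by []. Qed.

Lemma fct_addE (T : Type) (V : zmodType) (f g : T -> V) x :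
  (f + g) x = f x + g x.
Proof. by []. Qed.

(** * Barycentric subdivision *)

(* An ordered n-simplex is encoded by a sequence of vertices, of which only the
   terms of index at most n matter (see [tail_free]); the coboundary of n-cochains
   is then [alt n.+2]. *)
Section OrderedSimplices.
Variables (P : Type) (V : zmodType).
Implicit Types (f g : (nat -> P) -> V) (v w : nat -> P).

Definition vcons (b : P) (v : nat -> P) : nat -> P :=
  fun i => if i is j.+1 then v j else b.

Definition alt (m : nat) f : (nat -> P) -> V :=
  fun v => \sum_(i < m) f (v \o bump i) *~ (-1) ^+ i.

Lemma bump0E : bump 0 = succn.
Proof. by []. Qed.

Lemma vcons_bumpS (b : P) v i : vcons b v \o bump i.+1 = vcons b (v \o bump i).
Proof. by apply/funext => -[|j] //=; rewrite bumpS. Qed.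

Lemma vconsE v : v = vcons (v 0%N) (v \o succn).
Proof. by apply/funext => -[]. Qed.

Lemma alt0 f : alt 0 f = 0.
Proof. by apply/funext => v; rewrite /alt big_ord0. Qed.

Lemma altB m f g : alt m (f - g) = alt m f - alt m g.
Proof.
apply/funext => v; rewrite /alt !fctE -sumrB; apply: eq_bigr => i _.
by rewrite -mulrzBl.
Qed.

Lemma altD m f g : alt m (f + g) = alt m f + alt m g.
Proof.
apply/funext => v; rewrite /alt !fctE -big_split/=; apply: eq_bigr => i _.
by rewrite -mulrzDl.
Qed.

Lemma altSE m f v : alt m.+1 f v =
  f (v \o succn) - alt m (f \o vcons (v 0%N)) (v \o succn).
Proof.
rewrite /alt big_ord_recl/= expr0 mulr1z bump0E; congr (_ + _).
rewrite -sumrN; apply: eq_bigr => i _; rewrite exprS mulN1r mulrNz.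
by rewrite [in LHS](vconsE v) vcons_bumpS.
Qed.

(** Coning off from [b] is a contracting homotopy for the alternating sum. As subdivision is an
    iterated cone, [sd_alt] and [sdh_homotopy] both rest on this identity. *)
Lemma alt_vcons m f b : alt m.+1 f \o vcons b = f - alt m (f \o vcons b).
Proof. by apply/funext => v; rewrite /= altSE. Qed.

Lemma alt_alt m f : alt m.+1 (alt m f) = 0.
Proof.
elim: m f => [|m IH] f; apply/funext => v.
  by rewrite alt0 /alt big1// => i _; rewrite mul0rz.
rewrite altSE alt_vcons altB !fctE subKr.
exact: (congr1 (@^~ (v \o succn)) (IH _)).
Qed.

Definition tail_free (n : nat) f := forall v w,
  (forall i, (i <= n)%N -> v i = w i) -> f v = f w.

Lemma tail_free_vcons n f b : tail_free n.+1 f -> tail_free n (f \o vcons b).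
Proof. by move=> tf v w vw; apply: tf => -[|i] //= /vw. Qed.

Lemma bump_le n i j : (j <= n)%N -> (bump i j <= n.+1)%N.
Proof. by rewrite /bump => jn; case: (i <= j)%N; rewrite ?add1n ?add0n // leqW. Qed.

Lemma tail_free_alt n f m : tail_free n f -> tail_free n.+1 (alt m f).
Proof.
move=> tf v w vw; apply: eq_bigr => i _; congr (_ *~ _).
by apply: tf => j jn; apply: vw; exact: bump_le.
Qed.

Variable bary : nat -> (nat -> P) -> P.

(* Evaluation on the barycentric subdivision, the cone from the barycentre over
   the subdivided boundary, and on the homotopy from it to the identity. *)
Fixpoint sd (n : nat) f : (nat -> P) -> V :=
  if n is m.+1 then fun v => alt m.+2 (sd m (f \o vcons (bary n v))) v else f.

Fixpoint sdh (n : nat) f : (nat -> P) -> V :=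
  if n is m.+1 then fun v =>
    f (vcons (bary n v) v) - alt m.+2 (sdh m (f \o vcons (bary n v))) v
  else 0.

Lemma sdSE n f v : sd n.+1 f v = alt n.+2 (sd n (f \o vcons (bary n.+1 v))) v.
Proof. by []. Qed.

Lemma sdhSE n f v : sdh n.+1 f v = f (vcons (bary n.+1 v) v) -
  alt n.+2 (sdh n (f \o vcons (bary n.+1 v))) v.
Proof. by []. Qed.

Lemma sdB n f g : sd n (f - g) = sd n f - sd n g.
Proof.
elim: n f g => [|n IH] f g //; apply/funext => v; rewrite fct_subE !sdSE.
have -> : (f - g) \o vcons (bary n.+1 v) = (f \o vcons (bary n.+1 v)) - (g \o vcons (bary n.+1 v)) by [].
by rewrite IH altB.
Qed.

Lemma sdhB n f g : sdh n (f - g) = sdh n f - sdh n g.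
Proof.
elim: n f g => [|n IH] f g; first by rewrite /= subrr.
apply/funext => v; rewrite fct_subE !sdhSE.
have -> : (f - g) \o vcons (bary n.+1 v) = (f \o vcons (bary n.+1 v)) - (g \o vcons (bary n.+1 v)) by [].
by rewrite IH altB !fct_subE !opprD !opprK addrACA.
Qed.

Lemma sd_alt n f : sd n.+1 (alt n.+2 f) = alt n.+2 (sd n f).
Proof.
elim: n f => [|n IH] f; apply/funext => v; rewrite sdSE alt_vcons sdB altB.
  by rewrite alt_alt subr0.
by rewrite IH alt_alt subr0.
Qed.

Lemma sdh_homotopy n f :
  f - sd n f = sdh n (alt n.+2 f) + (if n is m.+1 then alt n.+1 (sdh m f) else 0).
Proof.
elim: n f => [|n IH] f; first by rewrite /= addr0 subrr.
apply/funext => v; rewrite !fctE sdSE sdhSE.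
set g := f \o vcons (bary n.+1 v).
have -> : alt n.+3 f (vcons (bary n.+1 v) v) = f v - alt n.+2 g v.
  exact: (congr1 (@^~ v) (alt_vcons n.+2 f (bary n.+1 v))).
have E : alt n.+2 (sdh n (alt n.+2 g)) = alt n.+2 g - alt n.+2 (sd n g).
  have /(congr1 (alt n.+2)) := IH g; rewrite altB => ->.
  by case: n {IH} @g => [|n] g; rewrite ?addr0// altD alt_alt addr0.
rewrite alt_vcons sdhB altB E !fct_subE.
rewrite -/g; move: (alt _ g v) (alt _ (sd n g) v) (alt _ (sdh _ _) v) => a b c.
by rewrite opprB !addrA subrK subrK.
Qed.

Hypothesis baryE : forall n v w,
  (forall i, (i <= n)%N -> v i = w i) -> bary n v = bary n w.

Lemma tail_free_sd n f : tail_free n f -> tail_free n (sd n f).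
Proof.
elim: n f => [|n IH] f tf // v w vw; rewrite !sdSE (baryE vw).
have H := @tail_free_alt n _ n.+2 (IH _ (tail_free_vcons (bary n.+1 w) tf)); exact: H.
Qed.

(** Faces [i] and [i.+1] coincide and cancel, and the other faces are again degenerate. Subdivision
    thus normalises cochains, which later removes most shuffles from the evaluation of a cup
    product. *)
Lemma sd_degenerate n f v i : (i < n)%N -> v i = v i.+1 -> sd n f v = 0.
Proof.
elim: n f v i => // n IH f v i ltin vi; rewrite sdSE.
set g := f \o _.
have lti : (i < n.+2)%N by rewrite ltnW.
have ltSi : (i.+1 < n.+2)%N by [].
have vE : v \o bump i = v \o bump i.+1.
  apply/funext => j; rewrite /= /bump.
  case: (ltngtP i j) => [ij|ij|<-]; last by rewrite add0n vi.
    by [].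
  by [].
rewrite /alt (bigD1 (Ordinal lti))//= (bigD1 (Ordinal ltSi))/=; last first.
  by rewrite -val_eqE /= eqn_leq ltnn.
rewrite big1 => [|j /andP[]]; last first.
  rewrite -!val_eqE /= => ji jSi; rewrite (_ : sd _ _ _ = 0) ?mul0rz//.
  case: (ltngtP j i) => [lt|gt|e]; last by rewrite e eqxx in ji.
    case: i ltin vi {lti ltSi vE ji jSi} lt => // i ltin vi lt.
    apply: (IH _ _ i) => //=; rewrite /bump.
    by rewrite -ltnS lt leqW//.
  have Sij : (i.+1 < j)%N by rewrite ltn_neqAle gt eq_sym jSi.
  apply: (IH _ _ i) => /=; first by have := ltn_ord j; lia.
  by rewrite /bump leqNgt gt leqNgt Sij.
by rewrite addr0 vE exprS mulN1r mulrNz subrr.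
Qed.

(** The vertices that [sdh] produces arise from those of [v] by taking barycentres, so they never
    leave a set [C] closed under this operation. The homotopy therefore preserves smallness. *)
Lemma sdh_hull n f v (C : set P) :
  (forall m w, (forall i, (i <= m)%N -> C (w i)) -> C (bary m w)) ->
  (forall i, (i <= n)%N -> C (v i)) ->
  (forall w, (forall i, (i <= n.+1)%N -> C (w i)) -> f w = 0) -> sdh n f v = 0.
Proof.
move=> Cb; elim: n f v => // n IH f v Cv f0; rewrite sdhSE.
rewrite f0 => [|[|i]//= lei]; [|exact: Cb|exact: Cv].
rewrite sub0r [X in - X]big1 ?oppr0// => i _; rewrite IH ?mul0rz// => [j lej|w Cw].
  by apply: Cv; exact: bump_le.
by apply: f0 => -[|j]//= lej; [exact: Cb|exact: Cw].
Qed.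

Section Mesh.
Variables (R : realFieldType) (dist : P -> P -> R).

Definition mesh n v D := forall i j, (i <= n)%N -> (j <= n)%N -> dist (v i) (v j) <= D.

Hypothesis distC : forall x y, dist x y = dist y x.
Hypothesis dist_hull : forall x r n v,
  (forall i, (i <= n)%N -> dist x (v i) <= r) -> dist x (bary n v) <= r.
Hypothesis distxx : forall x, dist x x = 0.
Hypothesis dist_bary : forall n v D, mesh n v D ->
  forall i, (i <= n)%N -> dist (bary n v) (v i) <= n%:R / n.+1%:R * D.

Let q n : R := n%:R / n.+1%:R.

Lemma mesh_ge0 n v D : mesh n v D -> 0 <= D.
Proof. by move=> /(_ 0%N 0%N isT isT); rewrite distxx. Qed.

Let qS n : q n <= q n.+1.
Proof.
rewrite /q ler_pdivrMr ?ltr0n// mulrAC ler_pdivlMr ?ltr0n//.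
by rewrite -!natrM ler_nat; lia.
Qed.

(** The clause on balls carries the induction: a ball about the new vertex [b] that contains a face
    of [v] also contains the subdivided face, which bounds the edges from [b] to it. *)
Lemma sd_mesh n f v D : mesh n v D ->
  (forall w, mesh n w (n%:R / n.+1%:R * D) ->
    (forall x r, (forall i, (i <= n)%N -> dist x (v i) <= r) ->
      forall i, (i <= n)%N -> dist x (w i) <= r) -> f w = 0) ->
  sd n f v = 0.
Proof.
elim: n f v => [|n IH] f v vD f0.
  by apply: f0 => // i j; rewrite !leqn0 => /eqP-> /eqP->; rewrite mul0r mul0r distxx.
have D0 := mesh_ge0 vD; set b := bary n.+1 v.
rewrite sdSE /alt big1// => i _; rewrite IH ?mul0rz// => [j k lej lek|w wD wv].
  by apply: vD; exact: bump_le.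
have bw j : (j <= n)%N -> dist b (w j) <= q n.+1 * D.
  by apply: wv => k lek; apply: dist_bary => //; exact: bump_le.
apply: f0 => [[|j] [|k]//= lej lek|x r vr [|j]//= lej].
- by rewrite distxx mulr_ge0 ?divr_ge0.
- exact: bw.
- by rewrite distC; exact: bw.
- by apply: le_trans (wD _ _ lej lek) _; apply: ler_wpM2r => //; exact: qS.
- exact: dist_hull.
- by apply: wv => // k lek; apply: vr; exact: bump_le.
Qed.

Lemma iter_sd_mesh n f v D N : mesh n v D ->
  (forall w, mesh n w ((n%:R / n.+1%:R) ^+ N * D) -> f w = 0) ->
  iter N (sd n) f v = 0.
Proof.
elim: N D v => [|N IH] D v vD f0 /=; first by apply: f0; rewrite mul1r.
apply: (sd_mesh vD) => w wD _; apply: (IH _ _ wD) => u uD; apply: f0.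
by rewrite exprSr -mulrA.
Qed.

End Mesh.
End OrderedSimplices.

Lemma sd_map (P Q : Type) (V : zmodType) (baryP : nat -> (nat -> P) -> P)
    (baryQ : nat -> (nat -> Q) -> Q) (h : P -> Q) n (f : (nat -> Q) -> V) v :
  (forall n v, baryQ n (h \o v) = h (baryP n v)) ->
  sd baryQ n f (h \o v) = sd baryP n (fun w => f (h \o w)) v.
Proof.
move=> hb; elim: n f v => [//|n IH] f v; rewrite !sdSE.
apply: eq_bigr => i _; congr (_ *~ _).
rewrite [LHS](IH _ (v \o bump i)); congr (sd _ _ _ _).
apply/funext => w /=; rewrite hb; congr (f _).
by apply/funext => -[].
Qed.

Lemma sdh_map (P Q : Type) (V : zmodType) (baryP : nat -> (nat -> P) -> P)
    (baryQ : nat -> (nat -> Q) -> Q) (h : P -> Q) n (f : (nat -> Q) -> V) v :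
  (forall n v, baryQ n (h \o v) = h (baryP n v)) ->
  sdh baryQ n f (h \o v) = sdh baryP n (fun w => f (h \o w)) v.
Proof.
move=> hb; have hc b w : vcons (h b) (h \o w) = h \o vcons b w.
  by apply/funext => -[].
elim: n f v => [//|n IH] f v; rewrite !sdhSE hb hc; congr (_ - _).
apply: eq_bigr => i _; congr (_ *~ _).
rewrite [LHS](IH _ (v \o bump i)); congr (sdh _ _ _ _).
by apply/funext => w /=; rewrite hc.
Qed.

(** * Products of simplices *)

Section Shuffles.
Local Notation label := (nat * nat)%type.
Local Notation path_of := (nat -> label).

Definition hmap (h : nat -> nat) (x : label) : label := (h x.1, x.2).
Definition vmap (h : nat -> nat) (x : label) : label := (x.1, h x.2).

Definition right (v : path_of) : path_of := vcons (0%N, 0%N) (hmap succn \o v).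
Definition up (v : path_of) : path_of := vcons (0%N, 0%N) (vmap succn \o v).

Definition lattice_path (p q : nat) (v : path_of) : Prop :=
  [/\ v 0%N = (0%N, 0%N), v (p + q)%N = (p, q) &
   forall i, (i < p + q)%N -> v i.+1 = hmap succn (v i) \/ v i.+1 = vmap succn (v i)].

Lemma lattice_path_right p q v : lattice_path p q v -> lattice_path p.+1 q (right v).
Proof.
move=> [v0 vpq vS]; split=> //=; first by rewrite vpq.
case=> [|i] lti /=; first by left; rewrite v0.
by have [->|->] := vS i lti; [left|right].
Qed.

Lemma lattice_path_up p q v : lattice_path p q v -> lattice_path p q.+1 (up v).
Proof.
move=> [v0 vpq vS]; split=> //=; first by rewrite addnS /= vpq.
rewrite addnS; case=> [|i] lti /=; first by right; rewrite v0.
by have [->|->] := vS i lti; [left|right].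
Qed.

Lemma lattice_path_mono p q v i j : lattice_path p q v -> (i <= j <= p + q)%N ->
  ((v i).1 <= (v j).1)%N /\ ((v i).2 <= (v j).2)%N.
Proof.
move=> [_ _ vS] /andP[]; elim: j => [|j IH].
  by rewrite leqn0 => /eqP->.
rewrite leq_eqVlt => /predU1P[->//|ij jpq].
have [i1 i2] := IH ij (ltnW jpq).
by have [->|->] := vS j jpq; rewrite /= ?(leqW i1) ?(leqW i2).
Qed.

Variable V : zmodType.
Implicit Types (f g : path_of -> V) (v w : path_of).

(* Signed sum over the lattice paths from (0, 0) to (p, q), sorted by their first
   step: the Eilenberg-Zilber map. *)
Fixpoint shuffle (p : nat) : nat -> (path_of -> V) -> V :=
  if p is p'.+1 then
    fix shuffle_p q f :=
      if q is q'.+1 then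
        shuffle p' q (f \o right) + shuffle_p q' (f \o up) *~ (-1) ^+ p
      else shuffle p' q (f \o right)
  else
    fix shuffle_0 q f :=
      if q is q'.+1 then shuffle_0 q' (f \o up) else f (fun=> (0%N, 0%N)).

Arguments shuffle : simpl never.

Lemma shuffle00 f : shuffle 0 0 f = f (fun=> (0%N, 0%N)).
Proof. by []. Qed.

Lemma shuffle0S q f : shuffle 0 q.+1 f = shuffle 0 q (f \o up).
Proof. by []. Qed.

Lemma shuffleS0 p f : shuffle p.+1 0 f = shuffle p 0 (f \o right).
Proof. by []. Qed.

Lemma shuffleSS p q f : shuffle p.+1 q.+1 f =
  shuffle p q.+1 (f \o right) + shuffle p.+1 q (f \o up) *~ (-1) ^+ p.+1.
Proof. by []. Qed.

Lemma shuffle_ind (Q : nat -> nat -> Prop) :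
  Q 0%N 0%N -> (forall q, Q 0%N q -> Q 0%N q.+1) ->
  (forall p, Q p 0%N -> Q p.+1 0%N) ->
  (forall p q, Q p q.+1 -> Q p.+1 q -> Q p.+1 q.+1) -> forall p q, Q p q.
Proof.
move=> Q00 Q0S QS0 QSS; elim=> [|p IHp]; elim=> [|q IHq]; auto.
Qed.

Lemma eq_shuffle p q f g : (forall v, lattice_path p q v -> f v = g v) ->
  shuffle p q f = shuffle p q g.
Proof.
move: p q f g; apply: shuffle_ind => [|q IH|p IH|p q IH1 IH2] f g fg.
- by rewrite !shuffle00; apply: fg.
- by rewrite !shuffle0S; apply: IH => v /lattice_path_up/fg.
- by rewrite !shuffleS0; apply: IH => v /lattice_path_right/fg.
- rewrite !shuffleSS; congr (_ + _ *~ _).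
    by apply: IH1 => v /lattice_path_right/fg.
  by apply: IH2 => v /lattice_path_up/fg.
Qed.

Lemma shuffleB p q f g : shuffle p q (f - g) = shuffle p q f - shuffle p q g.
Proof.
move: p q f g; apply: shuffle_ind => [|q IH|p IH|p q IH1 IH2] f g //.
- by rewrite !shuffle0S -IH.
- by rewrite !shuffleS0 -IH.
- by rewrite !shuffleSS opprD addrACA -mulrzBl -IH1 -IH2.
Qed.

Lemma shuffle0 p q : shuffle p q 0 = 0.
Proof. by rewrite -[X in shuffle _ _ X](subrr 0) shuffleB subrr. Qed.

Lemma shuffle_eq0 p q f : (forall v, lattice_path p q v -> f v = 0) ->
  shuffle p q f = 0.
Proof. by move=> f0; rewrite (@eq_shuffle _ _ f 0) ?shuffle0. Qed.

Definition face_left p q f : V :=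
  if p is p'.+1 then
    \sum_(i < p.+1) shuffle p' q (f \o comp (hmap (bump i))) *~ (-1) ^+ i
  else 0.

Definition face_right p q f : V :=
  if q is q'.+1 then
    \sum_(i < q.+1) shuffle p q' (f \o comp (vmap (bump i))) *~ (-1) ^+ i
  else 0.

Lemma right_hmapS v i : hmap (bump i.+1) \o right v = right (hmap (bump i) \o v).
Proof. by apply/funext => -[|j] //=; rewrite /hmap /= bumpS. Qed.

Lemma right_vmapS v i : vmap (bump i.+1) \o right v = right (vmap (bump i.+1) \o v).
Proof. by apply/funext => -[|j]. Qed.

Lemma up_vmapS v i : vmap (bump i.+1) \o up v = up (vmap (bump i) \o v).
Proof. by apply/funext => -[|j] //=; rewrite /vmap /= bumpS. Qed.

Lemma up_hmapS v i : hmap (bump i.+1) \o up v = up (hmap (bump i.+1) \o v).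
Proof. by apply/funext => -[|j]. Qed.

Lemma face_leftSE p q f : face_left p.+1 q f =
  shuffle p q (f \o comp (hmap succn)) -
  \sum_(i < p.+1) shuffle p q (f \o comp (hmap (bump i.+1))) *~ (-1) ^+ i.
Proof.
rewrite /face_left big_ord_recl expr0 mulr1z -sumrN; congr (_ + _).
by apply: eq_bigr => i _; rewrite exprS mulN1r mulrNz.
Qed.

Lemma face_rightSE p q f : face_right p q.+1 f =
  shuffle p q (f \o comp (vmap succn)) -
  \sum_(i < q.+1) shuffle p q (f \o comp (vmap (bump i.+1))) *~ (-1) ^+ i.
Proof.
rewrite /face_right big_ord_recl expr0 mulr1z -sumrN; congr (_ + _).
by apply: eq_bigr => i _; rewrite exprS mulN1r mulrNz.
Qed.

Lemma alt_right m f : alt m.+1 f \o right =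
  (f \o comp (hmap succn)) - (alt m (f \o vcons (0%N, 0%N)) \o comp (hmap succn)).
Proof.
by rewrite (_ : alt m.+1 f \o right = (alt m.+1 f \o vcons (0%N, 0%N)) \o comp (hmap succn))// alt_vcons.
Qed.

Lemma alt_up m f : alt m.+1 f \o up =
  (f \o comp (vmap succn)) - (alt m (f \o vcons (0%N, 0%N)) \o comp (vmap succn)).
Proof.
by rewrite (_ : alt m.+1 f \o up = (alt m.+1 f \o vcons (0%N, 0%N)) \o comp (vmap succn))// alt_vcons.
Qed.

Let sum_left p q f : V :=
  \sum_(i < p.+1) shuffle p q (f \o comp (hmap (bump i.+1))) *~ (-1) ^+ i.

Let sum_right p q f : V :=
  \sum_(i < q.+1) shuffle p q (f \o comp (vmap (bump i.+1))) *~ (-1) ^+ i.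

Let comp_hmap_right f i :
  (f \o comp (hmap (bump i.+1))) \o right = (f \o right) \o comp (hmap (bump i)).
Proof. by apply/funext => v /=; rewrite right_hmapS. Qed.

Let comp_vmap_right f i :
  (f \o comp (vmap (bump i.+1))) \o right = (f \o right) \o comp (vmap (bump i.+1)).
Proof. by apply/funext => v /=; rewrite right_vmapS. Qed.

Let comp_vmap_up f i :
  (f \o comp (vmap (bump i.+1))) \o up = (f \o up) \o comp (vmap (bump i)).
Proof. by apply/funext => v /=; rewrite up_vmapS. Qed.

Let comp_hmap_up f i :
  (f \o comp (hmap (bump i.+1))) \o up = (f \o up) \o comp (hmap (bump i.+1)).
Proof. by apply/funext => v /=; rewrite up_hmapS. Qed.

Let sum_leftS0 p f : sum_left p.+1 0 f = face_left p.+1 0 (f \o right).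
Proof. by apply: eq_bigr => i _; rewrite shuffleS0 comp_hmap_right. Qed.

Let sum_right0S q f : sum_right 0 q.+1 f = face_right 0 q.+1 (f \o up).
Proof. by apply: eq_bigr => i _; rewrite shuffle0S comp_vmap_up. Qed.

Let sum_leftSS p q f : sum_left p q.+1 f =
  face_left p q.+1 (f \o right) + sum_left p q (f \o up) *~ (-1) ^+ p.
Proof.
case: p => [|p].
  rewrite /face_left add0r expr0 mulr1z; apply: eq_bigr => i _.
  by rewrite shuffle0S comp_hmap_up.
rewrite /sum_left mulrz_suml -big_split/=; apply: eq_bigr => i _.
rewrite -mulrzA [_ * _ ^+ p.+1]mulrC mulrzA -mulrzDl.
by rewrite shuffleSS comp_hmap_right comp_hmap_up.
Qed.

Let sum_rightSS p q f : sum_right p.+1 q f =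
  sum_right p q (f \o right) + face_right p.+1 q (f \o up) *~ (-1) ^+ p.+1.
Proof.
case: q => [|q].
  rewrite /face_right mul0rz addr0; apply: eq_bigr => i _.
  by rewrite shuffleS0 comp_vmap_right.
rewrite /sum_right /face_right mulrz_suml -big_split/=; apply: eq_bigr => i _.
rewrite -mulrzA [_ * _ ^+ p.+1]mulrC mulrzA -mulrzDl.
by rewrite shuffleSS comp_vmap_right comp_vmap_up.
Qed.

Lemma tail_free_right n f : tail_free n.+1 f -> tail_free n (f \o right).
Proof. by move=> tf v w vw; apply: tf => -[|i] //= /vw ->. Qed.

Lemma tail_free_up n f : tail_free n.+1 f -> tail_free n (f \o up).
Proof. by move=> tf v w vw; apply: tf => -[|i] //= /vw ->. Qed.

(** Leibniz rule, by induction on the first step of the path. Removing the origin gives the zeroth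
    faces of the two factors, removing a first corner gives terms that cancel in pairs, and the
    faces further along come from the induction hypothesis. *)
Lemma shuffle_boundary p q n f : (p + q = n.+1)%N -> tail_free n f ->
  shuffle p q (alt n.+2 f) = face_left p q f + face_right p q f *~ (-1) ^+ p.
Proof.
move: p q n f; apply: shuffle_ind => [//|q IH|p IH|p q IH1 IH2] n f pq tf.
- rewrite shuffle0S alt_up shuffleB face_rightSE -/(sum_right 0 q f).
  rewrite expr0 mulr1z add0r; congr (_ - _).
  case: q => [|q] in IH pq *.
    case: n => [|n] // in pq tf *.
    rewrite /sum_right shuffle00 big_ord_recl big_ord0 addr0 expr0 mulr1z shuffle00.
    by rewrite /= /alt big_ord_recl big_ord0 addr0 expr0 mulr1z; apply: tf => -[].
  case: n => [|n] // in pq tf *; rewrite sum_right0S.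
  have := IH n (f \o up); rewrite /face_left add0r expr0 mulr1z => <- //.
    lia.
  exact: tail_free_up.
- rewrite shuffleS0 alt_right shuffleB face_leftSE -/(sum_left p 0 f).
  rewrite mul0rz addr0; congr (_ - _).
  case: p => [|p] in IH pq *.
    case: n => [|n] // in pq tf *.
    rewrite /sum_left shuffle00 big_ord_recl big_ord0 addr0 expr0 mulr1z shuffle00.
    by rewrite /= /alt big_ord_recl big_ord0 addr0 expr0 mulr1z; apply: tf => -[].
  case: n => [|n] // in pq tf *; rewrite sum_leftS0.
  have := IH n (f \o right); rewrite /face_right mul0rz addr0 => <- //.
    lia.
  exact: tail_free_right.
- case: n => [|n] // in pq tf *; first lia.
  rewrite shuffleSS alt_right alt_up !shuffleB.
  rewrite (IH1 n (f \o right)) ?(IH2 n (f \o up)); first last.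
  + exact: tail_free_right.
  + lia.
  + exact: tail_free_up.
  + lia.
  rewrite [in RHS]face_leftSE [in RHS]face_rightSE.
  rewrite -/(sum_left p q.+1 f) -/(sum_right p.+1 q f) sum_leftSS sum_rightSS.
  rewrite (face_leftSE p q (f \o up)) (face_rightSE p q (f \o right)).
  rewrite -/(sum_left p q (f \o up)) -/(sum_right p q (f \o right)).
  (* Deleting the corner (1, 0) of a path that goes right and up, or the corner (0, 1) of one that
     goes up and right, leaves the same vertices; the two terms have opposite signs. *)
  rewrite -[(f \o right) \o _]/((f \o up) \o comp (hmap succn)).
  rewrite exprS mulN1r !mulrNz !mulrzBl.
  rewrite -/(sum_left p q (f \o up)) -/(sum_right p q (f \o right)).
  rewrite !opprB !opprD !opprK !addrA [X in X + _ - _ - _ - _]addrAC subrK.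
  by rewrite [X in X - _ - _]addrAC.
Qed.

(** One horizontal step remains to be shuffled because, in the cup product to come, [u] uses up all
    but one of the horizontal steps. *)
Lemma shuffle_right_first p q f :
  (forall v, lattice_path p.+1 q v ->
    (exists2 i, (i < p)%N & (v i.+1).1 = (v i).1) -> f v = 0) ->
  shuffle p.+1 q f = shuffle 1 q (iter p (fun g => g \o right) f).
Proof.
elim: p f => [//|p IH] f f0.
have -> : shuffle p.+2 q f = shuffle p.+1 q (f \o right).
  case: q f0 {IH} => [//|q] f0.
  rewrite shuffleSS [X in _ + X *~ _]shuffle_eq0 ?mul0rz ?addr0// => v pv /=.
  apply: f0; first exact: lattice_path_up.
  by exists 0%N => //=; case: pv => ->.
rewrite IH ?iterSr// => v pv [i lti vi] /=.
apply: f0; first exact: lattice_path_right.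
by exists i.+1 => //=; rewrite vi.
Qed.

Definition up_then_right (q : nat) : path_of := fun i => ((i - q)%N, minn i q).

Lemma up_up_then_right q : up (up_then_right q) = up_then_right q.+1.
Proof.
by apply/funext => -[|i] //=; rewrite /up_then_right /vmap /= subSS minnSS.
Qed.

Lemma shuffle_up_first p q f : tail_free (p + q) f ->
  (forall v, lattice_path p q v ->
    (exists2 i, (q <= i < p + q)%N & (v i.+1).1 = (v i).1) -> f v = 0) ->
  shuffle p q f = f (up_then_right q) *~ (-1) ^+ (p * q).
Proof.
move: p q f; apply: shuffle_ind => [|q IH|p IH|p q IH1 IH2] f tf f0.
- by rewrite shuffle00 mulr1z; apply: tf => -[].
- rewrite shuffle0S IH /= ?up_up_then_right// => [|v pv [i]].
    exact: tail_free_up.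
  by rewrite leqNgt ltnNge; lia.
- rewrite shuffleS0 IH; first last.
  + move=> v pv [i lti vi] /=; apply: f0; first exact: lattice_path_right.
    by exists i.+1; [lia|rewrite /= vi].
  + exact: tail_free_right.
  rewrite !muln0 /=; congr (_ *~ _); apply: tf => -[|i] //= lei.
  by rewrite /up_then_right /hmap /= !subn0 !minn0.
- rewrite shuffleSS (@shuffle_eq0 p q.+1) => [|v pv /=]; last first.
    have pv' := lattice_path_right pv; apply: f0 => //.
    (* If the last [p.+1] steps were all horizontal, they would exhaust the horizontal steps,
       although the first step already goes to the right. *)
    apply: contrapT => noi.
    have steps j : (j <= p.+1)%N -> ((right v (q.+1 + j)).1 = (right v q.+1).1 + j)%N.
      elim: j => [|j IHj] ltj; first by rewrite !addn0.
      rewrite !addnS -IHj; last exact: ltnW.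
      have [_ _ /(_ (q.+1 + j)%N)] := pv'; rewrite (_ : (_ < _)%N); last by lia.
      move=> /(_ isT)[->//|vS]; case: noi.
      exists (q.+1 + j)%N; first lia.
      by rewrite vS.
    have := steps p.+1 (leqnn _); have [_ vpq _] := pv'.
    rewrite addnC vpq /= => e.
    have [m _] := @lattice_path_mono _ _ _ 1 q.+1 pv' ltac:(lia).
    by move: m e; case: pv => /= -> _ _; rewrite /=; lia.
  rewrite add0r IH2; first last.
  + move=> v pv [i lti vi] /=; apply: f0; first exact: lattice_path_up.
    by exists i.+1 => //=; lia.
  + by apply: tail_free_up; rewrite -addnS.
  rewrite /= up_up_then_right -mulrzA -exprD; congr (_ *~ (_ ^+ _)); lia.
Qed.

End Shuffles.

(** * Singular cochains *)

Section AffineSimplices.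
Variable R : realType.
Local Notation simplex := (simplex R).

Definition vertex_row (n i : nat) : 'rV[R]_n.+1 := \row_j (nat_of_ord j == minn i n)%:R.

Lemma vertex_row_simplex n i : simplex n (vertex_row n i).
Proof.
split=> [j|]; first by rewrite mxE ler0n.
have lti : (minn i n < n.+1)%N by rewrite ltnS geq_minr.
rewrite (bigD1 (Ordinal lti))//= mxE eqxx big1 ?addr0// => j ji.
by rewrite mxE (_ : _ == _ = false)//; apply/negbTE.
Qed.

(* The last vertex when [i > n]. *)
Definition vertex (n i : nat) : simplex n :=
  exist _ (vertex_row n i) (mem_set (vertex_row_simplex n i)).

Definition affine_row (n m : nat) (v : nat -> simplex m) (s : 'rV[R]_n.+1) : 'rV[R]_m.+1 :=
  \sum_(i < n.+1) s ord0 i *: set_val (v i).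

Lemma affine_row_simplex n m (v : nat -> simplex m) s :
  simplex n s -> simplex m (affine_row v s).
Proof.
move=> [s0 s1]; split=> [j|].
  rewrite summxE sumr_ge0// => i _; rewrite mxE mulr_ge0//.
  by have [+ _] := set_valP (v i); exact.
under eq_bigr do rewrite summxE.
rewrite exchange_big/= -[RHS]s1; apply: eq_bigr => i _.
under eq_bigr do rewrite mxE.
by rewrite -mulr_sumr; have [_ ->] := set_valP (v i); rewrite mulr1.
Qed.

Definition affine_fun (n m : nat) (v : nat -> simplex m) (s : simplex n) : simplex m :=
  exist _ (affine_row v (set_val s)) (mem_set (affine_row_simplex v (set_valP s))).

Lemma affine_row_continuous n m (v : nat -> simplex m) : continuous (@affine_row n m v).
Proof.
apply: continuous_mx => i j s.
rewrite (_ : (fun x => _) = (fun x : 'rV[R]_n.+1 =>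
    \sum_(k < n.+1) x ord0 k * (set_val (v k) : 'rV[R]_m.+1) i j)); last first.
  by apply/funext => x; rewrite summxE; apply: eq_bigr => k _; rewrite mxE.
have ck k (c : R) : continuous (fun x : 'rV[R]_n.+1 => x ord0 k * c).
  have cc : continuous (fun x : 'rV[R]_n.+1 => x ord0 k) by exact: coord_continuous.
  by move=> x; apply: (@cvgMr_tmp _ _ (nbhs x)); exact: cc.
exact: (@continuous_big _ _ _ _ predT add_continuous _ _
  (fun k (x : 'rV[R]_n.+1) => x ord0 k * (set_val (v k) : 'rV[R]_m.+1) i j)).
Qed.

Lemma affine_continuous n m (v : nat -> simplex m) : continuous (@affine_fun n m v).
Proof.
apply: (@continuous_comp_initial _ _ _ set_val) => x.
apply: (@continuous_comp _ _ _ set_val (affine_row v)).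
  exact: initial_continuous.
exact: affine_row_continuous.
Qed.

Definition affine (n m : nat) (v : nat -> simplex m) : continuousType (simplex n) (simplex m) :=
  mkcts (@affine_continuous n m v).

Lemma simplex_eq n (x y : simplex n) : set_val x = set_val y -> x = y.
Proof. exact: val_inj. Qed.

Lemma affineE n m (v : nat -> simplex m) s :
  set_val (affine n v s) = \sum_(i < n.+1) (set_val s : 'rV[R]_n.+1) ord0 i *: set_val (v i).
Proof. by []. Qed.

Lemma eq_affine n m (v w : nat -> simplex m) :
  (forall i, (i <= n)%N -> v i = w i) -> affine n v = affine n w.
Proof.
move=> vw; apply/continuousEP => s; apply: simplex_eq; rewrite !affineE.
by apply: eq_bigr => i _; rewrite vw// -ltnS.
Qed.

Lemma affine_vertex n m (v : nat -> simplex m) i : affine n v (vertex n i) = v (minn i n).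
Proof.
apply: simplex_eq; rewrite affineE.
have lti : (minn i n < n.+1)%N by rewrite ltnS geq_minr.
rewrite (bigD1 (Ordinal lti))//= mxE eqxx scale1r big1 ?addr0// => j ji.
by rewrite mxE (_ : _ == _ = false) ?scale0r//; apply/negbTE.
Qed.

Lemma affine_comp n m p (v : nat -> simplex p) (w : nat -> simplex m) :
  affine m v \o affine n w = affine n (affine m v \o w) :> continuousType _ _.
Proof.
apply/continuousEP => s; apply: simplex_eq; rewrite [RHS]affineE [LHS]affineE /=.
under eq_bigr do rewrite summxE scaler_suml.
rewrite exchange_big/=; apply: eq_bigr => i _.
by rewrite /affine_row scaler_sumr; apply: eq_bigr => j _; rewrite scalerA mxE.
Qed.

Lemma affine_id n (s : simplex n) : affine n (vertex n) s = s.
Proof.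
apply: simplex_eq; rewrite affineE; apply/rowP => j; rewrite summxE (bigD1 j)//= !mxE.
rewrite (minn_idPl _) ?eqxx ?mulr1; last by rewrite -ltnS.
rewrite big1 ?addr0// => i ij; rewrite !mxE (minn_idPl _); last by rewrite -ltnS.
by rewrite eq_sym (_ : _ == _ = false) ?mulr0//; apply/negbTE.
Qed.

Lemma affine_face n m (v : nat -> simplex m) (i : 'I_n.+2) :
  affine n.+1 v \o @face R n i = affine n (v \o bump i) :> continuousType _ _.
Proof.
apply/continuousEP => s; apply: simplex_eq; rewrite [RHS]affineE [LHS]affineE /=.
rewrite (bigD1 i)//= mxE unlift_none scale0r add0r.
rewrite (reindex_omap (lift i) (unlift i))/=; last first.
  by move=> j; case: unliftP => [k ->|->]; rewrite ?eqxx.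
apply: eq_big => [k|k _]; last by rewrite mxE liftK.
by rewrite liftK eqxx andbT eq_sym neq_lift.
Qed.

Lemma vertex_face n (i : 'I_n.+2) j : (j <= n)%N ->
  face i (vertex n j) = vertex n.+1 (bump i j).
Proof.
move=> lej; apply: simplex_eq => /=; apply/rowP => k; rewrite !mxE.
have lebump : (bump i j <= n.+1)%N by exact: bump_le.
rewrite (minn_idPl lebump); case: unliftP => [l ->|->]; rewrite ?mxE.
  by rewrite (minn_idPl lej) /= (can_eq (@bumpK i)).
by rewrite (_ : _ == _ = false)//; apply/negbTE; rewrite neq_bump.
Qed.

End AffineSimplices.

Section Cochains.
Variables (R : realType) (V : zmodType).
Local Notation simplex := (simplex R).
Local Notation chains n X := (continuousType (simplex n) X).
Implicit Types X Y : topologicalType.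

(** Coefficients in any abelian group: dimension shifting needs groups of functions on [hs], and the
    acyclic models argument needs ['F_l]. *)
Definition dV n X (phi : chains n X -> V) : chains n.+1 X -> V :=
  fun s => \sum_(i < n.+2) phi (s \o @face R n i) *~ (-1) ^+ i.

(* The values of [phi] on the affine simplices inside [sigma]. *)
Definition pull n X (phi : chains n X -> V) m (sigma : chains m X) :
    (nat -> simplex m) -> V :=
  fun v => phi (sigma \o affine n v).

Lemma alt_pull n X (phi : chains n X -> V) m (sigma : chains m X) :
  alt n.+2 (pull phi sigma) = pull (dV phi) sigma.
Proof.
apply/funext => v; apply: eq_bigr => i _; congr (phi _ *~ _).
apply/continuousEP => s /=; congr (sigma _).
by have /continuousEP/(_ s)/= := affine_face v i.
Qed.

Lemma tail_free_pull n X (phi : chains n X -> V) m (sigma : chains m X) :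
  tail_free n (pull phi sigma).
Proof. by move=> v w vw; rewrite /pull (eq_affine vw). Qed.

Lemma pull_affine n X (phi : chains n X -> V) m p (sigma : chains m X) (w : nat -> simplex m) v :
  pull phi (sigma \o affine p w) v = pull phi sigma (affine p w \o v).
Proof.
congr (phi _); apply/continuousEP => s /=; congr (sigma _).
by have /continuousEP/(_ s)/= := affine_comp n w v.
Qed.

Lemma comp_affine_vertex n X (sigma : chains n X) : sigma \o affine n (@vertex R n) = sigma :> chains n X.
Proof. by apply/continuousEP => s /=; rewrite affine_id. Qed.

Lemma pull_vertex n X (phi : chains n X -> V) (sigma : chains n X) :
  pull phi sigma (@vertex R n) = phi sigma.
Proof. by rewrite /pull comp_affine_vertex. Qed.

Lemma dVE n X (phi : chains n X -> V) (sigma : chains n.+1 X) :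
  dV phi sigma = alt n.+2 (pull phi sigma) (@vertex R n.+1).
Proof. by rewrite alt_pull pull_vertex. Qed.

Lemma dVdV n X (phi : chains n X -> V) : dV (dV phi) = 0.
Proof. by apply/funext => s; rewrite dVE -alt_pull alt_alt. Qed.

Lemma dVB n X (phi psi : chains n X -> V) : dV (phi - psi) = dV phi - dV psi.
Proof.
apply/funext => v; rewrite /dV !fctE -sumrB; apply: eq_bigr => i _.
by rewrite -mulrzBl.
Qed.

Lemma dVD n X (phi psi : chains n X -> V) : dV (phi + psi) = dV phi + dV psi.
Proof.
apply/funext => v; rewrite /dV !fctE -big_split/=; apply: eq_bigr => i _.
by rewrite -mulrzDl.
Qed.

Lemma dV0 n X : dV (0 : chains n X -> V) = 0.
Proof. by rewrite -[X in dV X](subrr 0) dVB subrr. Qed.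

Lemma dVN n X (phi : chains n X -> V) : dV (- phi) = - dV phi.
Proof. by rewrite -sub0r dVB dV0 sub0r. Qed.

Lemma dVMz n X (phi : chains n X -> V) l : dV (fun s => phi s *~ l) = fun s => dV phi s *~ l.
Proof.
apply/funext => v; rewrite /dV mulrz_suml; apply: eq_bigr => i _.
by rewrite -!mulrzA mulrC.
Qed.

Lemma dV_comp n X Y (f : continuousType X Y) (phi : chains n Y -> V) :
  dV (fun s : chains n X => phi (f \o s)) = fun s => dV phi (f \o s).
Proof.
apply/funext => s; apply: eq_bigr => i _; congr (phi _ *~ _).
exact/continuousEP.
Qed.

Lemma barycenter_simplex n : simplex n (const_mx n.+1%:R^-1).
Proof.
split=> [i|]; first by rewrite mxE invr_ge0.
under eq_bigr do rewrite mxE.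
by rewrite sumr_const card_ord -[LHS]mulr_natl mulfV.
Qed.

Definition barycenter n : simplex n :=
  exist _ (const_mx n.+1%:R^-1 : 'rV[R]_n.+1) (mem_set (barycenter_simplex n)).

Definition bary m n (v : nat -> simplex m) : simplex m := affine n v (barycenter n).

Lemma eq_bary m n (v w : nat -> simplex m) :
  (forall i, (i <= n)%N -> v i = w i) -> bary n v = bary n w.
Proof. by move=> vw; rewrite /bary (eq_affine vw). Qed.

Lemma bary_affine m p (w : nat -> simplex p) n (v : nat -> simplex m) :
  bary n (affine m w \o v) = affine m w (bary n v).
Proof.
by have /continuousEP/(_ (barycenter n))/= := affine_comp n w v.
Qed.

Definition Sd n X (phi : chains n X -> V) : chains n X -> V :=
  fun s => sd (@bary n) n (pull phi s) (@vertex R n).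

Definition Sh n X (phi : chains n.+1 X -> V) : chains n X -> V :=
  fun s => sdh (@bary n) n (pull phi s) (@vertex R n).

Lemma affine_comp_vertex n m (v : nat -> simplex m) i : (i <= n)%N ->
  (affine n v \o @vertex R n) i = v i.
Proof. by move=> len; rewrite /= affine_vertex (minn_idPl len). Qed.

(** Subdivision commutes with restriction to affine simplices, so that the identities for ordered
    simplices carry over to singular ones. *)
Lemma pull_Sd n X (phi : chains n X -> V) m (s : chains m X) :
  pull (Sd phi) s = sd (@bary m) n (pull phi s).
Proof.
apply/funext => v; rewrite {1}/pull /Sd.
have -> : pull phi (s \o affine n v) = fun w => pull phi s (affine n v \o w).
  by apply/funext => w; rewrite pull_affine.
rewrite -(@sd_map _ _ _ (@bary n) (@bary m) (affine n v)); last by move=> *; exact: bary_affine.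
apply: (tail_free_sd (@eq_bary m) (@tail_free_pull _ _ _ _ _)) => i len.
exact: affine_comp_vertex.
Qed.

Lemma tail_free_sdh P (b : nat -> (nat -> P) -> P) n (f : (nat -> P) -> V) :
  (forall n v w, (forall i, (i <= n)%N -> v i = w i) -> b n v = b n w) ->
  tail_free n.+1 f -> tail_free n (sdh b n f).
Proof.
move=> bE; elim: n f => [|n IH] f tf // v w vw; rewrite !sdhSE (bE _ _ _ vw).
congr (_ - _); first by apply: tf => -[|i] //= /vw.
exact: (@tail_free_alt _ _ n _ n.+2 (IH _ (tail_free_vcons (b n.+1 w) tf))).
Qed.

Lemma pull_Sh n X (phi : chains n.+1 X -> V) m (s : chains m X) :
  pull (Sh phi) s = sdh (@bary m) n (pull phi s).
Proof.
apply/funext => v; rewrite {1}/pull /Sh.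
have -> : pull phi (s \o affine n v) = fun w => pull phi s (affine n v \o w).
  by apply/funext => w; rewrite pull_affine.
rewrite -(@sdh_map _ _ _ (@bary n) (@bary m) (affine n v)); last by move=> *; exact: bary_affine.
apply: (tail_free_sdh (@eq_bary m) (@tail_free_pull _ _ _ _ _)) => i len.
exact: affine_comp_vertex.
Qed.

Lemma dV_Sd n X (phi : chains n X -> V) : dV (Sd phi) = Sd (dV phi).
Proof.
by apply/funext => s; rewrite dVE pull_Sd -sd_alt alt_pull -pull_Sd pull_vertex.
Qed.

Lemma Sh_homotopy n X (phi : chains n X -> V) :
  phi - Sd phi = Sh (dV phi) + (if n is m.+1 return (chains n X -> V) -> chains n X -> V
    then fun phi => dV (Sh phi) else fun=> 0) phi.
Proof.
apply/funext => s; rewrite [LHS]fct_subE fct_addE.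
have := congr1 (@^~ (@vertex R n)) (sdh_homotopy (@bary n) n (pull phi s)).
rewrite alt_pull -pull_Sd -pull_Sh fct_subE !pull_vertex => ->.
rewrite fct_addE pull_vertex; congr (_ + _).
by case: n phi s => [|n] phi s //; rewrite dVE pull_Sh.
Qed.

End Cochains.

(** * Cochains that vanish on small simplices *)

Section SmallSimplices.
Variable R : realType.
Local Notation simplex := (simplex R).
Local Notation chains n X := (continuousType (simplex n) X).

Definition coords n (x : simplex n) : 'rV[R]_n.+1 := set_val x.

Lemma coords_vertex n i (j : 'I_n.+1) :
  coords (vertex R n i) ord0 j = (nat_of_ord j == minn i n)%:R.
Proof. exact: mxE. Qed.

Lemma coords_ge0 n (x : simplex n) i : 0 <= coords x ord0 i.
Proof. by have [] := set_valP x. Qed.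

Lemma sum_coords n (x : simplex n) : \sum_i coords x ord0 i = 1.
Proof. by have [] := set_valP x. Qed.

Lemma simplex_compact n : compact (simplex n).
Proof.
pose cube := [set v : 'rV[R]_n.+1 | forall i, v ord0 i \in `[0, 1]%R].
have -> : simplex n = cube `&` [set v | \sum_i v ord0 i = 1].
  apply/seteqP; split=> [x [x0 x1]|x [x01 x1]]; split=> // i; last first.
    by have := x01 i; rewrite in_itv/= => /andP[].
  rewrite in_itv/= x0 -x1 (bigD1 i)//= lerDl.
  by apply: sumr_ge0 => j _; exact: x0.
apply: compact_closedI.
  have := @rV_compact R n.+1 (fun=> `[0, 1]%classic).
  by apply => _; exact: segment_compact.
have sum_cont : continuous (fun v : 'rV[R]_n.+1 => \sum_i v ord0 i).
  apply: (@continuous_big R _ _ _ predT add_continuous 'rV[R]_n.+1 _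
    (fun k (x : 'rV[R]_n.+1) => x ord0 k)) => k _.
  exact: coord_continuous.
apply: (@preimage_closed _ _ (fun v : 'rV[R]_n.+1 => \sum_i v ord0 i) [set x | x = 1]); last exact: closed_eq.
by move=> v _; exact: sum_cont.
Qed.

Definition dist n (x y : simplex n) : R := `|coords x - coords y|.

Lemma distC n (x y : simplex n) : dist x y = dist y x.
Proof. exact: distrC. Qed.

Lemma distxx n (x : simplex n) : dist x x = 0.
Proof. by rewrite /dist subrr normr0. Qed.

Lemma coords_affine n m (v : nat -> simplex m) (s : simplex n) :
  coords (affine n v s) = \sum_(i < n.+1) coords s ord0 i *: coords (v i).
Proof. exact: affineE. Qed.

Lemma coords_bary n m (v : nat -> simplex m) :
  coords (bary n v) = \sum_(i < n.+1) n.+1%:R^-1 *: coords (v i).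
Proof. by rewrite coords_affine; apply: eq_bigr => i _; rewrite mxE. Qed.

Lemma dist_affine n m (x : simplex m) r (v : nat -> simplex m) (s : simplex n) :
  (forall i, (i <= n)%N -> dist x (v i) <= r) -> dist x (affine n v s) <= r.
Proof.
move=> xv; rewrite /dist coords_affine -[coords x]scale1r -(sum_coords s) scaler_suml -sumrB.
rewrite (le_trans (ler_norm_sum _ _ _))//.
rewrite -[r]mul1r -(sum_coords s) mulr_suml; apply: ler_sum => i _.
rewrite -scalerBr normrZ ger0_norm ?coords_ge0// ler_wpM2l ?coords_ge0//.
by apply: xv; rewrite -ltnS.
Qed.

Lemma dist_bary m n (v : nat -> simplex m) D : mesh (@dist m) n v D ->
  forall i, (i <= n)%N -> dist (bary n v) (v i) <= n%:R / n.+1%:R * D.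
Proof.
move=> vD i len; rewrite /dist coords_bary.
have -> : coords (v i) = \sum_(j < n.+1) n.+1%:R^-1 *: coords (v i).
  by rewrite sumr_const card_ord -scaler_nat scalerA mulfV ?scale1r.
rewrite -sumrB (bigD1 (Ordinal (len : (i < n.+1)%N)))//= subrr add0r.
rewrite (le_trans (ler_norm_sum _ _ _))//.
rewrite (@le_trans _ _ (\sum_(j < n.+1 | j != Ordinal (len : (i < n.+1)%N)) n.+1%:R^-1 * D))//.
  apply: ler_sum => j _; rewrite -scalerBr normrZ ger0_norm ?invr_ge0//.
  by rewrite ler_wpM2l ?invr_ge0//; apply: vD => //; rewrite -ltnS.
rewrite sumr_const (_ : #|_| = n).
  by rewrite -[X in _ <= X]mulrA mulr_natl.
by have := cardC1 (Ordinal (len : (i < n.+1)%N)); rewrite card_ord.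
Qed.

Lemma lebesgue_number (X : topologicalType) n (s : chains n X) (O : set (set X)) :
  (forall U, O U -> open U) -> (forall x, exists2 U, O U & U x) ->
  exists2 e : R, 0 < e & forall x, exists2 U, O U & forall y, dist x y <= e -> U (s y).
Proof.
move=> Oopen Ocover.
pose P (e : R) (x : 'rV[R]_n.+1) :=
  exists2 U, O U & forall y : simplex n, `|x - coords y| <= e -> U (s y).
have : \forall e \near 0^'+, simplex n `<=` P e.
  apply: ((compact_near_coveringP _).1 (@simplex_compact n)) => x sx.
  pose x' : simplex n := exist _ x (mem_set sx).
  have [U OU Ux] := Ocover (s x').
  have [B oB BE] : open (s @^-1` U).
    by apply: open_comp (Oopen _ OU) => y _; exact: cts_fun.
  have : nbhs x B.
    apply: open_nbhs_nbhs; split=> //.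
    by have : (set_val @^-1` B) x' by rewrite BE.
  move=> /nbhs_ballP[r /= r0 rB].
  exists (ball x (r / 2), [set e | e < r / 2]) => /=.
    split; first by apply: nbhsx_ballx; rewrite divr_gt0.
    by apply: nbhs_right_lt; rewrite divr_gt0.
  case=> x1 e /= [x1x er]; exists U => // y yx.
  suff : (s @^-1` U) y by [].
  rewrite -BE; apply: rB; move: x1x; rewrite -!ball_normE /= => x1x.
  rewrite -(subrK x1 x) -addrA (le_lt_trans (ler_normD _ _))// [ltRHS]splitr ltrD//.
  exact: le_lt_trans er.
move=> /filterI/(_ (nbhs_right_gt (0 : R))) H.
have [e [eP e0]] := @filter_ex _ _ (at_right_proper_filter (0 : R)) _ H.
by exists e => // x; apply: eP; exact: set_valP.
Qed.

End SmallSimplices.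

Section SmallCochains.
Variables (R : realType) (V : zmodType).
Local Notation simplex := (simplex R).
Local Notation chains n X := (continuousType (simplex n) X).
Implicit Types X : topologicalType.

Lemma iter_sd_eventually0 m n (f : (nat -> simplex m) -> V) (e : R) v : 0 < e ->
  (forall w, mesh (@dist R m) n w e -> f w = 0) ->
  exists N, forall i, (N <= i)%N -> iter i (sd (@bary R m) n) f v = 0.
Proof.
move=> e0 fe.
pose D := \sum_(i < n.+1) \sum_(j < n.+1) dist (v i) (v j).
have vD : mesh (@dist R m) n v D.
  move=> i j len ljn; rewrite /D (bigD1 (Ordinal (len : (i < n.+1)%N)))//=.
  rewrite (bigD1 (Ordinal (ljn : (j < n.+1)%N)))//= -addrA lerDl addr_ge0//.
    by apply: sumr_ge0 => k _; exact: normr_ge0.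
  by do 2!(apply: sumr_ge0 => ? _); exact: normr_ge0.
have D0 : 0 <= D by exact: mesh_ge0 (@distxx R m) _ _ _ vD.
pose q : R := n%:R / n.+1%:R.
have q0 : 0 <= q by rewrite divr_ge0.
have q1 : `|q| < 1 by rewrite ger0_norm// ltr_pdivrMr// mul1r ltr_nat.
(* Dividing by [D + 1] covers the case [D = 0]. *)
have eD : 0 < e / (D + 1) by rewrite divr_gt0// ltr_wpDl.
have /cvgr0_norm_lt/(_ _ eD)[N _ NP] := cvg_expr q1.
exists N => i Ni; apply: (@iter_sd_mesh _ _ _ _ _ (@distC R m) _ (@distxx R m) _ _ _ _ _ _ vD).
- by move=> x r k w xw; exact: dist_affine.
- by move=> k w E wE j lek; exact: dist_bary.
move=> w wi; apply: fe => j k lej lek; apply: (le_trans (wi j k lej lek)).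
have := NP i Ni; rewrite /= ger0_norm ?exprn_ge0// ltr_pdivlMr ?ltr_wpDl// => H.
apply: ltW; apply: le_lt_trans H; rewrite ler_wpM2l ?exprn_ge0// lerDl//.
Qed.

Definition small (X : topologicalType) (O : set (set X)) n (s : chains n X) : Prop :=
  exists2 U, O U & forall p, U (s p).

Lemma pull_iter_Sd n X (phi : chains n X -> V) i m (s : chains m X) :
  pull (iter i (@Sd R V n X) phi) s = iter i (sd (@bary R m) n) (pull phi s).
Proof. by elim: i => //= i IH; rewrite pull_Sd IH. Qed.

Lemma dV_iter_Sd n X (phi : chains n X -> V) i :
  dV (iter i (@Sd R V n X) phi) = iter i (@Sd R V n.+1 X) (dV phi).
Proof. by elim: i => //= i IH; rewrite dV_Sd IH. Qed.

Lemma SdB n X (phi psi : chains n X -> V) : Sd (phi - psi) = Sd phi - Sd psi.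
Proof.
apply/funext => s; rewrite /Sd fct_subE -fct_subE -sdB; congr (sd _ _ _ _).
Qed.

Lemma iter_SdB n X (phi psi : chains n X -> V) i :
  iter i (@Sd R V n X) (phi - psi) = iter i (@Sd R V n X) phi - iter i (@Sd R V n X) psi.
Proof. by elim: i => //= i IH; rewrite IH SdB. Qed.

Lemma Sh0 n X : Sh (0 : chains n.+1 X -> V) = 0.
Proof.
apply/funext => s; rewrite /Sh (_ : pull _ s = 0 - 0); last by rewrite subrr.
by rewrite sdhB fct_subE subrr.
Qed.

Section Cover.
Variables (X : topologicalType) (O : set (set X)).
Hypothesis Oopen : forall U, O U -> open U.
Hypothesis Ocover : forall x, exists2 U, O U & U x.

Lemma iter_Sd_eventually0 n (F : chains n X -> V) (s : chains n X) :
  (forall t, small O t -> F t = 0) ->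
  exists N, forall i, (N <= i)%N -> iter i (@Sd R V n X) F s = 0.
Proof.
move=> F0; have [e e0 eP] := lebesgue_number s Oopen Ocover.
have [w we|N NP] := @iter_sd_eventually0 n n (pull F s) e (@vertex R n) e0.
  apply: F0; have [U OU Uw] := eP (w 0%N); exists U => // p /=.
  by apply: Uw; apply: dist_affine => i len; exact: we.
by exists N => i /NP; rewrite -pull_iter_Sd pull_vertex.
Qed.

Lemma iter_Sd_Sh_eventually0 n (F : chains n.+1 X -> V) (s : chains n X) :
  (forall t, small O t -> F t = 0) ->
  exists N, forall i, (N <= i)%N -> iter i (@Sd R V n X) (Sh F) s = 0.
Proof.
move=> F0; have [e e0 eP] := lebesgue_number s Oopen Ocover.
have [w we|N NP] := @iter_sd_eventually0 n n (pull (Sh F) s) e (@vertex R n) e0.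
  have [U OU Uw] := eP (w 0%N).
  rewrite pull_Sh (@sdh_hull _ _ _ _ _ _ [set y | dist (w 0%N) y <= e])//.
  - by move=> k u uC; exact: dist_affine.
  - by move=> i len; exact: we.
  move=> u uC; apply: F0; exists U => // p /=.
  by apply: Uw; exact: dist_affine.
by exists N => i /NP; rewrite -pull_iter_Sd pull_vertex.
Qed.

(** As [dV (Sh F) = F - Sd F], the coboundary of the partial sums telescopes to [F] minus an
    iterated subdivision of [F], and the latter vanishes on each simplex from some stage on. The
    formula for [g] is recorded so that equivariance and membership in a submodule pass from [F] to
    [g]. *)
Theorem small_coboundary n (F : chains n.+1 X -> V) : dV F = 0 ->
  (forall t, small O t -> F t = 0) ->
  exists2 g : chains n X -> V, dV g = F &
  forall s, exists N, forall m, (N <= m)%N ->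
    g s = \sum_(i < m) iter i (@Sd R V n X) (Sh F) s.
Proof.
move=> dF F0.
have /choice[N NP] : forall s : chains n X, exists N, forall i, (N <= i)%N ->
    iter i (@Sd R V n X) (Sh F) s = 0.
  by move=> s; exact: iter_Sd_Sh_eventually0.
pose g (s : chains n X) := \sum_(i < N s) iter i (@Sd R V n X) (Sh F) s.
have gE s m : (N s <= m)%N -> g s = \sum_(i < m) iter i (@Sd R V n X) (Sh F) s.
  move=> Nm; rewrite /g -!(big_mkord predT (fun i => iter i (@Sd R V n X) (Sh F) s)).
  rewrite (big_cat_nat _ Nm)//= [X in _ + X]big1_seq ?addr0// => i.
  by rewrite mem_index_iota => /andP[_ /andP[Ni _]]; exact: NP.
exists g; last by move=> s; exists (N s) => m; exact: gE.
apply/funext => s.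
have [N' N'P] := iter_Sd_eventually0 s F0.
(* A number of terms that suffices for [s] and for all its faces at once. *)
pose m := maxn N' (\max_(i < n.+2) N (s \o @face R n i)).
have -> : dV g s = dV (fun t => \sum_(i < m) iter i (@Sd R V n X) (Sh F) t) s.
  apply: eq_bigr => i _; congr (_ *~ _); apply: gE.
  by rewrite leq_max (leq_bigmax i) orbT.
have -> : dV (fun t => \sum_(i < m) iter i (@Sd R V n X) (Sh F) t) s =
    \sum_(i < m) dV (iter i (@Sd R V n X) (Sh F)) s.
  by rewrite exchange_big/=; apply: eq_bigr => i _; rewrite mulrz_suml.
have dSh : dV (Sh F) = F - Sd F.
  by rewrite Sh_homotopy dF Sh0 add0r.
under eq_bigr do rewrite dV_iter_Sd dSh iter_SdB fct_subE -iterSr iterS.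
rewrite (_ : \sum_(i < m) _ = F s - iter m (@Sd R V n.+1 X) F s).
  by rewrite N'P ?subr0// leq_maxl.
elim: m => [|j IH]; first by rewrite big_ord0 subrr.
by rewrite big_ord_recr IH /= addrA subrK.
Qed.

End Cover.
End SmallCochains.

(** * Cross products of simplices and homotopy invariance *)

Section Pairing.
Variables (Z X Y : topologicalType) (f : continuousType Z X) (g : continuousType Z Y).

Lemma pair_continuous : continuous (fun z => (f z, g z)).
Proof. by move=> z; apply: cvg_pair; exact: cts_fun. Qed.

Definition pairc : continuousType Z (X * Y)%type := mkcts pair_continuous.

End Pairing.

Section Products.
Variables (R : realType) (V : zmodType).
Local Notation simplex := (simplex R).
Local Notation chains n X := (continuousType (simplex n) X).
Implicit Types X Y : topologicalType.

(** Labels (i, j) stand for the vertices of the product of two simplices. Summing over lattice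
    paths, [ez] evaluates [Phi] on the cross product of the singular simplices [s] and [t]. *)
Definition cross n X Y (Phi : chains n (X * Y)%type -> V) p q (s : chains p X)
    (t : chains q Y) : (nat -> nat * nat) -> V :=
  fun v => Phi (pairc (s \o affine n (@vertex R p \o (fun i => (v i).1)))
                      (t \o affine n (@vertex R q \o (fun i => (v i).2)))).

Definition ez n X Y (Phi : chains n (X * Y)%type -> V) p q (s : chains p X)
    (t : chains q Y) : V := shuffle p q (cross Phi s t).

Lemma eq_comp_affine n X m (s : chains m X) (v w : nat -> simplex m) :
  (forall i, (i <= n)%N -> v i = w i) -> s \o affine n v = s \o affine n w :> chains n X.
Proof. by move=> vw; rewrite (eq_affine vw). Qed.

Lemma comp_face_affine n X m (s : chains m.+1 X) (i : 'I_m.+2) (v : nat -> simplex m) :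
  (s \o face i : chains m X) \o affine n v = s \o affine n (face i \o v) :> chains n X.
Proof.
apply/continuousEP => x /=; congr (s _); apply: simplex_eq; rewrite affineE /=.
apply/rowP => j; rewrite !mxE summxE.
case: unliftP => [k ->|->]; last by rewrite big1// => l _; rewrite !mxE unlift_none mulr0.
by rewrite summxE; apply: eq_bigr => l _; rewrite !mxE liftK.
Qed.

Lemma tail_free_cross n X Y (Phi : chains n (X * Y)%type -> V) p q (s : chains p X) (t : chains q Y) :
  tail_free n (cross Phi s t).
Proof.
move=> v w vw; rewrite /cross.
by rewrite (@eq_comp_affine _ _ _ s _ (@vertex R p \o (fun i => (w i).1)))
  ?(@eq_comp_affine _ _ _ t _ (@vertex R q \o (fun i => (w i).2)))// => i /vw /= ->.
Qed.

Lemma alt_cross n X Y (Phi : chains n (X * Y)%type -> V) p q (s : chains p X) (t : chains q Y) :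
  alt n.+2 (cross Phi s t) = cross (dV Phi) s t.
Proof.
apply/funext => v; apply: eq_bigr => i _; congr (Phi _ *~ _).
apply/continuousEP => x /=; congr (s _, t _).
  by have /continuousEP/(_ x)/= := affine_face (@vertex R p \o (fun i => (v i).1)) i.
by have /continuousEP/(_ x)/= := affine_face (@vertex R q \o (fun i => (v i).2)) i.
Qed.

Lemma lattice_path_le p q v i : lattice_path p q v -> (i <= p + q)%N ->
  ((v i).1 <= p)%N /\ ((v i).2 <= q)%N.
Proof.
move=> pv ipq; have [] := @lattice_path_mono p q v i (p + q) pv; first by rewrite ipq leqnn.
by have [_ -> _] := pv.
Qed.

Lemma cross_face_left n X Y (Phi : chains n (X * Y)%type -> V) p q (s : chains p.+1 X)
    (t : chains q Y) (i : 'I_p.+2) : n = (p + q)%N ->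
  shuffle p q (cross Phi s t \o comp (hmap (bump i))) = ez Phi (s \o face i) t.
Proof.
move=> npq; apply: eq_shuffle => v pv; rewrite /= /cross; congr (Phi (pairc _ _)).
rewrite comp_face_affine; apply: eq_comp_affine => j ljn /=.
by rewrite vertex_face//; have [] := @lattice_path_le p q v j pv ltac:(lia).
Qed.

Lemma cross_face_right n X Y (Phi : chains n (X * Y)%type -> V) p q (s : chains p X)
    (t : chains q.+1 Y) (i : 'I_q.+2) : n = (p + q)%N ->
  shuffle p q (cross Phi s t \o comp (vmap (bump i))) = ez Phi s (t \o face i).
Proof.
move=> npq; apply: eq_shuffle => v pv; rewrite /= /cross; congr (Phi (pairc _ _)).
rewrite comp_face_affine; apply: eq_comp_affine => j ljn /=.
by rewrite vertex_face//; have [] := @lattice_path_le p q v j pv ltac:(lia).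
Qed.

Lemma ez_dVSS n X Y (Phi : chains n (X * Y)%type -> V) p q (s : chains p.+1 X)
    (t : chains q.+1 Y) : n = (p + q.+1)%N ->
  ez (dV Phi) s t = dV (fun s => ez Phi s t) s + dV (fun t => ez Phi s t) t *~ (-1) ^+ p.+1.
Proof.
move=> npq; rewrite /ez -alt_cross (@shuffle_boundary _ p.+1 q.+1 n); first last.
- exact: tail_free_cross.
- by lia.
congr (_ + _ *~ _); apply: eq_bigr => i _; congr (_ *~ _).
  by rewrite cross_face_left.
by rewrite cross_face_right// npq addnS.
Qed.

Lemma ez_dV0S n X Y (Phi : chains n (X * Y)%type -> V) q (s : chains 0 X)
    (t : chains q.+1 Y) : n = q ->
  ez (dV Phi) s t = dV (fun t => ez Phi s t) t.
Proof.
move=> np; rewrite /ez -alt_cross (@shuffle_boundary _ 0 q.+1 n); first last.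
- exact: tail_free_cross.
- by lia.
rewrite /face_left add0r mulr1z; apply: eq_bigr => i _; congr (_ *~ _).
by rewrite cross_face_right.
Qed.

Lemma const_continuous (Z : topologicalType) X (x : X) : continuous (fun _ : Z => x).
Proof. by move=> z; exact: cvg_cst. Qed.

Definition constc (Z : topologicalType) X (x : X) : continuousType Z X :=
  mkcts (@const_continuous Z X x).

Definition slice_l n X Y (y : Y) (Phi : chains n (X * Y)%type -> V) : chains n X -> V :=
  fun s => Phi (pairc s (constc _ y)).

Lemma simplex0 (x y : simplex 0) : x = y.
Proof.
apply: simplex_eq; apply/rowP => i; rewrite (ord1 i).
have := sum_coords x; have := sum_coords y; rewrite !big_ord1 /coords => H1 H2.
by rewrite H1 H2.
Qed.

Lemma ez_point n X Y (Phi : chains n (X * Y)%type -> V) (s : chains n X) (t : chains 0 Y) :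
  ez Phi s t = slice_l (t (@vertex R 0 0)) Phi s.
Proof.
pose v : nat -> nat * nat := fun i => (i, 0%N).
have shE p (f : (nat -> nat * nat) -> V) : tail_free p f -> shuffle p 0 f = f (fun i => (i, 0%N)).
  elim: p f => [|p IH] f tf; first by rewrite shuffle00; apply: tf => -[].
  rewrite shuffleS0 IH; last exact: tail_free_right.
  by congr (f _); apply/funext => -[].
rewrite /ez shE; last exact: tail_free_cross.
rewrite /cross /slice_l; congr (Phi _); apply/continuousEP => x /=.
congr (_, _); last by congr (t _); exact: simplex0.
by congr (s _); exact: affine_id.
Qed.

End Products.

Section Homotopy.
Variables (R : realType).
Local Notation simplex := (simplex R).
Local Notation chains n X := (continuousType (simplex n) X).
Implicit Types X Y : topologicalType.

Lemma coboundaryE n X (phi : chains n X -> int) : coboundary phi = dV phi.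
Proof. by apply/funext => s; apply: eq_bigr => i _; rewrite mulrzz mulrC. Qed.

Lemma shuffle_additive (V W : zmodType) (h : {additive V -> W}) p q f :
  shuffle p q (h \o f) = h (shuffle p q f).
Proof.
move: p q f; apply: shuffle_ind => [|q IH|p IH|p q IH1 IH2] f //.
- by rewrite !shuffle0S -IH.
- by rewrite !shuffleS0 -IH.
- by rewrite !shuffleSS raddfD raddfMz -IH1 -IH2.
Qed.

Lemma shuffleZ (A : pzRingType) (l : A) p q f :
  shuffle p q (fun v => l * f v) = l * shuffle p q f.
Proof. exact: (shuffle_additive (l \*o (@idfun A) : {additive A -> A})%R). Qed.

Lemma dVZ (A : pzRingType) n X (l : A) (phi : chains n X -> A) :
  dV (fun s => l * phi s) = fun s => l * dV phi s.
Proof.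
apply/funext => s; rewrite /dV mulr_sumr; apply: eq_bigr => i _.
by rewrite mulrzAr.
Qed.

(* Coboundaries modulo [l]; for [l = 0], coboundaries. *)
Definition cob (l : int) n X (phi : chains n X -> int) : Prop :=
  exists b c, is_coboundary (R := R) b /\ phi = b + (fun s => l * c s).

Lemma is_coboundaryB n X (b b' : chains n X -> int) :
  is_coboundary b -> is_coboundary b' -> is_coboundary (b - b').
Proof.
case: n b b' => [|n] b b' /=; first by move=> -> ->; rewrite subrr.
by move=> [p ->] [p' ->]; exists (p - p'); rewrite coboundaryB.
Qed.

Lemma is_coboundary0 n X : is_coboundary (0 : chains n X -> int).
Proof. by case: n => [//|n]; exists 0; rewrite coboundaryE dV0. Qed.

Lemma is_coboundary_dV n X (p : chains n X -> int) : is_coboundary (dV p).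
Proof. by exists p; rewrite coboundaryE. Qed.

Lemma cobB l n X (p p' : chains n X -> int) : cob l p -> cob l p' -> cob l (p - p').
Proof.
move=> [b [c [bb ->]]] [b' [c' [bb' ->]]].
exists (b - b'), (c - c'); split; first exact: is_coboundaryB.
by apply/funext => s; rewrite !fctE mulrBr opprD addrACA.
Qed.

Lemma cob0 l n X : cob l (0 : chains n X -> int).
Proof.
exists 0, 0; split; first exact: is_coboundary0.
by apply/funext => s; rewrite !fctE mulr0 addr0.
Qed.

Lemma cobD l n X (p p' : chains n X -> int) : cob l p -> cob l p' -> cob l (p + p').
Proof.
move=> cp cp'; rewrite -[p']opprK; apply: cobB => //.
by rewrite -sub0r; apply: cobB => //; exact: cob0.
Qed.

Lemma cob_dV l n X (p : chains n X -> int) : cob l (dV p).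
Proof.
exists (dV p), 0; split; first exact: is_coboundary_dV.
by apply/funext => s; rewrite !fctE mulr0 addr0.
Qed.

Lemma cobZ l n X (c : chains n X -> int) : cob l (fun s => l * c s).
Proof. by exists 0, c; split; [exact: is_coboundary0|rewrite add0r]. Qed.

Lemma cob_0 n X (p : chains n X -> int) : cob 0 p -> is_coboundary p.
Proof.
move=> [b [c [bb ->]]]; rewrite (_ : _ + _ = b)//.
by apply/funext => s; rewrite !fctE mul0r addr0.
Qed.

(* Any two points are joined by a finite chain of singular 1-simplices, expressed
   by induction along such chains. *)
Definition chain_connected Y : Prop := forall P : Y -> Prop,
  (forall c : chains 1 Y, P (c (@vertex R 1 0)) -> P (c (@vertex R 1 1))) ->
  forall y y', P y -> P y'.

Lemma ez_path n X Y (M : chains n (X * Y)%type -> int) (s : chains n X) (c : chains 1 Y) :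
  dV (fun t => ez M s t) c =
  slice_l (c (@vertex R 1 1)) M s - slice_l (c (@vertex R 1 0)) M s.
Proof.
rewrite /dV !big_ord_recl big_ord0 addr0 expr0 mulr1z expr1 mulrN1z !ez_point /=.
by rewrite !vertex_face.
Qed.

(** In the Leibniz rule for [ez], the boundary of the path [c] gives the difference of the two
    slices, and the boundary of [s] gives the coboundary of [ez M s c]. Taking [l = 0] recovers the
    integral statement. *)
Lemma homotopy_path (l : int) n X Y (M : chains n (X * Y)%type -> int) N (c : chains 1 Y) :
  dV M = (fun s => l * N s) ->
  cob l (slice_l (c (@vertex R 1 1)) M - slice_l (c (@vertex R 1 0)) M).
Proof.
move=> dM.
have ezl p q (s : chains p X) (t : chains q Y) : ez (dV M) s t = l * ez N s t.
  by rewrite dM -shuffleZ.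
case: n M N dM ezl => [|n] M N dM ezl.
  (* In degree 0 the Leibniz rule has no boundary term in the first factor, and the difference is
     itself a multiple of [l]. *)
  rewrite (_ : _ - _ = (fun s => l * ez N s c)); first exact: cobZ.
  by apply/funext => s; rewrite fct_subE -ez_path -ezl ez_dV0S.
have E : slice_l (c (@vertex R 1 1)) M - slice_l (c (@vertex R 1 0)) M =
    (fun s => l * (ez N s c *~ (-1) ^+ n.+1)) - dV (fun s => ez M s c *~ (-1) ^+ n.+1).
  apply/funext => s; rewrite !fct_subE -ez_path mulrzAr -ezl dVMz.
  rewrite (ez_dVSS (n := n.+1)) ?addn1// mulrzDl addrAC subrr add0r -mulrzA.
  by rewrite -exprD addnn -muln2 mulnC exprM sqrrN !expr1n mulr1z.
by rewrite E; apply: cobB; [exact: cobZ|exact: cob_dV].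
Qed.

Lemma homotopy_cob (l : int) n X Y (M : chains n (X * Y)%type -> int) N y y' :
  chain_connected Y -> dV M = (fun s => l * N s) ->
  cob l (slice_l y' M - slice_l y M).
Proof.
move=> cY dM; apply: (cY (fun y' => cob l (slice_l y' M - slice_l y M)) _ y y').
  move=> c; set a := slice_l _ M => ca.
  rewrite -[X in X - _](subrK a) -addrA; apply: cobD => //.
  exact: homotopy_path dM.
by rewrite subrr; exact: cob0.
Qed.

End Homotopy.

(** * Invariant cocycles as transfers *)

Section Equivariant.
Variables (R : realType) (d : nat) (G : lieGroupType R d) (hs : seq G).
Local Notation simplex := (simplex R).
Local Notation chains n X := (continuousType (simplex n) X).
Hypothesis hs_uniq : uniq hs.
Hypothesis hs1 : (1%g : G) \in hs.
Hypothesis hsV : forall h, h \in hs -> (h^-1)%g \in hs.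
Hypothesis hsM : forall h h', h \in hs -> h' \in hs -> (h * h')%g \in hs.

Lemma mulr_continuous (h : G) : continuous (fun g : G => (g * h)%g).
Proof.
move=> g; apply: (@continuous_comp _ _ _ (fun g : G => (g, h))
  (fun p : G * G => (p.1 * p.2)%g)); last exact: lie_mul_continuous.
by apply: cvg_pair => //=; exact: cvg_cst.
Qed.

Definition transl (h : G) : continuousType G G := mkcts (@mulr_continuous h).

Lemma transl_comp n (s : chains n G) h h' :
  transl h' \o (transl h \o s : chains n G) = transl (h * h')%g \o s :> chains n G.
Proof. by apply/continuousEP => x /=; rewrite /mkcts/= mulgA. Qed.

(* Right modules over the group [hs]. The module is the subgroup [coef_mem] of
   [coef], which spares a subtype at each dimension shift. *)
Record coefficients := Coefficients {
  coef :> zmodType;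
  coef_mem : coef -> Prop;
  coef_act : G -> coef -> coef;
  coef_mem0 : coef_mem 0;
  coef_memB : forall u v, coef_mem u -> coef_mem v -> coef_mem (u - v);
  coef_actB : forall h, {morph coef_act h : u v / u - v};
  coef_act1 : forall v, coef_act 1%g v = v;
  coef_actM : forall h h' v, coef_act (h * h')%g v = coef_act h' (coef_act h v);
  coef_act_mem : forall h v, h \in hs -> coef_mem v -> coef_mem (coef_act h v)
}.

Section CoefficientTheory.
Variable C : coefficients.
Local Notation mem := (@coef_mem C).
Local Notation act := (@coef_act C).

Lemma coef_act0 h : act h 0 = 0.
Proof. by rewrite -[X in act h X](subrr 0) coef_actB subrr. Qed.

Lemma coef_actN h v : act h (- v) = - act h v.
Proof. by rewrite -sub0r coef_actB coef_act0 sub0r. Qed.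

Lemma coef_actD h u v : act h (u + v) = act h u + act h v.
Proof. by rewrite -[in LHS](opprK v) coef_actB coef_actN opprK. Qed.

Lemma coef_act_sum h I (r : seq I) (F : I -> C) :
  act h (\sum_(i <- r) F i) = \sum_(i <- r) act h (F i).
Proof. exact: (big_morph (act h) (coef_actD h) (coef_act0 h)). Qed.

Lemma coef_actMz h v z : act h (v *~ z) = act h v *~ z.
Proof.
have H n : act h (v *+ n) = act h v *+ n.
  by elim: n => [|n IH]; rewrite ?mulr0n ?coef_act0// !mulrS coef_actD IH.
by case: z => n; rewrite ?NegzE ?mulrNz ?coef_actN -!pmulrn H.
Qed.

Lemma coef_memN v : mem v -> mem (- v).
Proof. by move=> mv; rewrite -sub0r; apply: coef_memB => //; exact: coef_mem0. Qed.

Lemma coef_memD u v : mem u -> mem v -> mem (u + v).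
Proof. by move=> mu mv; rewrite -[v]opprK; apply: coef_memB => //; exact: coef_memN. Qed.

Lemma coef_mem_sum I (r : seq I) (Q : pred I) (F : I -> C) :
  (forall i, Q i -> mem (F i)) -> mem (\sum_(i <- r | Q i) F i).
Proof. by move=> mF; elim/big_ind: _ => //; [exact: coef_mem0|exact: coef_memD]. Qed.

Lemma coef_memMz v z : mem v -> mem (v *~ z).
Proof.
move=> mv; have H n : mem (v *+ n).
  by elim: n => [|n IH]; rewrite ?mulr0n ?mulrS; [exact: coef_mem0|exact: coef_memD].
by case: z => n; rewrite ?NegzE ?mulrNz -!pmulrn; [|apply: coef_memN].
Qed.

Lemma coef_mem_dV n (F : chains n G -> C) : (forall s, mem (F s)) -> forall s, mem (dV F s).
Proof. by move=> mF s; apply: coef_mem_sum => i _; exact: coef_memMz. Qed.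

Definition equivariant n (F : chains n G -> C) : Prop :=
  forall h (s : chains n G), h \in hs -> F (transl h \o s) = act h (F s).

Lemma equivariant_dV n (F : chains n G -> C) : equivariant F -> equivariant (dV F).
Proof.
move=> eF h s hh; rewrite /dV coef_act_sum; apply: eq_bigr => i _.
rewrite coef_actMz -eF//; congr (F _ *~ _); exact/continuousEP.
Qed.

Lemma pull_coef_act n h (F : chains n G -> C) m (s : chains m G) :
  equivariant F -> h \in hs -> pull F (transl h \o s) = act h \o pull F s.
Proof.
move=> eF hh; apply/funext => v /=; rewrite /pull -eF//; congr (F _).
exact/continuousEP.
Qed.

Lemma act_additive_alt P m (f : (nat -> P) -> C) h : alt m (act h \o f) = act h \o alt m f.
Proof.
apply/funext => v; rewrite /alt /= coef_act_sum; apply: eq_bigr => i _.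
by rewrite coef_actMz.
Qed.

Lemma act_sd P (b : nat -> (nat -> P) -> P) n (f : (nat -> P) -> C) h :
  sd b n (act h \o f) = act h \o sd b n f.
Proof.
elim: n f => [//|n IH] f; apply/funext => v; rewrite sdSE.
by rewrite (_ : (act h \o f) \o _ = act h \o (f \o vcons (b n.+1 v)))// IH act_additive_alt.
Qed.

Lemma act_sdh P (b : nat -> (nat -> P) -> P) n (f : (nat -> P) -> C) h :
  sdh b n (act h \o f) = act h \o sdh b n f.
Proof.
elim: n f => [|n IH] f; apply/funext => v; first by rewrite /= coef_act0.
rewrite [RHS]/= -/(sdh b n.+1 f v) !sdhSE coef_actB.
by rewrite (_ : (act h \o f) \o _ = act h \o (f \o vcons (b n.+1 v)))// IH act_additive_alt.
Qed.

Lemma mem_alt P m (f : (nat -> P) -> C) : (forall v, mem (f v)) -> forall v, mem (alt m f v).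
Proof. by move=> mf v; apply: coef_mem_sum => i _; exact: coef_memMz. Qed.

Lemma mem_sd P (b : nat -> (nat -> P) -> P) n (f : (nat -> P) -> C) :
  (forall v, mem (f v)) -> forall v, mem (sd b n f v).
Proof.
elim: n f => [//|n IH] f mf v; rewrite sdSE; apply: mem_alt => w; apply: IH => u.
exact: mf.
Qed.

Lemma mem_sdh P (b : nat -> (nat -> P) -> P) n (f : (nat -> P) -> C) :
  (forall v, mem (f v)) -> forall v, mem (sdh b n f v).
Proof.
elim: n f => [|n IH] f mf v; first exact: coef_mem0.
rewrite sdhSE; apply: coef_memB; first exact: mf.
by apply: mem_alt => w; apply: IH => u; exact: mf.
Qed.

Lemma equivariant_Sd n (F : chains n G -> C) : equivariant F -> equivariant (Sd F).
Proof. by move=> eF h s hh; rewrite /Sd pull_coef_act// act_sd. Qed.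

Lemma equivariant_Sh n (F : chains n.+1 G -> C) : equivariant F -> equivariant (Sh F).
Proof. by move=> eF h s hh; rewrite /Sh pull_coef_act// act_sdh. Qed.

Lemma small_coboundary_equivariant (O : set (set G)) n (F : chains n.+1 G -> C) :
  (forall U, O U -> open U) -> (forall x, exists2 U, O U & U x) ->
  dV F = 0 -> (forall t, small O t -> F t = 0) ->
  (forall s, mem (F s)) -> equivariant F ->
  exists g : chains n G -> C, [/\ dV g = F, forall s, mem (g s) & equivariant g].
Proof.
move=> Oo Oc dF F0 mF eF; have [g dg gE] := small_coboundary Oo Oc dF F0.
have eSh i : equivariant (iter i (@Sd R C n G) (Sh F)).
  by elim: i => [|i IH]; [exact: equivariant_Sh|exact: equivariant_Sd].
have mSh i : forall s, mem (iter i (@Sd R C n G) (Sh F) s).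
  elim: i => [|i IH] s; last by apply: mem_sd => v; exact: IH.
  by apply: mem_sdh => v; exact: mF.
exists g; split=> // [s|h s hh].
  by have [N NP] := gE s; rewrite (NP N)//; apply: coef_mem_sum => i _; exact: mSh.
have [N NP] := gE s; have [N' N'P] := gE (transl h \o s).
rewrite (NP (maxn N N')) ?leq_maxl// (N'P (maxn N N')) ?leq_maxr//.
by rewrite coef_act_sum; apply: eq_bigr => i _; exact: eSh.
Qed.

End CoefficientTheory.

(* Cohomology vanishes in degrees larger than [k]. *)
Definition acyclic_above (k : nat) (C : coefficients) : Prop :=
  forall j (F : chains j.+1 G -> C), (k <= j)%N -> dV F = 0 ->
    (forall s, coef_mem (F s)) ->
  exists2 E : chains j G -> C, dV E = F & forall s, coef_mem (E s).

Lemma perm_map_mulr h : h \in hs -> perm_eq (map (fun x => (x * h)%g) hs) hs.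
Proof.
move=> hh; apply: uniq_perm => //; first by rewrite map_inj_uniq//; exact: mulIg.
move=> x; apply/mapP/idP => [[y yh ->]|xh]; first exact: hsM.
by exists (x * h^-1)%g; [apply: hsM => //; exact: hsV|rewrite mulgVK].
Qed.

Lemma sum_mulr (V : zmodType) (f : G -> V) h : h \in hs ->
  \sum_(x <- hs) f (x * h)%g = \sum_(x <- hs) f x.
Proof.
by move=> hh; rewrite -[RHS](perm_big _ (perm_map_mulr hh)) big_map.
Qed.

Section Augmentation.
Variable C : coefficients.

(* The functions on [hs] with sum zero, extended by 0 to [G]. *)
Definition aug_mem (f : G -> C) : Prop :=
  [/\ forall h, h \in hs -> coef_mem (f h), forall h, h \notin hs -> f h = 0 &
      \sum_(h <- hs) f h = 0].

Definition aug_act (h : G) (f : G -> C) : G -> C := fun x => coef_act h (f (x * h^-1)%g).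

Lemma aug_mem0 : aug_mem 0.
Proof. by split=> // [h _|]; [exact: coef_mem0|rewrite big1]. Qed.

Lemma aug_memB u v : aug_mem u -> aug_mem v -> aug_mem (u - v).
Proof.
move=> [u1 u2 u3] [v1 v2 v3]; split=> [h hh|h hh|].
- by apply: coef_memB; [exact: u1|exact: v1].
- by rewrite fct_subE u2// v2// subrr.
- by rewrite (eq_bigr (fun h => u h - v h))// sumrB u3 v3 subrr.
Qed.

Lemma aug_actB h : {morph aug_act h : u v / u - v}.
Proof. by move=> u v; apply/funext => x; rewrite /aug_act !fct_subE coef_actB. Qed.

Lemma aug_act1 v : aug_act 1%g v = v.
Proof. by apply/funext => x; rewrite /aug_act coef_act1 invg1 mulg1. Qed.

Lemma aug_actM h h' v : aug_act (h * h')%g v = aug_act h' (aug_act h v).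
Proof. by apply/funext => x; rewrite /aug_act coef_actM invgM mulgA. Qed.

Lemma aug_act_mem h v : h \in hs -> aug_mem v -> aug_mem (aug_act h v).
Proof.
move=> hh [v1 v2 v3]; split=> [x xh|x xh|].
- by apply: coef_act_mem => //; apply: v1; apply: hsM => //; exact: hsV.
- rewrite /aug_act v2 ?coef_act0//; apply: contra xh => xh.
  by rewrite -(mulgVK h x); exact: hsM.
- by rewrite /aug_act -coef_act_sum (sum_mulr _ (hsV hh)) v3 coef_act0.
Qed.

Definition augmentation : coefficients :=
  Coefficients aug_mem0 aug_memB aug_actB aug_act1 aug_actM aug_act_mem.

Lemma dV_fct n (X : topologicalType) (F : chains n X -> (G -> C)) s x :
  dV F s x = dV (fun t => F t x) s.
Proof.
rewrite /dV.
have H I (r : seq I) (f : I -> G -> C) : (\sum_(i <- r) f i) x = \sum_(i <- r) f i x.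
  by elim: r => [|i r IH]; rewrite ?big_nil// !big_cons fct_addE IH.
rewrite H; apply: eq_bigr => i _.
have HM (f : G -> C) (z : int) : (f *~ z) x = f x *~ z.
  have Hn m : (f *+ m) x = f x *+ m.
    by elim: m => [|m IH]; rewrite ?mulr0n// !mulrS fct_addE IH.
  by case: z => m; rewrite ?NegzE ?mulrNz -?pmulrn -?Hn.
exact: HM.
Qed.

(** As an abelian group the augmentation module is a product of copies of [C] indexed by the
    non-trivial elements of [hs]; the coordinate at 1 is minus the sum of the others. Acyclicity
    ignores the action. *)
Lemma augmentation_acyclic k : acyclic_above k C -> acyclic_above k augmentation.
Proof.
move=> acC j F kj dF mF.
have /choice[E EP] : forall x : G, exists E : chains j G -> C,
    x \in hs -> dV E = (fun s => F s x) /\ forall s, coef_mem (E s).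
  move=> x; have [xh|_] := boolP (x \in hs); last by exists 0.
  have [|s|E dE mE] := acC j (fun s => F s x) kj; last by exists E.
    by apply/funext => s; rewrite -dV_fct dF.
  by have [mF1 _ _] := mF s; exact: mF1.
pose E' (s : chains j G) (x : G) : C :=
  if x \notin hs then 0 else if x == 1%g then - \sum_(y <- hs | y != 1%g) E y s else E x s.
exists E'.
  apply/funext => s; apply/funext => x; rewrite dV_fct /E'.
  have [xh|xh] := boolP (x \in hs); last first.
    by rewrite /= (_ : (fun=> 0) = 0)// dV0; have [_ -> //] := mF s.
  have [->|x1] := eqVneq x 1%g; last by have [dE _] := EP x xh; exact: (congr1 (@^~ s) dE).
  rewrite /= (_ : (fun t => _) = - (fun t => \sum_(y <- hs | y != 1%g) E y t))// dVN.
  rewrite -[LHS]/(- dV (fun t => \sum_(y <- hs | y != 1%g) E y t) s).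
  have -> : dV (fun t => \sum_(y <- hs | y != 1%g) E y t) s = \sum_(y <- hs | y != 1%g) F s y.
    rewrite /dV; under eq_bigr do rewrite mulrz_suml.
    rewrite exchange_big/= big_seq_cond [RHS]big_seq_cond; apply: eq_bigr => y /andP[yh _].
    by have [dE _] := EP y yh; exact: (congr1 (@^~ s) dE).
  have [_ _] := mF s; rewrite (bigD1_seq 1%g)//= => /eqP; rewrite addr_eq0 => /eqP->.
  by [].
move=> s; split=> [x xh|x xh|].
- rewrite /E' xh/=; case: eqP => _; last by have [_ +] := EP x xh; exact.
  rewrite big_seq_cond; apply: coef_memN; apply: coef_mem_sum => y /andP[yh _].
  by have [_ +] := EP y yh; exact.
- by rewrite /E' xh.
- rewrite (bigD1_seq 1%g)//= {1}/E' hs1 eqxx /= addrC.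
  apply/eqP; rewrite subr_eq0; apply/eqP; rewrite big_seq_cond [RHS]big_seq_cond.
  by apply: eq_bigr => y /andP[yh /negbTE y1]; rewrite /E' yh y1.
Qed.

End Augmentation.

(** An equivariant map to [hs], without continuity: a continuous one would be constant on a
    connected group, against equivariance as soon as [hs] is non-trivial. *)
Definition retract (lam : G -> G) : Prop :=
  (forall g, lam g \in hs) /\ forall g h, h \in hs -> lam (g * h)%g = (lam g * h)%g.

Section Descent.
Variables (C : coefficients) (lam : G -> G).
Hypothesis lamP : retract lam.

(* A lift of [F] to the coinduced module; its coboundary is augmentation valued. *)
Definition spread n (F : chains n G -> C) : chains n G -> augmentation C :=
  fun s x => if lam (s (@vertex R n 0)) == x then F s else 0.

Lemma spread_equivariant n (F : chains n G -> C) :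
  equivariant F -> equivariant (spread F).
Proof.
move=> eF h s hh; apply/funext => x; have [_ lamM] := lamP.
rewrite /spread /= /mkcts /aug_act lamM// eF// (can2_eq (mulgK h) (mulgVK h)).
by case: ifP; rewrite ?coef_act0.
Qed.

Lemma sum_spread n (F : chains n G -> C) s : \sum_(x <- hs) spread F s x = F s.
Proof.
have [lamh _] := lamP.
rewrite (bigD1_seq (lam (s (@vertex R n 0))))//= /spread eqxx big1 ?addr0// => x.
by rewrite eq_sym => /negbTE->.
Qed.

Lemma dV_spread_mem n (F : chains n G -> C) : dV F = 0 -> (forall s, coef_mem (F s)) ->
  forall s, coef_mem (dV (spread F) s).
Proof.
move=> dF mF s; have [lamh _] := lamP; split=> [x xh|x xh|].
- rewrite dV_fct; apply: coef_mem_dV => t; rewrite /spread; case: ifP => // _.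
  exact: coef_mem0.
- rewrite dV_fct (_ : (fun t => _) = 0) ?dV0//; apply/funext => t; rewrite /spread.
  by case: eqP => // e; rewrite -e lamh in xh.
- under eq_bigr do rewrite dV_fct.
  rewrite exchange_big/= -[RHS](congr1 (@^~ s) dF); apply: eq_bigr => i _.
  by rewrite -mulrz_suml sum_spread.
Qed.

(** Frobenius reciprocity: [spread F - g'] is an equivariant cocycle in the coinduced module, so its
    coordinate at 1 determines the others. The coordinates sum to [F], since those of [g'] sum to
    zero. *)
Lemma descent n (F : chains n G -> C) (g' : chains n G -> augmentation C) :
  dV F = 0 -> (forall s, coef_mem (F s)) -> equivariant F ->
  dV g' = dV (spread F) -> (forall s, coef_mem (g' s)) -> equivariant g' ->
  exists D : chains n G -> C, [/\ dV D = 0, forall s, coef_mem (D s) &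
    forall s, F s = \sum_(h <- hs) coef_act h (D (transl h^-1%g \o s))].
Proof.
move=> dF mF eF dg mg eg; pose D s := (spread F - g') s 1%g.
have [lamh _] := lamP.
have e_sub : equivariant (spread F - g').
  move=> h s hh; rewrite !fct_subE (spread_equivariant eF)// eg//.
  by rewrite (coef_actB (c := augmentation C)).
exists D; split=> [|s|s].
- by apply/funext => s; rewrite /D -(dV_fct (spread F - g')) dVB dg subrr.
- apply: coef_memB; last by have [+ _ _] := mg s; exact.
  by rewrite /spread; case: ifP => // _; exact: coef_mem0.
- transitivity (\sum_(h <- hs) (spread F - g') s h).
    rewrite (eq_bigr (fun h => spread F s h - g' s h))// sumrB sum_spread.
    by have [_ _ ->] := mg s; rewrite subr0.
  rewrite big_seq [RHS]big_seq; apply: eq_bigr => h hh.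
  rewrite /D e_sub ?hsV//= /aug_act -coef_actM invgK mulVg coef_act1 mul1g.
  by [].
Qed.

End Descent.

Variables (N : nat) (O : nat -> set (set G)) (lam : nat -> G -> G).
Hypothesis Oopen : forall c U, O c U -> open U.
Hypothesis Ocover : forall x, exists2 c, (c < N)%N & exists2 U, O c U & U x.
Hypothesis lamP : forall c, retract (lam c).
Hypothesis lamE : forall c U, O c U -> exists h, forall g, U g -> lam c g = h.

(* The coboundary of [spread (lam m) F] moreover vanishes on the simplices of
   colour [m], whence the downward induction on [m]. *)
Lemma equivariant_exact m : (m <= N)%N -> forall k (C : coefficients) j (F : chains j.+1 G -> C),
  (k <= j)%N -> acyclic_above k C -> dV F = 0 -> (forall s, coef_mem (F s)) ->
  equivariant F -> (forall c s, (c < m)%N -> small (O c) s -> F s = 0) ->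
  exists g : chains j G -> C, [/\ dV g = F, forall s, coef_mem (g s) & equivariant g].
Proof.
move: {2}(N - m)%N (erefl (N - m)%N) => r; elim: r m => [|r IH] m rE mN k C j F kj acC dF mF eF F0.
  (* All colours are used up, so [F] vanishes on the small simplices of a genuine open cover. *)
  apply: (@small_coboundary_equivariant _ (fun U => exists2 c, (c < N)%N & O c U)) => //.
  - by move=> U [c _]; exact: Oopen.
  - by move=> x; have [c cN [U OU Ux]] := Ocover x; exists U => //; exists c.
  - by move=> t [U [c cN OU] tU]; apply: (F0 c); [lia|exists U].
have [|||||||c s|g' [dg' mg' eg']] := IH m.+1 _ _ k (augmentation C) j.+1 (dV (spread (lam m) F)).
- lia.
- lia.
- lia.
- exact: augmentation_acyclic.
- exact: dVdV.
- exact: (dV_spread_mem (lamP m) dF mF).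
- exact/equivariant_dV/spread_equivariant.
- rewrite ltnS leq_eqVlt => /predU1P[->|cm] [U OU sU].
    (* Inside a member of colour [m] the faces of [s] all have the same value of [lam m] at their
       first vertex, so spreading commutes with the coboundary there and [dV F = 0] applies. *)
    have [h hP] := lamE OU; apply/funext => x; rewrite dV_fct.
    transitivity (if h == x then dV F s else 0); last by rewrite dF if_same.
    rewrite /dV /spread; case: ifP => hx.
      by apply: eq_bigr => i _; rewrite hP ?hx//; exact: sU.
    by rewrite big1// => i _; rewrite hP ?hx ?mul0rz//; exact: sU.
  apply/funext => x; rewrite dV_fct /dV big1// => i _; rewrite /spread.
  rewrite (F0 c)//; first by rewrite if_same mul0rz.
  by exists U => // p; exact: sU.
have [D [dD mD DF]] := descent (lamP m) dF mF eF dg' mg' eg'.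
have [E dE mE] := acC j D kj dD mD.
(* The primitive [E] of [D] need not be equivariant; its transfer is, and the transfer of [D] is
   [F]. *)
exists (fun s : chains j G => \sum_(h <- hs) coef_act h (E (transl h^-1%g \o s))); split.
- apply/funext => s; rewrite DF /dV; under eq_bigr do rewrite mulrz_suml.
  rewrite exchange_big/= big_seq [RHS]big_seq; apply: eq_bigr => h hh.
  rewrite -dE /dV coef_act_sum; apply: eq_bigr => i _; rewrite coef_actMz.
  by congr (coef_act _ (E _) *~ _); exact/continuousEP.
- move=> s; rewrite big_seq; apply: coef_mem_sum => h hh.
  by apply: coef_act_mem => //; exact: mE.
- move=> h s hh; rewrite coef_act_sum.
  rewrite -[LHS](sum_mulr _ hh).
  apply: eq_bigr => x _; rewrite transl_comp coef_actM invgM mulVKg.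
  by [].
Qed.

(** [F] lies in the critical degree [k], where it may well have no primitive. The coboundary of its
    spread lies one degree higher, and there [equivariant_exact] applies. *)
Lemma equivariant_transfer k (C : coefficients) (F : chains k G -> C) :
  acyclic_above k C -> dV F = 0 -> (forall s, coef_mem (F s)) -> equivariant F ->
  exists D : chains k G -> C, [/\ dV D = 0, forall s, coef_mem (D s) &
    forall s, F s = \sum_(h <- hs) coef_act h (D (transl h^-1%g \o s))].
Proof.
move=> acC dF mF eF.
have [||||||g' [dg' mg' eg']] := @equivariant_exact 0 _ k (augmentation C) k (dV (spread (lam 0) F)) _ (augmentation_acyclic acC).
- by [].
- by [].
- exact: dVdV.
- exact: (dV_spread_mem (lamP 0) dF mF).
- exact/equivariant_dV/spread_equivariant.
- by [].
exact: (descent (lamP 0) dF mF eF dg' mg' eg').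
Qed.

End Equivariant.

(** * Colourings of a Lie group *)

Section LocalStructure.
Variables (R : realType) (d : nat) (G : lieGroupType R d).
Local Notation simplex := (simplex R).
Local Notation chains n X := (continuousType (simplex n) X).

Lemma chart_ball (x : G) : exists (c : chart R d G) (r : R),
  [/\ 0 < r, chart_dom c x & closed_ball (chart_map c x) r `<=` chart_cod c].
Proof.
have [c _ cx] := lie_atlas_cover x.
have /nbhs_ballP[r /= r0 rB] : nbhs (chart_map c x) (chart_cod c).
  by apply: open_nbhs_nbhs; split; [exact: chart_cod_open|exact: chart_map_cod].
exists c, (r / 2); split=> //; first by rewrite divr_gt0.
by apply: subset_trans rB; apply: closed_ball_subset => //; rewrite ?divr_gt0// ltr_pdivrMr// mulr_natr mulr2n ltrDl.
Qed.

Lemma chart_map_nbhs (c : chart R d G) x A : chart_dom c x ->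
  nbhs (chart_map c x) A -> nbhs x [set y | chart_dom c y /\ A (chart_map c y)].
Proof.
move=> cx nA; have := @chart_map_continuous _ _ _ c.
rewrite continuous_open_subspace; last exact: chart_dom_open.
move=> /(_ x (mem_set cx)) /(_ A nA) nAx.
by apply: filterI => //; apply: open_nbhs_nbhs; split=> //; exact: chart_dom_open.
Qed.

Lemma chart_inv_cts (c : chart R d G) y : chart_cod c y -> {for y, continuous (chart_inv c)}.
Proof.
move=> cy; have := @chart_inv_continuous _ _ _ c.
rewrite continuous_open_subspace; last exact: chart_cod_open.
by apply; exact: mem_set.
Qed.

Lemma local_path (x : G) : exists2 W, nbhs x W &
  forall y, W y -> exists c : chains 1 G, c (@vertex R 1 0) = x /\ c (@vertex R 1 1) = y.
Proof.
have [c [r [r0 cx rB]]] := chart_ball x.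
exists [set y | chart_dom c y /\ ball (chart_map c x) r (chart_map c y)].
  by apply: chart_map_nbhs => //; exact: nbhsx_ballx.
move=> y [cy]; rewrite -ball_normE /= => yr.
set a := chart_map c x; set b := chart_map c y.
pose f (s : simplex 1) : 'rV[R]_d := a + coords s ord0 ord_max *: (b - a).
have s1 (s : simplex 1) : 0 <= coords s ord0 ord_max <= 1.
  rewrite coords_ge0 -(sum_coords s) big_ord_recr /= lerDr.
  by apply: sumr_ge0 => i _; exact: coords_ge0.
have fc s : chart_cod c (f s).
  apply: rB; rewrite closed_ballE//= /closed_ball_ /f /= opprD addrA subrr add0r normrN normrZ.
  have /andP[s0 s1'] := s1 s; rewrite ger0_norm// distrC.
  by rewrite (le_trans (ler_piMl _ s1'))// ltW.
have fcts : continuous f.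
  have hcts : continuous (fun t : R => a + t *: (b - a)).
    by move=> t; apply: cvgD; [exact: cvg_cst|apply: cvgZr_tmp; exact: cvg_id].
  have ccts : continuous (fun v : 'rV[R]_2 => v ord0 ord_max) by exact: coord_continuous.
  have vcts : continuous (fun s : simplex 1 => set_val s : 'rV[R]_2).
    exact: initial_continuous.
  move=> s; apply: (@continuous_comp _ _ _ (fun s : simplex 1 => coords s ord0 ord_max) (fun t => a + t *: (b - a))); last exact: hcts.
  by apply: (@continuous_comp _ _ _ (fun s : simplex 1 => set_val s : 'rV[R]_2) (fun v : 'rV[R]_2 => v ord0 ord_max)); [exact: vcts|exact: ccts].
have gcts : continuous (chart_inv c \o f).
  by move=> s; apply: continuous_comp; [exact: fcts|exact: chart_inv_cts].
exists (mkcts gcts); split.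
  rewrite -[LHS]/(chart_inv c (f (vertex R 1 0))) /f coords_vertex /=.
  by rewrite scale0r addr0 chart_mapK.
rewrite -[LHS]/(chart_inv c (f (vertex R 1 1))) /f coords_vertex /=.
by rewrite scale1r addrC subrK chart_mapK.
Qed.

Lemma path_rev (X : topologicalType) (c : chains 1 X) : exists c' : chains 1 X,
  c' (@vertex R 1 0) = c (@vertex R 1 1) /\ c' (@vertex R 1 1) = c (@vertex R 1 0).
Proof.
exists (c \o affine 1 (fun i => @vertex R 1 (1 - i)%N)) => /=.
by rewrite !affine_vertex.
Qed.

(** A property that propagates along paths holds on an open set, and so does its negation, because
    paths can be reversed. *)
Lemma lie_chain_connected : connected [set: G] -> chain_connected R G.
Proof.
move=> Gc P Pc y y' Py.
have openP (Q : G -> Prop) : (forall c : chains 1 G, Q (c (@vertex R 1 0)) -> Q (c (@vertex R 1 1))) -> open [set x | Q x].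
  move=> Qc; rewrite openE => x Qx; have [W Wx WP] := local_path x.
  by apply: filterS Wx => z /WP[c [c0 c1]] /=; rewrite -c1; apply: Qc; rewrite c0.
suff PT : [set x | P x] = [set: G].
  by have : [set: G] y' by []; rewrite -PT.
apply: Gc.
- by exists y.
- by exists [set x | P x]; [exact: openP|rewrite setTI].
- exists [set x | P x]; last by rewrite setTI.
  rewrite -[X in closed X]setCK; apply: open_closedC; apply: (openP (fun x => ~ P x)).
  move=> c nP Pc1; apply: nP; have [c' [c0 c1]] := path_rev c.
  by rewrite -c1; apply: Pc; rewrite c0.
Qed.

Lemma compact_nbhs1 : exists2 K : set G, compact K & nbhs (1%g : G) K.
Proof.
have [c [r [r0 c1 rB]]] := chart_ball (1%g : G).
exists (chart_inv c @` closed_ball (chart_map c 1%g) r).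
  apply: continuous_compact.
    apply: continuous_in_subspaceT => y; rewrite inE => /rB; exact: chart_inv_cts.
  apply: bounded_closed_compact; last exact: closed_ball_closed.
  rewrite closed_ballE//; exists (r + `|chart_map c 1%g|); split; first exact: num_real.
  move=> M rM y /=; rewrite /closed_ball_ /= => yr; apply: le_trans (ltW rM).
  rewrite -(subrK (chart_map c 1%g) y) (le_trans (ler_normD _ _))// lerD2r.
  by rewrite distrC.
have : nbhs (1%g : G) [set y | chart_dom c y /\ ball (chart_map c 1%g) r (chart_map c y)].
  by apply: chart_map_nbhs => //; exact: nbhsx_ballx.
apply: filterS => y [cy yr]; exists (chart_map c y); last exact: chart_mapK.
exact: subset_closed_ball.
Qed.

End LocalStructure.

Section Independent.
Variables (T : Type) (rel : T -> T -> Prop).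
Hypothesis relC : forall x y, rel x y -> rel y x.

Definition independent (B : set T) : Prop :=
  forall x y, B x -> B y -> rel x y -> x = y.

Lemma maximal_independent (A : set T) : exists2 B, B `<=` A &
  independent B /\ forall x, A x -> ~ B x -> exists2 y, B y & rel x y.
Proof.
have [F FP Ftot|B [[BA Bi] Bmax]] := @Zorn_bigcup T [set B | B `<=` A /\ independent B].
  split=> [x [B FB Bx]|x y [B FB Bx] [C FC Cy]]; first by have [+ _] := FP B FB; exact.
  have [BC|CB] := Ftot B C FB FC.
    by have [_] := FP C FC; apply => //; exact: BC.
  by have [_] := FP B FB; apply => //; exact: CB.
exists B => //; split=> // x Ax nBx; apply: contrapT => nrel.
apply: (Bmax (B `|` [set x])).
  split=> [y By|]; first by left.
  by move=> /(_ x) H; apply: nBx; apply: H; right.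
split=> [y [/BA//|->//]|y z [By|->] [Bz|->]//].
- exact: Bi.
- by move=> yx; case: nrel; exists y => //; exact: relC.
- by move=> xz; case: nrel; exists z.
Qed.

(* A greedy colouring: remove maximal independent sets one after the other. *)
Lemma colouring (S : set T) (M : nat) :
  (forall x (f : 'I_M.+1 -> T), S x -> injective f -> (forall i, S (f i)) ->
     ~ forall i, rel x (f i)) ->
  exists2 C : nat -> set T, (forall c, C c `<=` S /\ independent (C c)) &
  forall x, S x -> exists2 c, (c <= M)%N & C c x.
Proof.
move=> bounded.
have /choice[mis misP] : forall A : set T, exists B, B `<=` A /\
  (independent B /\ forall x, A x -> ~ B x -> exists2 y, B y & rel x y).
  by move=> A; have [B BA BP] := maximal_independent A; exists B.
pose rest c := iter c (fun A => A `\` mis A) S.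
have restS c : rest c `<=` S.
  by elim: c => [//|c IH] x [+ _]; exact: IH.
have rest_mono c c' : (c <= c')%N -> rest c' `<=` rest c.
  elim: c' => [|c' IH]; first by rewrite leqn0 => /eqP->.
  by rewrite leq_eqVlt => /predU1P[->//|/IH sub] x [/sub].
exists (fun c => mis (rest c)).
  by move=> c; have [sub [ind _]] := misP (rest c); split=> // x /sub; exact: restS.
move=> x Sx; apply: contrapT => nx.
(* An element left over after [M.+1] rounds would be related to a member of each of [M.+1] pairwise
   disjoint independent sets. *)
have restx c : (c <= M.+1)%N -> rest c x.
  elim: c => [//|c IH] cM; split; first by apply: IH; exact: ltnW.
  by move=> mx; apply: nx; exists c.
have /choice[f fP] : forall i : 'I_M.+1, exists y, mis (rest i) y /\ rel x y.
  move=> i; have [_ [_ mx]] := misP (rest i).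
  have [|nmx|y my xy] := mx x; last by exists y.
    by apply: restx; exact: ltnW.
  by apply: nx; exists i => //; rewrite -ltnS.
apply: (bounded x f) => // [i j fij|i|i]; last by have [] := fP i.
  wlog ij : i j fij / (i <= j)%N.
    by move=> H; have [/H->//|/ltnW/H->//] := leqP i j.
  apply/val_inj; move: ij; rewrite leq_eqVlt => /predU1P[//|ij].
  have [mi _] := fP i; have [mj _] := fP j.
  have [sub _] := misP (rest j); have := rest_mono i.+1 j ij _ (sub _ mj).
  by rewrite -fij => -[_]; case.
by have [mi _] := fP i; have [sub _] := misP (rest i); apply: (restS i); exact: sub.
Qed.

End Independent.

Section EquivariantCover.
Variables (R : realType) (d : nat) (G : lieGroupType R d) (hs : seq G).
Hypothesis hs1 : (1%g : G) \in hs.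
Hypothesis hsV : forall h, h \in hs -> (h^-1)%g \in hs.
Hypothesis hsM : forall h h', h \in hs -> h' \in hs -> (h * h')%g \in hs.

Lemma mul_cts (T : topologicalType) (f g : T -> G) :
  continuous f -> continuous g -> continuous (fun x => (f x * g x)%g).
Proof.
move=> cf cg x; apply: (@continuous_comp _ _ _ (fun x => (f x, g x))
  (fun p : G * G => (p.1 * p.2)%g)); last exact: lie_mul_continuous.
by apply: cvg_pair; [exact: cf|exact: cg].
Qed.

Lemma inv_cts (T : topologicalType) (f : T -> G) :
  continuous f -> continuous (fun x => (f x)^-1%g).
Proof. by move=> cf x; apply: continuous_comp; [exact: cf|exact: lie_inv_continuous]. Qed.

Lemma cst_cts (T : topologicalType) (g : G) : continuous (fun _ : T => g).
Proof. by move=> x; exact: cvg_cst. Qed.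

Lemma id_cts (T : topologicalType) : continuous (fun x : T => x).
Proof. by move=> x. Qed.

Lemma fst_cts : continuous (fun p : G * G => p.1).
Proof. by move=> x; exact: cvg_fst. Qed.

Lemma snd_cts : continuous (fun p : G * G => p.2).
Proof. by move=> x; exact: cvg_snd. Qed.

Lemma div_nbhs (A : set G) : nbhs (1%g : G) A ->
  exists V : set G, [/\ open V, V 1%g & forall a b, V a -> V b -> A (a^-1 * b)%g].
Proof.
move=> nA.
have cts : continuous (fun p : G * G => (p.1^-1 * p.2)%g).
  by apply: mul_cts; [apply: inv_cts; exact: fst_cts|exact: snd_cts].
have : nbhs (1%g : G, 1%g : G) [set p | A (p.1^-1 * p.2)%g].
  by apply: (cts (1%g, 1%g)); rewrite /= invg1 mulg1.
move=> [[P Q] [/= nP nQ] PQ].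
exists (P° `&` Q°); split.
- by apply: openI; exact: open_interior.
- by split.
- by move=> a b [/interior_subset Pa _] [_ /interior_subset Qb]; exact: (PQ (a, b)).
Qed.

(** Translates [s * V], for [s] in a maximal [V]-separated set [S], cover [G]. Two of them conflict
    when they meet after right translation by an element of [hs]; compactness of [K] bounds the
    conflicts of each, hence the number of colours. Within one colour every coset of [hs] meets the
    union of the translates at most once, and that point is the natural representative of the
    coset. *)
Lemma equivariant_cover : exists (N : nat) (O : nat -> set (set G)) (lam : nat -> G -> G),
  [/\ forall c U, O c U -> open U,
      forall x, exists2 c, (c < N)%N & exists2 U, O c U & U x,
      forall c, retract hs (lam c) &
      forall c U, O c U -> exists h, forall g, U g -> lam c g = h].
Proof.
have [K cK nK] := compact_nbhs1 G.
have nhs : nbhs (1%g : G) [set g | g \in hs -> g = 1%g].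
  have : closed [set` rem 1%g (undup hs)].
    move: (@hausdorff_accessible _ (@lie_hausdorff R d G)) => /accessible_finite_set_closed.
    by apply; exact: finite_seq.
  move=> /closed_openC; rewrite openE => /(_ 1%g) /=.
  rewrite rem_filter ?undup_uniq// mem_filter /= eqxx/= => /(_ notF).
  apply: filterS => g /=; rewrite mem_filter/= mem_undup => nm gh.
  by apply: contrapT => g1; apply: nm; rewrite gh andbT; apply/eqP.
(* [V1] is so small that two of its points in the same coset of [hs] coincide. *)
have [V1 [oV1 V11 V1P]] := div_nbhs nhs.
pose V0 := K° `&` V1.
pose V := V0 `&` [set g | V0 g^-1%g].
have oV0 : open V0 by apply: openI => //; exact: open_interior.
have oV : open V.
  apply: openI => //.
  by apply: (open_comp _ oV0) => x _; apply: inv_cts; exact: id_cts.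
have V01 : V0 1%g by split.
have V_1 : V 1%g by split => //=; rewrite invg1.
have VV g : V g -> V g^-1%g by move=> [? ?]; split => //=; rewrite invgK.
have VK : V `<=` K by move=> g [[/interior_subset]].
have Vhs a b : V a -> V b -> (a^-1 * b)%g \in hs -> a = b.
  move=> [[_ a1] _] [[_ b1] _] /(V1P _ _ a1 b1) e.
  by rewrite -[b](mulVKg a) e mulg1.
have [Q [oQ Q1 QP]] := div_nbhs (open_nbhs_nbhs (conj oV V_1)).
have [S _ [Si Smax]] := @maximal_independent G (fun s t => V (s^-1 * t)%g)
  ltac:(by move=> s t /VV; rewrite invgM invgK) [set: G].
pose conflict (s t : G) := exists v v' h, [/\ V v, V v', h \in hs & (s * v * h = t * v')%g].
have conflictC s t : conflict s t -> conflict t s.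
  move=> [v [v' [h [Vv Vv' hh e]]]]; exists v', v, h^-1%g; split=> //; first exact: hsV.
  by rewrite -e mulgK.
have /choice[ys ysP] : forall h : G, exists ys : seq G,
    forall a b, K a -> K b -> exists2 y, y \in ys & Q (y^-1 * (a * h * b^-1))%g.
  move=> h; pose f (p : G * G) := (p.1 * h * p.2^-1)%g.
  have cf : continuous f.
    apply: mul_cts; last by apply: inv_cts; exact: snd_cts.
    by apply: mul_cts; [exact: fst_cts|exact: cst_cts].
  have fK : compact (f @` (K `*` K)).
    by apply: continuous_compact; [exact: continuous_subspaceT|exact: compact_setX].
  (* Compactness is used as a near-covering property along the filter of growing finite lists: one
     list of translates of [Q] then covers the whole compact set. *)
  pose F := filter_from [set: seq G] (fun r => [set r' : seq G | {subset r <= r'}]).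
  have FF : Filter F.
    apply: filter_from_filter; first by exists [::].
    move=> r r' _ _; exists (r ++ r') => // t rt.
    by split=> x xr; apply: rt; rewrite mem_cat xr ?orbT.
  pose P (r : seq G) (x : G) := exists2 y, y \in r & Q (y^-1 * x)%g.
  have [x _|r _ rP] := (compact_near_coveringP _).1 fK _ F P FF.
    exists ([set x' | Q (x^-1 * x')%g], [set r : seq G | x \in r]).
      split; last by exists [:: x] => // r; apply; rewrite inE.
      apply: open_nbhs_nbhs; split; last by rewrite /= mulVg.
      apply: (open_comp _ oQ) => y _.
      by apply: mul_cts; [exact: cst_cts|exact: id_cts].
    by move=> [x' r] /= [Qx xr]; exists x.
  by exists r => a b Ka Kb; apply: (rP r) => //; exists (a, b).
pose Y := flatten [seq ys h | h <- hs].
have YP s t : conflict s t -> exists2 y, y \in Y & Q (y^-1 * (s^-1 * t))%g.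
  move=> [v [v' [h [Vv Vv' hh e]]]].
  have [y yh Qy] := ysP h v v' (VK _ Vv) (VK _ Vv').
  exists y; first by apply/flattenP; exists (ys h) => //; exact: map_f.
  rewrite (_ : (s^-1 * t = v * h * v'^-1)%g)//.
  by rewrite -[t](mulgK v') -e !mulgA mulVg mul1g.
have [|C CP Ccover] := @colouring G conflict conflictC S (size Y).
  move=> x f Sx finj Sf cf.
  have /choice[g gP] : forall i, exists j : 'I_(size Y), Q ((nth 1 Y j)^-1 * (x^-1 * f i))%g.
    move=> i; have [y yY Qy] := YP _ _ (cf i).
    have lty : (index y Y < size Y)%N by rewrite index_mem.
    by exists (Ordinal lty); rewrite /= nth_index.
  (* Two elements of [S] sent to the same translate of [Q] differ by an element of [Q^-1 * Q], which
     lies in [V], so they agree by separation. *)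
  have ginj : injective g.
    move=> i j gij; apply: finj; apply: Si => //.
    have := QP _ _ (gP i) (gP j); rewrite gij !invgM !invgK !mulgA.
    by rewrite mulgK mulgK.
  by have := leq_card g ginj; rewrite !card_ord ltnn.
pose box (s h : G) := [set x | V (s^-1 * x * h^-1)%g].
pose O c := [set U | exists s h, [/\ C c s, h \in hs & U = box s h]].
pose orb (g : G) := [set x | exists2 h, h \in hs & x = (g * h)%g].
pose core c := [set x | exists2 s, C c s & V (s^-1 * x)%g].
(* The representative depends on the orbit only as a set, which makes [lam c] equivariant; on orbits
   that miss the core any choice will do. *)
pose rep c (A : set G) : G :=
  if `[< A `&` core c !=set0 >] then xget 1%g (A `&` core c) else xget 1%g A.
have orb_self g : orb g g by exists 1%g; rewrite ?mulg1.
have repP c g : orb g (rep c (orb g)).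
  rewrite /rep; case: asboolP => [[x xP]|_].
    by have [] := @xgetPex _ (1%g : G) (orb g `&` core c) (ex_intro _ x xP).
  exact: (@xgetPex _ (1%g : G) (orb g) (ex_intro _ g (orb_self g))).
pose lam c (g : G) : G := ((rep c (orb g))^-1 * g)%g.
exists (size Y).+1, O, lam; split.
- move=> c U [s [h [_ _ ->]]]; apply: (open_comp _ oV) => x _.
  apply: mul_cts; last exact: cst_cts.
  by apply: mul_cts; [exact: cst_cts|exact: id_cts].
- move=> x; have [s Ss Vsx] : exists2 s, S s & V (s^-1 * x)%g.
    have [Sx|nSx] := pselect (S x); first by exists x; rewrite ?mulVg.
    have [y Sy Vxy] := Smax x I nSx; exists y => //.
    by have := VV _ Vxy; rewrite invgM invgK.
  have [c cY Cs] := Ccover s Ss; exists c => //; exists (box s 1%g).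
    by exists s, 1%g.
  by rewrite /box /= invg1 mulg1.
- move=> c; split=> [g|g h hh].
    by rewrite /lam; have [h hh ->] := repP c g; rewrite invgM mulgVK; exact: hsV.
  rewrite /lam (_ : orb (g * h)%g = orb g) ?mulgA//.
  apply/seteqP; split=> x [h' hh' ->].
    by exists (h * h')%g; [exact: hsM|rewrite mulgA].
  by exists (h^-1 * h')%g; [apply: hsM => //; exact: hsV|rewrite -mulgA mulVKg].
- move=> c U [s [h [Cs hh ->]]]; exists h => g; rewrite /box /=.
  move vdef: (s^-1 * g * h^-1)%g => v Vg.
  have gE : g = (s * v * h)%g by rewrite -vdef -!mulgA mulVKg mulVg mulg1.
  have sv : (orb g `&` core c) (s * v)%g.
    split; first by exists h^-1%g; rewrite ?hsV// gE mulgK.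
    by exists s => //; rewrite mulKg.
  have : (orb g `&` core c) (rep c (orb g)).
    rewrite /rep; case: asboolP => [_|[]]; last by exists (s * v)%g.
    exact: (@xgetPex _ (1%g : G) (orb g `&` core c) (ex_intro _ _ sv)).
  move=> [[h' hh' repE] [s' Cs' Vs']].
  have [CS Ci] := CP c.
  have repE' : rep c (orb g) = (s * v * (h * h'))%g by rewrite repE gE !mulgA.
  have ss' : s = s'.
    apply: Ci => //; exists v, (s'^-1 * rep c (orb g))%g, (h * h')%g; split=> //; first exact: hsM.
    by rewrite mulVKg repE'.
  have vE : v = (s^-1 * rep c (orb g))%g.
    apply: Vhs => //; first by rewrite ss'.
    by rewrite repE' -!mulgA mulKg mulKg; exact: hsM.
  have repsv : rep c (orb g) = (s * v)%g by rewrite {1}vE mulVKg.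
  by rewrite /lam repsv {1}gE mulKg.
Qed.

End EquivariantCover.

(** * Duality modulo a prime *)

(* A partial homomorphism to F_l, given by its graph, extends: F_l is injective
   among groups of exponent l. *)
Section GraphExtension.
Variables (l : nat) (V : zmodType) (Gam : set (V * 'F_l)).
Hypothesis l_prime : prime l.
Hypothesis Gam_l : forall v, Gam (v *+ l, 0).
Hypothesis GamB : forall p q, Gam p -> Gam q -> Gam (p - q).
Hypothesis Gam_fun : forall t, Gam (0, t) -> t = 0.

Let good (B : set (V * 'F_l)) : Prop :=
  [/\ Gam `<=` B, forall p q, B p -> B q -> B (p - q) & forall t, B (0, t) -> t = 0].

Lemma graph_extension : exists f : V -> 'F_l,
  {morph f : x y / x - y} /\ forall v t, Gam (v, t) -> f v = t.
Proof.
have [F FP Ftot|B [Bgood Bmax]] := @Zorn_bigcup _ [set B | B = set0 \/ good B].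
  have [[B0 FB0 B0good]|none] := pselect (exists2 B, F B & good B); last first.
    left; apply/seteqP; split=> // p [B FB Bp].
    have [B0|Bg] := FP B FB; first by rewrite B0 in Bp.
    by case: none; exists B.
  right; split=> [p Gp|p q [B FB Bp] [C FC Cq]|t [B FB Bt]].
  - by exists B0 => //; have [+ _ _] := B0good; apply.
  - have [BC|CB] := Ftot B C FB FC.
      have [C0|[_ CB _]] := FP C FC; first by rewrite C0 in Cq.
      by exists C => //; apply: CB => //; exact: BC.
    have [B0'|[_ BB _]] := FP B FB; first by rewrite B0' in Bp.
    by exists B => //; apply: BB => //; exact: CB.
  - by have [B0'|[_ _ Bf]] := FP B FB; [rewrite B0' in Bt|exact: Bf].
have {Bgood}[GB BB Bf] : good B.
  case: Bgood => // B0; exfalso; apply: (Bmax Gam); last by right; split.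
  by rewrite B0; split=> // /(_ _ (Gam_l 0)).
have B_l v : B (v *+ l, 0) by exact/GB/Gam_l.
have B00 : B (0, 0) by have := B_l 0; rewrite mul0rn.
have BN p : B p -> B (- p) by move=> Bp; rewrite -sub0r; apply: BB.
have BD p q : B p -> B q -> B (p + q).
  by move=> Bp Bq; rewrite -[q]opprK; apply: BB => //; exact: BN.
have BM p z : B p -> B (p *~ z).
  move=> Bp; have H n : B (p *+ n) by elim: n => [//|n IH]; rewrite mulrS; exact: BD.
  by case: z => n; rewrite ?NegzE ?mulrNz -!pmulrn; [|apply: BN].
have pairMz (v : V) (t : 'F_l) z : (v, t) *~ z = (v *~ z, t *~ z).
  have H n : (v, t) *+ n = (v *+ n, t *+ n).
    by elim: n => [//|n IH]; rewrite !mulrS IH.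
  by case: z => n; rewrite ?NegzE ?mulrNz -!pmulrn H.
have total v : exists t, B (v, t).
  apply: contrapT => nv.
  (* [B'] extends the graph by sending [v] to 0. If it fails to be a graph, some [v *~ z] with [z]
     prime to [l] is already in the domain; a Bezout relation then puts [v] there too, since all
     multiples of [l] are. *)
  pose B' := [set p | exists w t z, B (w, t) /\ p = (w + v *~ z, t)].
  apply: (Bmax B'); last right; split.
  - by move=> [w t] Bwt; exists w, t, 0; rewrite mulr0z addr0.
  - move=> /(_ (v, 0)) H; apply: nv; exists 0; apply: H.
    by exists 0, 0, 1; rewrite mulr1z add0r.
  - by move=> [w t] /GB Bwt; exists w, t, 0; rewrite mulr0z addr0.
  - move=> _ _ [w [t [z [Bwt ->]]]] [w' [t' [z' [Bwt' ->]]]].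
    exists (w - w'), (t - t'), (z - z'); split; first exact: (BB _ _ Bwt Bwt').
    by congr (_, _); rewrite /= mulrzBr opprD addrACA.
  - move=> _ [w [t [z [Bwt [e ->]]]]].
    have wE : w = - (v *~ z) by apply/eqP; rewrite -addr_eq0 -e.
    have [lz|lz] := boolP (l%:Z %| z)%Z.
      apply: Bf; have -> : (0, t) = (w, t) + (v *~ (z %/ l)%Z *+ l, 0).
        by congr (_, _); rewrite /= ?addr0// pmulrn -mulrzA divzK// wE addrC subrr.
      exact: BD.
    exfalso; apply: nv.
    have [[a b] /= ab] : exists ab : int * int, ab.1 * z + ab.2 * l%:Z = 1.
      have [a [b ab]] := Bezoutz z l; exists (a, b); rewrite /= ab.
      have : coprimez z l by rewrite coprimez_sym coprimezE prime_coprime// -dvdzE.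
      by rewrite /coprimez => /eqP.
    exists (- t *~ a).
    have -> : (v, - t *~ a) = (- (w, t)) *~ a + (v *~ b *+ l, 0).
      rewrite -[- (w, t)]/((- w, - t)) pairMz; congr (_, _); rewrite /= ?addr0//.
      by rewrite wE opprK pmulrn -!mulrzA -mulrzDr mulrC ab mulr1z.
    by apply: BD => //; apply: BM; exact: BN.
have /choice[f fP] := total.
have funB v s t : B (v, s) -> B (v, t) -> s = t.
  move=> Bs Bt; apply/eqP; rewrite -subr_eq0; apply/eqP/Bf.
  by have := BB _ _ Bs Bt; rewrite -[_ - _]/((v - v, s - t)) subrr.
exists f; split=> [x y|v t /GB Bvt].
  by apply: funB (fP _) _; exact: (BB _ _ (fP x) (fP y)).
exact: funB (fP v) Bvt.
Qed.

End GraphExtension.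

Section Duality.
Variables (R : realType) (l : nat).
Hypothesis l_prime : prime l.
Local Notation simplex := (simplex R).
Local Notation chains n X := (continuousType (simplex n) X).
Implicit Types X Y : topologicalType.

Lemma intr_Fp_eq0 (x : int) : (x%:~R == 0 :> 'F_l) = (l%:Z %| x)%Z.
Proof. by rewrite -(dvdz_pcharf (pchar_Fp l_prime)). Qed.

Lemma lift_Fp (t : 'F_l) : exists x : int, x%:~R = t.
Proof. by exists (t : nat)%:Z; exact: natr_Zp. Qed.

Lemma Fp_mulrn (t : 'F_l) : t *+ l = 0.
Proof. by rewrite -mulr_natr (pcharf0 (pchar_Fp l_prime)) mulr0. Qed.

Lemma dvdz_fun T (f : T -> int) : (forall x, (l%:Z %| f x)%Z) ->
  exists g, f = fun x => l%:Z * g x.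
Proof.
move=> lf; exists (fun x => (f x %/ l)%Z); apply/funext => x.
by rewrite mulrC divzK.
Qed.

Definition ev T (z : seq (int * T)) (phi : T -> int) : int :=
  \sum_(p <- z) p.1 * phi p.2.

Lemma evB T (z : seq (int * T)) phi psi : ev z (phi - psi) = ev z phi - ev z psi.
Proof. by rewrite /ev -sumrB; apply: eq_bigr => p _; rewrite fct_subE mulrBr. Qed.

Lemma evD T (z : seq (int * T)) phi psi : ev z (phi + psi) = ev z phi + ev z psi.
Proof. by rewrite /ev -big_split; apply: eq_bigr => p _; rewrite fct_addE mulrDr. Qed.

Lemma evZ T (z : seq (int * T)) c phi : ev z (fun x => c * phi x) = c * ev z phi.
Proof. by rewrite /ev mulr_sumr; apply: eq_bigr => p _; rewrite mulrCA. Qed.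

Lemma ev_cat T (z z' : seq (int * T)) phi : ev (z ++ z') phi = ev z phi + ev z' phi.
Proof. by rewrite /ev big_cat. Qed.

Definition opp_chain T (z : seq (int * T)) := [seq (- p.1, p.2) | p <- z].

Lemma ev_opp T (z : seq (int * T)) phi : ev (opp_chain z) phi = - ev z phi.
Proof.
by rewrite /ev big_map -sumrN; apply: eq_bigr => p _; rewrite /= mulNr.
Qed.

Lemma additive0 (U V : zmodType) (f : U -> V) : {morph f : x y / x - y} -> f 0 = 0.
Proof. by move=> fB; rewrite -[X in f X](subrr 0) fB subrr. Qed.

Lemma additiveN (U V : zmodType) (f : U -> V) : {morph f : x y / x - y} ->
  forall x, f (- x) = - f x.
Proof. by move=> fB x; rewrite -sub0r fB (additive0 fB) sub0r. Qed.

Lemma additiveD (U V : zmodType) (f : U -> V) : {morph f : x y / x - y} ->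
  {morph f : x y / x + y}.
Proof. by move=> fB x y; rewrite -[in LHS](opprK y) fB (additiveN fB) opprK. Qed.

Lemma additiveMz (U V : zmodType) (f : U -> V) : {morph f : x y / x - y} ->
  forall x z, f (x *~ z) = f x *~ z.
Proof.
move=> fB x z; have H n : f (x *+ n) = f x *+ n.
  by elim: n => [|n IH]; rewrite ?mulr0n ?(additive0 fB)// !mulrS (additiveD fB) IH.
by case: z => n; rewrite ?NegzE ?mulrNz ?(additiveN fB) -!pmulrn H.
Qed.

Lemma additive_sum (U V : zmodType) (f : U -> V) : {morph f : x y / x - y} ->
  forall I (r : seq I) (F : I -> U), f (\sum_(i <- r) F i) = \sum_(i <- r) f (F i).
Proof.
move=> fB I r F; exact: (big_morph f (additiveD fB) (additive0 fB)).
Qed.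

Lemma fct_mulrzE T (V : zmodType) (f : T -> V) z x : (f *~ z) x = f x *~ z.
Proof. exact: (@additiveMz _ _ (fun f : T -> V => f x)). Qed.

Lemma fct_mulrnE T (V : zmodType) (f : T -> V) n x : (f *+ n) x = f x *+ n.
Proof. by rewrite !pmulrn fct_mulrzE. Qed.

(** Otherwise the value on [a], taken modulo [l], would depend only on the boundary of a chain
    modulo [l]. Extended to all functionals and read off at the point evaluations, this homomorphism
    is a cochain with coboundary [a] modulo [l]. Functionals on cochains play the role of chains of
    degree [n]. *)
Lemma dual_chain n X (a : chains n.+1 X -> int) : ~ cob l a ->
  exists z : seq (int * chains n.+1 X),
    (forall phi : chains n X -> int, (l%:Z %| ev z (dV phi))%Z) /\ ~~ (l%:Z %| ev z a)%Z.
Proof.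
move=> na; apply: contrapT => none.
have za z : (forall phi : chains n X -> int, (l%:Z %| ev z (dV phi))%Z) -> (l%:Z %| ev z a)%Z.
  by move=> zd; apply: contrapT => /negP nl; apply: none; exists z.
pose V := (chains n X -> int) -> int.
pose bd (z : seq (int * chains n.+1 X)) : V := fun phi => ev z (dV phi).
pose Gam : set (V * 'F_l) := [set p | exists z v, p = (bd z + v *+ l, (ev z a)%:~R)].
have [v|_ _ [z [v ->]] [z' [v' ->]]|t [z [v [/(congr1 (fun f : V => f)) e ->]]]|f [fB fP]] := @graph_extension l V Gam l_prime.
- exists [::], v; congr (_, _); last by rewrite /ev big_nil.
  by rewrite [bd _](_ : _ = 0) ?add0r//; apply/funext => phi; rewrite /bd /ev big_nil.
- exists (z ++ opp_chain z'), (v - v'); congr (_, _).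
    rewrite /= mulrnBl opprD addrACA; congr (_ + _).
    by apply/funext => phi; rewrite /bd fct_subE ev_cat ev_opp.
  by rewrite ev_cat ev_opp intrB.
- apply/eqP; rewrite intr_Fp_eq0; apply: za => phi.
  have := congr1 (@^~ phi) e; rewrite fct_addE fct_mulrnE => /esym/eqP.
  rewrite addr_eq0 -[ev z _]/(bd z phi) => /eqP ->; by rewrite -mulNrn -mulr_natl natz (dvdz_mulr _ (dvdzz _)) ?eqxx//.
have /choice[e eP] : forall s : chains n X, exists x : int, x%:~R = f (fun phi => phi s).
  by move=> s; exact: lift_Fp.
apply: na; have [s|c cP] := @dvdz_fun _ (a - dV e); last first.
  rewrite -(subrK (dV e) a) cP; apply: cobD; [exact: cobZ|exact: cob_dV].
rewrite fct_subE -intr_Fp_eq0 intrB subr_eq0; apply/eqP.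
have <- : f (bd [:: (1, s)]) = (a s)%:~R.
  by apply: fP; exists [:: (1, s)], 0; rewrite mul0rn addr0 /ev big_seq1 mul1r.
have -> : bd [:: (1, s)] = \sum_(i < n.+2) (fun phi : chains n X -> int => phi (s \o @face R n i)) *~ (-1) ^+ i.
  apply/funext => phi; rewrite /bd /ev big_seq1 mul1r /dV.
  rewrite (@additive_sum _ _ (fun F : V => F phi))//; apply: eq_bigr => i _.
  by rewrite fct_mulrzE.
rewrite (additive_sum fB) /dV rmorph_sum; apply: eq_bigr => i _.
by rewrite (additiveMz fB) rmorphMz -eP.
Qed.

(** The hypothesis on [xi] is what makes the assignment of [xi phi] to [dV phi] single-valued modulo
    [l]; it then extends to all cochains. *)
Lemma dual_exact n X (xi : (chains n X -> int) -> 'F_l) :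
  {morph xi : x y / x - y} ->
  (forall phi N, dV phi = (fun s => l%:Z * N s) -> xi phi = 0) ->
  exists2 eta : (chains n.+1 X -> int) -> 'F_l,
    {morph eta : x y / x - y} & forall phi, eta (dV phi) = xi phi.
Proof.
move=> xiB xi0.
pose V := chains n.+1 X -> int.
pose Gam : set (V * 'F_l) := [set p | exists phi v, p = (dV phi + v *+ l, xi phi)].
have [v|_ _ [p [v ->]] [p' [v' ->]]|t [p [v [e ->]]]|f [fB fP]] := @graph_extension l V Gam l_prime.
- by exists 0, v; rewrite dV0 add0r (additive0 xiB).
- exists (p - p'), (v - v'); congr (_, _); last by rewrite xiB.
  by rewrite /= mulrnBl dVB opprD addrACA.
- apply: (xi0 p (- v)); apply/funext => s; have := congr1 (@^~ s) e.
  rewrite fct_addE fct_mulrnE => /esym/eqP; rewrite addr_eq0 => /eqP ->.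
  by rewrite -[(- v) s]/(- v s) mulrN -mulr_natl natz.
exists f => // phi; apply: fP; exists phi, 0; by rewrite mul0rn addr0.
Qed.

End Duality.

(** * Vanishing of cohomology on products with a simplex *)

Section Cylinder.
Variable R : realType.
Local Notation simplex := (simplex R).
Local Notation chains n X := (continuousType (simplex n) X).
Implicit Types X Y T A B : topologicalType.

Lemma realM_cts T (f g : T -> R) :
  continuous f -> continuous g -> continuous (fun x => f x * g x).
Proof. by move=> cf cg x; apply: cvgM; [exact: cf|exact: cg]. Qed.

Lemma realD_cts T (f g : T -> R) :
  continuous f -> continuous g -> continuous (fun x => f x + g x).
Proof. by move=> cf cg x; apply: cvgD; [exact: cf|exact: cg]. Qed.

Lemma coords_cts n (j : 'I_n.+1) : continuous (fun s : simplex n => coords s ord0 j).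
Proof.
have ccts : continuous (fun v : 'rV[R]_n.+1 => v ord0 j) by exact: coord_continuous.
have vcts : continuous (fun s : simplex n => set_val s : 'rV[R]_n.+1).
  exact: initial_continuous.
by move=> s; apply: (@continuous_comp _ _ _ (fun s : simplex n => set_val s : 'rV[R]_n.+1) (fun v : 'rV[R]_n.+1 => v ord0 j)); [exact: vcts|exact: ccts].
Qed.

Lemma comp_cts X Y T (f : X -> Y) (g : Y -> T) :
  continuous f -> continuous g -> continuous (g \o f).
Proof. by move=> cf cg x; apply: continuous_comp; [exact: cf|exact: cg]. Qed.

Lemma fst_prod_cts X Y : continuous (fun p : (X * Y)%type => p.1).
Proof. by move=> x; exact: cvg_fst. Qed.

Lemma snd_prod_cts X Y : continuous (fun p : (X * Y)%type => p.2).
Proof. by move=> x; exact: cvg_snd. Qed.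

Definition fstc X Y : continuousType (X * Y)%type X := mkcts (@fst_prod_cts X Y).
Definition sndc X Y : continuousType (X * Y)%type Y := mkcts (@snd_prod_cts X Y).

Definition segment n (s : simplex n) (e : simplex n) (t : simplex 1) : simplex n :=
  affine 1 (fun i => if i is 0%N then s else e) t.

Lemma coords_segment n (s e : simplex n) t j : coords (segment s e t) ord0 j =
  coords t ord0 ord0 * coords s ord0 j + coords t ord0 ord_max * coords e ord0 j.
Proof.
rewrite /segment coords_affine big_ord_recl big_ord1 /= !mxE.
by congr (_ + coords t ord0 _ * _); apply/val_inj.
Qed.

Lemma segment_cts n X (f : X -> simplex n) (e : simplex n) : continuous f ->
  continuous (fun p : (X * simplex 1)%type => segment (f p.1) e p.2).
Proof.
move=> cf; apply: (@continuous_comp_initial _ _ _ set_val).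
apply: (@continuous_mx R) => i j; rewrite (ord1 i).
rewrite (_ : (fun x => _) = fun p : (X * simplex 1)%type =>
  coords p.2 ord0 ord0 * coords (f p.1) ord0 j + coords p.2 ord0 ord_max * coords e ord0 j); last first.
  by apply/funext => p; rewrite -coords_segment.
have c2 j' : continuous (fun p : (X * simplex 1)%type => coords p.2 ord0 j').
  exact: (comp_cts (@snd_prod_cts X (simplex 1)) (@coords_cts 1 j')).
apply: realD_cts; apply: realM_cts => //; last by move=> x; exact: cvg_cst.
exact: (comp_cts (comp_cts (@fst_prod_cts X (simplex 1)) cf) (@coords_cts n j)).
Qed.

Lemma simplex_chain_connected n : chain_connected R (simplex n).
Proof.
move=> P Pc y y' Py.
have := Pc (affine 1 (fun i => if i is 0%N then y else y')).
by rewrite !affine_vertex /=; apply.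
Qed.

(* Cohomology vanishes in degrees larger than [k]. *)
Definition acyclic_from k X : Prop := forall j (F : chains j.+1 X -> int),
  (k <= j)%N -> dV F = 0 -> exists E : chains j X -> int, dV E = F.

(** The straight-line contraction of the simplex onto the vertex [e] shows that [F] differs by a
    coboundary from the pullback of its restriction to [X] times [e]. *)
Lemma acyclic_cylinder k X n : acyclic_from k X -> acyclic_from k (X * simplex n)%type.
Proof.
move=> acX j F kj dF; pose e := @vertex R n 0.
have cS := @segment_cts _ _ (fun p : (X * simplex n)%type => p.2) e (@snd_prod_cts _ _).
pose H := pairc (fstc X (simplex n) \o fstc (X * simplex n)%type (simplex 1)) (mkcts cS).
pose M : chains j.+1 ((X * simplex n) * simplex 1)%type -> int := fun s => F (H \o s).
have dM : dV M = fun s => 0 * 0 by rewrite dV_comp dF mul0r.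
have /cob_0 := @homotopy_cob R 0 _ _ _ M 0 (@vertex R 1 1) (@vertex R 1 0) (@simplex_chain_connected 1) dM.
have -> : slice_l (@vertex R 1 0) M = F.
  apply/funext => s; congr (F _); apply/continuousEP => x.
  rewrite -[LHS]/((s x).1, segment (s x).2 e (@vertex R 1 0)) /segment affine_vertex /=.
  by case: (s x).
pose i0 := pairc (@idfun X : continuousType X X) (constc X e).
have [E' dE'] : exists E : chains j X -> int, dV E = fun s => F (i0 \o s).
  by apply: acX => //; rewrite dV_comp dF.
have -> : slice_l (@vertex R 1 1) M = dV (fun s => E' (@fstc X (simplex n) \o s)).
  rewrite dV_comp dE'; apply/funext => s; congr (F _); apply/continuousEP => x /=.
  by rewrite /mkcts /= /segment affine_vertex.
move=> [p]; rewrite coboundaryE => /eqP; rewrite subr_eq -dVD => /eqP ->.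
by eexists.
Qed.

End Cylinder.

(** * Torsion in the top degree *)

Section Shear.
Variables (R : realType) (d : nat) (G : lieGroupType R d) (l k' : nat).
Local Notation k := (k'.+1).
Local Notation simplex := (simplex R).
Local Notation chains n X := (continuousType (simplex n) X).
Hypothesis l_prime : prime l.
Variable z : seq (int * chains k G).
Hypothesis z_cycle : forall phi : chains k' G -> int, (l%:Z %| ev z (dV phi))%Z.
Hypothesis G_acyclic : acyclic_from R k G.
Hypothesis G_conn : chain_connected R G.
Implicit Types A B X Y : topologicalType.

Definition prodc A B (f : continuousType A B) : continuousType (G * A)%type (G * B)%type :=
  pairc (fstc G A) (f \o sndc G A).

Lemma shear_cts B (t : continuousType B G) : continuous (fun p : (G * B)%type => (p.1 * t p.2)%g).
Proof.
apply: mul_cts; first exact: fst_prod_cts.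
by apply: (comp_cts (@snd_prod_cts G B)) => x; exact: cts_fun.
Qed.

Definition shearc B (t : continuousType B G) : continuousType (G * B)%type (G * B)%type :=
  pairc (mkcts (@shear_cts B t)) (sndc G B).

Definition idc n : chains n (simplex n) := idfun.

Definition ipull n A B (f : continuousType A B) (phi : chains n B -> int) : chains n A -> int :=
  fun s => phi (f \o s).

Lemma dV_ipull n A B (f : continuousType A B) (phi : chains n B -> int) :
  dV (ipull f phi) = ipull f (dV phi).
Proof. exact: dV_comp. Qed.

Lemma ez_prodc n A B (f : continuousType A B) (phi : chains n (G * B)%type -> int) p q
    (s : chains p G) (t : chains q A) : ez (ipull (prodc f) phi) s t = ez phi s (f \o t).
Proof.
apply: eq_shuffle => v _; congr (phi _); exact/continuousEP.
Qed.

(** Slant product with [z] of the change of [phi] under the shear that sends (g, b) to (g t(b),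
    b). *)
Definition shear_diff i B (t : continuousType B G) (phi : chains (i + k) (G * B)%type -> int) :
    chains i B -> int :=
  fun r => ev z (fun s => ez (ipull (shearc t) phi) s r - ez phi s r).

Lemma shear_diff_nat i A B (f : continuousType A B) (t : continuousType B G)
    (phi : chains (i + k) (G * B)%type -> int) r :
  shear_diff (t \o f) (ipull (prodc f) phi) r = shear_diff t phi (f \o r).
Proof.
have e : ipull (shearc (t \o f)) (ipull (prodc f) phi) =
         ipull (prodc f) (ipull (shearc t) phi).
  by apply/funext => x; congr (phi _); exact/continuousEP.
by congr (ev z _); apply/funext => s; rewrite e !ez_prodc.
Qed.

Lemma ez_sub n X Y (phi psi : chains n (X * Y)%type -> int) p q (s : chains p X) (t : chains q Y) :
  ez (phi - psi) s t = ez phi s t - ez psi s t.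
Proof. by rewrite /ez -shuffleB. Qed.

Lemma ev_dV n X m Y (r : seq (int * chains m Y)) (F : chains m Y -> chains n X -> int) t :
  ev r (fun s => dV (F s) t) = dV (fun t => ev r (fun s => F s t)) t.
Proof.
rewrite /ev /dV; under eq_bigr do rewrite mulr_sumr.
rewrite exchange_big/=; apply: eq_bigr => i _; rewrite mulrz_suml; apply: eq_bigr => p _.
by rewrite mulrzAr.
Qed.

(** In the Leibniz rule the boundary in the first factor is paired with [z], a cycle modulo [l];
    only the boundary in [B] survives. *)
Lemma shear_diff_dV i B (t : continuousType B G) (psi : chains (i + k) (G * B)%type -> int) r :
  (shear_diff (i := i.+1) t (dV psi) r)%:~R =
  (dV (shear_diff t psi) r *~ (-1) ^+ k)%:~R :> 'F_l.
Proof.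
apply/eqP; rewrite -subr_eq0 -intrB intr_Fp_eq0//.
rewrite /shear_diff.
have -> : (fun s : chains k G => ez (ipull (shearc t) (dV psi)) s r - ez (dV psi) s r) =
   dV (fun s => ez (ipull (shearc t) psi) s r - ez psi s r) +
   (fun s => (-1) ^+ k * dV (fun r => ez (ipull (shearc t) psi) s r - ez psi s r) r).
  apply/funext => s; rewrite -dV_ipull fct_addE.
  rewrite !(ez_dVSS (n := i + k)) ?[(i + k)%N]addnC ?addSnnS//.
  rewrite (dVB (fun s => ez (ipull (shearc t) psi) s r)) (dVB (fun r => ez (ipull (shearc t) psi) s r)).
  rewrite !fct_subE mulrBr opprD addrACA; congr (_ + _).
  by rewrite -!mulrzz ![_ ^+ k *~ _]mulrzz !mulrzz ![_ * _ ^+ k]mulrC.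
rewrite evD evZ ev_dV mulrzz [X in _ - X]mulrC addrK.
exact: z_cycle.
Qed.

Lemma ev_cob (phi : chains k G -> int) : cob l phi -> (l%:Z %| ev z phi)%Z.
Proof.
move=> [b [c [[psi ->] ->]]]; rewrite evD evZ coboundaryE.
by apply: rpredD; [exact: z_cycle|exact: dvdz_mulr].
Qed.

(* Acyclic models: [eta t] is a primitive modulo [l] of the functional
   [shear_diff t] up to the boundary terms given by the fillers of the faces of
   [t]; it exists because functionals vanishing on cocycles modulo [l] factor
   through the coboundary ([dual_exact]). *)
Definition filler i := forall t : chains i G,
  (chains (i + k).+1 (G * simplex i)%type -> int) -> 'F_l.

Definition fill i (eta : filler i) B (t : continuousType B G)
    (phi : chains (i + k).+1 (G * B)%type -> int) : chains i B -> 'F_l :=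
  fun r => eta (t \o r) (ipull (prodc r) phi).

Definition exactF i B : (chains i B -> 'F_l) -> Prop :=
  if i is j.+1 return (chains i B -> 'F_l) -> Prop
  then fun K => exists L : chains j B -> 'F_l, K = dV L else fun K => K = 0.

Lemma dV_exactF i B (K : chains i B -> 'F_l) : exactF K -> dV K = 0.
Proof. by case: i K => [|i] K /= => [->|[L ->]]; rewrite ?dV0 ?dVdV. Qed.

(** Of the error [K] the inductive step uses only that its coboundary vanishes; the end of the
    argument uses that it is exact. Arbitrary [B] is within reach because [fill] is natural by
    construction. *)
Definition good_filler i (eta : filler i) : Prop :=
  (forall t, {morph eta t : x y / x - y}) /\
  forall B (t : continuousType B G) (phi : chains (i + k) (G * B)%type -> int),
    exists2 K : chains i B -> 'F_l, exactF K &
    forall r, fill eta t (dV phi) r = (shear_diff t phi r)%:~R - K r.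

Lemma ipullB n A B (f : continuousType A B) (phi psi : chains n B -> int) :
  ipull f (phi - psi) = ipull f phi - ipull f psi.
Proof. by []. Qed.

Lemma shear_diffB i B (t : continuousType B G) (phi psi : chains (i + k) (G * B)%type -> int) r :
  shear_diff t (phi - psi) r = shear_diff t phi r - shear_diff t psi r.
Proof.
rewrite /shear_diff -evB; congr (ev z _); apply/funext => s.
by rewrite ipullB !ez_sub fct_subE !opprD addrACA.
Qed.

Lemma fillB i (eta : filler i) B (t : continuousType B G) :
  (forall t, {morph eta t : x y / x - y}) ->
  {morph fill eta t : x y / x - y}.
Proof. by move=> etaB x y; apply/funext => r; rewrite /fill ipullB etaB. Qed.

Lemma dV_intr n B (phi : chains n B -> int) :
  dV (fun s => (phi s)%:~R : 'F_l) = fun s => (dV phi s)%:~R.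
Proof.
apply/funext => s; rewrite /dV rmorph_sum; apply: eq_bigr => i _.
by rewrite rmorphMz.
Qed.

Lemma fill_nat i (eta : filler i) A B (f : continuousType A B) (t : continuousType B G)
    (phi : chains (i + k).+1 (G * B)%type -> int) r :
  fill eta (t \o f) (ipull (prodc f) phi) r = fill eta t phi (f \o r).
Proof.
rewrite /fill (_ : (t \o f) \o r = t \o (f \o r) :> chains i G); last exact/continuousEP.
by congr (eta _ _); apply/funext => s; congr (phi _); exact/continuousEP.
Qed.

(** Over a point the shear is a right translation of [G], homotopic to the identity, so on a cocycle
    modulo [l] it produces a coboundary modulo [l], which [z] kills. *)
Lemma good_filler0 : exists eta : filler 0, good_filler eta.
Proof.
have /choice[eta etaP] : forall t : chains 0 G, exists eta,
    {morph eta : x y / x - y} /\ forall phi : chains (0 + k) (G * simplex 0)%type -> int,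
      eta (dV phi) = (shear_diff t phi (idc 0))%:~R :> 'F_l.
  move=> t.
  have [x y|phi N dphi|eta etaB etaP] := @dual_exact R l l_prime (0 + k) (G * simplex 0)%type
    (fun phi => (shear_diff t phi (idc 0))%:~R); last by exists eta.
    by rewrite shear_diffB intrB.
  apply/eqP; rewrite intr_Fp_eq0//; apply: ev_cob.
  pose pt := @vertex R 0 0.
  pose M := ipull (pairc (mkcts (@lie_mul_continuous R d G)) (constc (G * G)%type pt)) phi.
  have dM : dV M = fun s => l%:Z * ipull (pairc (mkcts (@lie_mul_continuous R d G)) (constc (G * G)%type pt)) N s.
    by rewrite dV_ipull dphi.
  have := homotopy_cob 1%g (t pt) G_conn dM.
  congr (cob _ _); apply/funext => s; rewrite fct_subE !ez_point.
  congr (_ - _); congr (phi _); apply/continuousEP => x //=.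
  by congr (_, _); exact: mulg1.
exists eta; split=> [t|B t phi]; first exact: (etaP t).1.
exists 0 => // r; rewrite subr0 /fill -dV_ipull.
have [_ ->] := etaP (t \o r); rewrite shear_diff_nat; congr (_%:~R).
by congr (shear_diff _ _ _); exact/continuousEP.
Qed.

(** [N], the Bockstein of [phi], is an integral cocycle above degree [k], hence [dV chi]; then
    [phi - chi *+ l] is an integral cocycle, again above degree [k]. *)
Lemma mod_cocycle_decomp m n (phi : chains (n + k).+1 (G * simplex m)%type -> int) N :
  dV phi = (fun s => l%:Z * N s) ->
  exists psi chi, phi = dV psi + (chi *+ l).
Proof.
move=> dphi.
have l0 : l%:Z != 0 by rewrite -lt0n prime_gt0.
have [||chi dchi] := @acyclic_cylinder R k'.+1 G m G_acyclic (n + k).+1 N.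
- by rewrite ltnW// ltnS leq_addl.
- apply/funext => s; have := congr1 (@^~ s) (dVdV phi).
  by rewrite dphi dVZ => /eqP; rewrite mulf_eq0 (negbTE l0) => /eqP.
have [||psi dpsi] := @acyclic_cylinder R k'.+1 G m G_acyclic (n + k)%N (phi - chi *+ l).
- exact: leq_addl.
- rewrite dVB dphi -dchi; apply/funext => s; rewrite fct_subE.
  rewrite (_ : chi *+ l = fun s => l%:Z * chi s) ?dVZ ?subrr//.
  by apply/funext => s'; rewrite fct_mulrnE -mulr_natl natz.
by exists psi, chi; rewrite dpsi subrK.
Qed.

(** By [mod_cocycle_decomp] the obstruction [xi] has to vanish on coboundaries [dV psi] only. There
    both of its terms equal, up to the common sign, the coboundary of [shear_diff t psi] modulo [l],
    the error [K] being closed. *)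
Lemma good_fillerS i (eta : filler i) : good_filler eta ->
  exists eta' : filler i.+1, good_filler eta'.
Proof.
move=> [etaB etaP].
pose xi (t : chains i.+1 G) (phi : chains (i.+1 + k) (G * simplex i.+1)%type -> int) : 'F_l :=
  (shear_diff t phi (idc i.+1))%:~R - dV (fill eta t phi) (idc i.+1) *~ (-1) ^+ k.
have xiB t : {morph xi t : x y / x - y}.
  move=> x y; rewrite /xi shear_diffB fillB// dVB intrB fct_subE mulrzBl.
  by rewrite !opprD addrACA.
have /choice[eta' eta'P] : forall t : chains i.+1 G, exists eta',
    {morph eta' : x y / x - y} /\ forall phi, eta' (dV phi) = xi t phi.
  move=> t.
  have [phi N dphi|eta' eta'B eta'P] := @dual_exact R l l_prime _ _ (xi t) (xiB t).
  - have [psi [chi ->]] := mod_cocycle_decomp dphi.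
    rewrite (additiveD (xiB t)) pmulrn (additiveMz (xiB t)) -pmulrn Fp_mulrn// addr0.
    rewrite /xi shear_diff_dV//; have [K /dV_exactF dK fillE] := etaP _ t psi.
    rewrite (_ : fill eta t (dV psi) = (fun r => (shear_diff t psi r)%:~R) - K).
      by rewrite dVB dV_intr dK subr0 rmorphMz subrr.
    by apply/funext => r; rewrite fillE.
  - by exists eta'.
exists eta'; split=> [t|B t phi]; first exact: (eta'P t).1.
exists (fun r => dV (fill eta t phi) r *~ (-1) ^+ k).
  by exists (fun r => fill eta t phi r *~ (-1) ^+ k); rewrite dVMz.
move=> r; rewrite {1}/fill -dV_ipull; have [_ ->] := eta'P (t \o r).
rewrite /xi shear_diff_nat (_ : r \o idc i.+1 = r :> chains _ _); last exact/continuousEP.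
have -> : dV (fill eta (t \o r) (ipull (prodc r) phi)) (idc i.+1) = dV (fill eta t phi) r.
  rewrite /dV; apply: eq_bigr => j _; rewrite fill_nat.
  by rewrite (_ : r \o (idc i.+1 \o face j) = r \o face j :> chains _ _)//; exact/continuousEP.
by [].
Qed.

(** On a cocycle modulo [l] the filler is applied to a multiple of [l] and vanishes, so only the
    exact term is left. Its primitive is lifted to the integers simplex by simplex. *)
Lemma shear_diff_cob (Phi : chains (k' + k) (G * G)%type -> int) N :
  dV Phi = (fun s => l%:Z * N s) ->
  cob l (shear_diff (idfun : continuousType G G) Phi).
Proof.
move=> dPhi.
have [eta [etaB etaP]] : exists eta : filler k', good_filler eta.
  elim: {+}k' => [|i [eta geta]]; first exact: good_filler0.
  exact: good_fillerS geta.
have [K exK KE] := etaP G idfun Phi.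
have KE' r : (shear_diff (idfun : continuousType G G) Phi r)%:~R = K r.
  apply/eqP; rewrite -subr_eq0 -KE dPhi /fill (_ : ipull _ _ = ipull (prodc r) N *+ l).
    by rewrite pmulrn (additiveMz (etaB _)) -pmulrn Fp_mulrn.
  by apply/funext => s; rewrite fct_mulrnE -mulr_natl natz.
move: (shear_diff _ _) KE' => D DE.
have lift (L : chains k'.-1 G -> 'F_l) : exists L' : chains k'.-1 G -> int, forall s, (L' s)%:~R = L s.
  have /choice[L' L'P] : forall s, exists x : int, x%:~R = L s by move=> s; exact: lift_Fp.
  by exists L'.
have [E DE'] : exists E : chains k' G -> int, is_coboundary E /\ forall r, (E r)%:~R = K r :> 'F_l.
  case: {+}k' K exK {DE KE etaB etaP eta} lift => [|j] K /= exK lift.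
    by exists 0; split=> // r; rewrite exK.
  have [L KL] := exK; have [L' L'P] := lift L.
  exists (dV L'); split; first exact: is_coboundary_dV.
  move=> r; rewrite KL -[RHS]/(dV L r) (_ : L = fun s => (L' s)%:~R) ?dV_intr//.
  by apply/funext.
have [exE EK] := DE'.
have [r|c cP] := @dvdz_fun l _ (D - E).
  by rewrite fct_subE -intr_Fp_eq0// intrB DE EK subrr.
by exists E, c; split=> //; rewrite -cP addrC subrK.
Qed.

End Shear.

(** * Slant products of a cup product *)

Lemma alt_cup (P : Type) (A : pzRingType) p q n (f g : (nat -> P) -> A) v :
  n = (p + q)%N -> tail_free p f ->
  alt n.+2 (fun v => f v * g (v \o addn p)) v =
  alt p.+2 f v * g (v \o addn p.+1) + (f v * alt q.+2 g (v \o addn p)) *~ (-1) ^+ p.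
Proof.
move=> -> tf; rewrite /alt.
rewrite -(big_mkord predT (fun i => f (v \o bump i) * g ((v \o bump i) \o addn p) *~ (-1) ^+ i)).
rewrite -(big_mkord predT (fun i => f (v \o bump i) *~ (-1) ^+ i)).
rewrite -(big_mkord predT (fun i => g ((v \o addn p) \o bump i) *~ (-1) ^+ i)).
rewrite (big_cat_nat (n := p.+1))//=; last by lia.
rewrite [in RHS]big_nat_recr//= mulrDl -addrA; congr (_ + _).
  rewrite mulr_suml; apply: eq_big_nat => i /andP[_ ip].
  rewrite mulrzAl; congr (_ * g _ *~ _); apply/funext => j /=; congr (v _).
  by rewrite /bump (leq_trans (ip : (i <= p)%N)) ?leq_addr.
have vp : f (v \o bump p.+1) = f v.
  by apply: tf => j jp /=; rewrite /bump ltnNge jp.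
rewrite vp [in RHS]big_nat_recl//= expr0 mulr1z mulrDr mulrzDl addrA.
have -> : (v \o addn p) \o bump 0 = v \o addn p.+1.
  by apply/funext => j /=; rewrite bump0E addnS.
(* The last face of the front factor and the first face of the back factor give the same product
   with opposite signs; neither is a face of the whole simplex. *)
rewrite exprS mulN1r mulrNz mulNr mulrzAl addNr add0r.
rewrite -[p.+1 in LHS]add0n big_addn (_ : (_ - _ = q.+1)%N); last by lia.
rewrite mulr_sumr mulrz_suml; apply: eq_big_nat => i _.
have -> : f (v \o bump (i + p.+1)) = f v.
  by apply: tf => j jp /=; rewrite /bump leqNgt (_ : (j < _)%N)//; lia.
rewrite mulrzAr -mulrzA -exprD addnC addSnnS addnC; congr (_ * g _ *~ _).
by apply/funext => j /=; congr (v _); rewrite /bump; lia.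
Qed.

Section Evaluation.
Variable R : realType.
Local Notation simplex := (simplex R).
Local Notation chains n X := (continuousType (simplex n) X).
Implicit Types X Y : topologicalType.

(* Vanishing on degenerate simplices. *)
Definition normal n X (phi : chains n X -> int) : Prop :=
  forall m (s : chains m X) v i, (i < n)%N -> v i = v i.+1 -> pull phi s v = 0.

Lemma normal_Sd n X (phi : chains n X -> int) : normal (Sd phi).
Proof. by move=> m s v i ltin vi; rewrite pull_Sd; exact: sd_degenerate vi. Qed.

Lemma iter_rightE j w i :
  iter j right w i = if (i < j)%N then (i, 0%N) else hmap (addn j) (w (i - j)%N).
Proof.
elim: j i => [|j IH] [|i] //=; rewrite ?subn0.
- by case: (w 0%N).
- by case: (w i.+1).
- by rewrite IH ltnS subSS; case: ifP.
Qed.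

Variables (X Y : topologicalType) (k' : nat).
Local Notation k := (k'.+1).
Variables (u : chains k' X -> int).

Definition front (s : chains k X) : chains k' X := s \o affine k' (@vertex R k).
Definition edge (s : chains k X) : chains 1 X := s \o affine 1 (fun i => @vertex R k (k' + i)).

(* The cup product of the pullback of [u] along the first projection with [M]. *)
Definition cup_fst (M : chains k (X * Y)%type -> int) : chains (k' + k) (X * Y)%type -> int :=
  fun w => u (fstc X Y \o (w \o affine k' (@vertex R (k' + k)) : chains k' _)) *
           M (w \o affine k (@vertex R (k' + k) \o addn k')).

Lemma comp_affine2 m n p (Z : topologicalType) (s : chains m Z) (v : nat -> simplex m) (w : nat -> simplex n) :
  (s \o affine n v : chains n Z) \o affine p w = s \o affine p (affine n v \o w) :> chains p Z.
Proof.
apply/continuousEP => x /=; congr (s _).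
by have /continuousEP/(_ x)/= := affine_comp p v w.
Qed.

Lemma pull_cup_fst M m (s : chains m (X * Y)%type) v :
  pull (cup_fst M) s v = pull (fun t => u (fstc X Y \o t)) s v * pull M s (v \o addn k').
Proof.
rewrite /pull /cup_fst !comp_affine2.
rewrite (@eq_comp_affine R k' _ m s _ v); last first.
  move=> i ik /=.
  by rewrite affine_vertex (minn_idPl _)// (leq_trans ik) ?leq_addr.
rewrite (@eq_comp_affine R k _ m s _ (v \o addn k'))// => i ik /=.
by rewrite affine_vertex (minn_idPl _)// leq_add2l.
Qed.

Lemma dV_cup_fst (l : int) M N : dV M = 0 -> dV u = (fun s => l * N s) ->
  exists N', dV (cup_fst M) = fun s => l * N' s.
Proof.
move=> dM du.
pose N' (s : chains (k' + k).+1 (X * Y)%type) :=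
  pull (fun t => N (fstc X Y \o t)) s (@vertex R _) * pull M s (@vertex R _ \o addn k'.+1).
exists N'; apply/funext => s; rewrite dVE.
rewrite (_ : pull (cup_fst M) s = fun v => pull (fun t => u (fstc X Y \o t)) s v * pull M s (v \o addn k')); last first.
  by apply/funext => v; exact: pull_cup_fst.
rewrite (alt_cup _ _ (q := k))//; last exact: tail_free_pull.
rewrite !alt_pull dM dV_comp du {2}/pull mulr0 mul0rz addr0 /N' mulrA.
by [].
Qed.

Lemma cross_cup_fst M (s : chains k X) (t : chains k' Y) v :
  cross (cup_fst M) s t v =
  pull u s (@vertex R k \o (fun i => (v i).1)) * cross M s t (v \o addn k').
Proof.
rewrite /cross /cup_fst /pull.
set a := s \o affine (k' + k) _; set b := t \o affine (k' + k) _.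
have -> : fstc X Y \o (pairc a b \o affine k' (vertex R (k' + k)) : chains k' _) =
    (a : chains (k' + k) X) \o affine k' (vertex R (k' + k)) :> chains k' X.
  exact/continuousEP.
have -> : pairc a b \o affine k (vertex R (k' + k) \o addn k') =
    pairc ((a : chains (k' + k) X) \o affine k (vertex R (k' + k) \o addn k'))
          ((b : chains (k' + k) Y) \o affine k (vertex R (k' + k) \o addn k')) :> chains k _.
  exact/continuousEP.
rewrite /a /b !comp_affine2.
congr (u _ * M (pairc _ _)); apply: eq_comp_affine => i ik /=.
- by rewrite affine_vertex (minn_idPl _)// (leq_trans ik) ?leq_addr.
- by rewrite affine_vertex (minn_idPl _)// leq_add2l.
- by rewrite affine_vertex (minn_idPl _)// leq_add2l.
Qed.

(* As [u] vanishes on degenerate simplices, only the shuffles that start with [k']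
   steps to the right survive. *)
Lemma ez_cup_fst M (s : chains k X) (t : chains k' Y) : normal u ->
  ez (cup_fst M) s t = u (front s) * ez M (edge s) t.
Proof.
move=> nu; rewrite /ez shuffle_right_first; last first.
  move=> v _ [i ik vi]; rewrite cross_cup_fst (nu _ _ _ i)// ?mul0r//=.
  by rewrite vi.
rewrite -shuffleZ; apply: eq_shuffle => w pw.
have -> : iter k' (fun g : (nat -> nat * nat) -> int => g \o right) (cross (cup_fst M) s t) w =
    cross (cup_fst M) s t (iter k' right w).
  by elim: k' w {pw} (cross _ _ _) => [//|j IH] w f; rewrite iterS /= IH -iterSr.
have [w0 _ _] := pw.
rewrite cross_cup_fst; congr (_ * _).
  congr (u _); apply: eq_comp_affine => i ik /=; rewrite iter_rightE; case: ltnP => // ki.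
  have -> : i = k' by apply/eqP; rewrite eqn_leq ik.
  by rewrite subnn w0 /= addn0.
rewrite /cross; congr (M (pairc _ _)).
  rewrite /edge comp_affine2; apply: eq_comp_affine => i ik /=.
  rewrite iter_rightE ltnNge leq_addr /= addKn affine_vertex (minn_idPl _)//.
  by have [] := @lattice_path_le 1 k' w i pw ltac:(lia).
apply: eq_comp_affine => i ik /=.
by rewrite iter_rightE ltnNge leq_addr /= addKn.
Qed.

End Evaluation.

Section EdgeTerm.
Variable R : realType.
Local Notation simplex := (simplex R).
Local Notation chains n X := (continuousType (simplex n) X).
Implicit Types X Y : topologicalType.

Lemma ez_point_l n X Y (Phi : chains n (X * Y)%type -> int) (s : chains 0 X) (t : chains n Y) :
  ez Phi s t = Phi (pairc (constc _ (s (@vertex R 0 0))) t).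
Proof.
have shE p (f : (nat -> nat * nat) -> int) : tail_free p f -> shuffle 0 p f = f (fun i => (0%N, i)).
  elim: p f => [|p IH] f tf; first by rewrite shuffle00; apply: tf => -[].
  rewrite shuffle0S IH; last exact: tail_free_up.
  by congr (f _); apply/funext => -[].
rewrite /ez shE; last exact: tail_free_cross.
rewrite /cross; congr (Phi _); apply/continuousEP => x /=.
congr (_, _); first by congr (s _); exact: simplex0.
by congr (t _); exact: affine_id.
Qed.

Lemma frontE k' X (s : chains k'.+1 X) : front s = s \o @face R k' ord_max :> chains k' X.
Proof.
have E : affine k' (@vertex R k'.+1) = affine k' (@vertex R k'.+1 \o bump k'.+1).
  by apply: eq_affine => i ik /=; rewrite /bump ltnNge ik.
rewrite /front E; apply/continuousEP => x; rewrite -[RHS]/(s (face ord_max x)).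
have := @affine_face R k' k'.+1 (@vertex R k'.+1) ord_max.
move=> /continuousEP/(_ x); rewrite -[LHS]/(affine _ _ (face ord_max x)) affine_id => ->.
by [].
Qed.

Variables (l : nat) (k' : nat) (X Y : topologicalType) (x0 : X).
Local Notation k := (k'.+1).
Hypothesis X_conn : chain_connected R X.
Variables (z : seq (int * chains k X)) (u : chains k' X -> int) (a' : chains k X -> int).
Hypothesis z_cycle : forall phi : chains k' X -> int, (l%:Z %| ev z (dV phi))%Z.
Hypothesis du : dV u = fun s => l%:Z * a' s.

(** For a path [e], both [ez M e] and [f (e1 e) - f (e0 e)] are primitives of the difference of the
    slices of [M] at the ends of [e], so [F e] is a cocycle. What is subtracted contributes, up to
    multiples of [l], a coboundary in [s], because [u] is a cocycle modulo [l]; its value on [z] is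
    divisible by [l]. *)
Lemma edge_term (M : chains k (X * Y)%type -> int) : dV M = 0 ->
  exists2 Z : chains k' Y -> int, dV Z = 0 &
    forall t, (l%:Z %| ev z (fun s => (u (front s) * ez M (edge s) t)%R) - Z t)%Z.
Proof.
move=> dM.
pose sl x (t : chains k Y) := M (pairc (constc _ x) t).
have /choice[f fP] : forall x, exists f : chains k' Y -> int, sl x - sl x0 = dV f.
  move=> x.
  pose M' := ipull (pairc (sndc Y X) (fstc Y X)) M.
  have dM' : dV M' = fun s => 0 * 0 by rewrite dV_ipull dM mul0r.
  have /cob_0[f fE] := @homotopy_cob R 0 _ _ _ M' 0 x0 x X_conn dM'.
  exists f; rewrite -coboundaryE -fE; apply/funext => t; rewrite !fct_subE.
  by congr (M _ - M _); exact/continuousEP.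
pose e0 (e : chains 1 X) := e (@vertex R 1 0).
pose e1 (e : chains 1 X) := e (@vertex R 1 1).
pose F (e : chains 1 X) : chains k' Y -> int := (fun t => ez M e t) - (f (e1 e) - f (e0 e)).
have dF e : dV (F e) = 0.
  rewrite /F !dVB -!fP; apply/funext => t.
  rewrite !fct_subE.
  have -> : sl (e1 e) t - sl x0 t - (sl (e0 e) t - sl x0 t) = sl (e1 e) t - sl (e0 e) t.
    by rewrite opprB addrA subrK.
  have := ez_dVSS (n := k) M e t (erefl _ : k = (0 + k)%N).
  rewrite dM (_ : ez _ _ _ = 0); last exact: shuffle0.
  rewrite expr1 mulrN1z => /esym/eqP; rewrite subr_eq0 => /eqP <-.
  rewrite /dV !big_ord_recl big_ord0 addr0 expr0 mulr1z expr1 mulrN1z !ez_point_l /=.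
  by rewrite !vertex_face// /sl subrr.
pose Z t := ev z (fun s => u (front s) * F (edge s) t).
exists Z.
  apply/funext => t; rewrite -(@ev_dV R) /ev big1// => p _.
  rewrite (dVZ (u (front p.2)) (F (edge p.2))) dF mulr0 mulr0//.
move=> t; rewrite /Z -evB.
(* [u] weighted by [f] at the last vertex. All faces of [s] but the last one end at the vertex [k],
   so [dV c] is [dV u] weighted by [f] there, corrected on the face [front s] alone. *)
pose c (r : chains k' X) := u r * f (r (@vertex R k' k')) t.
have -> : (fun s => u (front s) * ez M (edge s) t) - (fun s => u (front s) * F (edge s) t) =
    (fun s => l%:Z * ((-1) ^+ k * a' s * f (s (@vertex R k k)) t)) - (fun s => (-1) ^+ k * dV c s).
  apply/funext => s; rewrite !fct_subE -mulrBr subKr fct_subE.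
  have e1E : e1 (edge s) = s (@vertex R k k).
    by rewrite /e1 /edge /= affine_vertex /= addn1.
  have e0E : e0 (edge s) = s (@vertex R k k').
    by rewrite /e0 /edge /= affine_vertex /= addn0.
  rewrite e1E e0E.
  have cmax : c (s \o @face R k' ord_max) = u (front s) * f (s (@vertex R k k')) t.
    by rewrite /c frontE /= vertex_face// /bump ltnn.
  have ci (i : 'I_k) : c (s \o face (widen_ord (leqnSn k) i)) =
      u (s \o face (widen_ord (leqnSn k) i)) * f (s (@vertex R k k)) t.
    by rewrite /c /= vertex_face// /bump /= -ltnS ltn_ord.
  have duE : l%:Z * a' s = \sum_(i < k) u (s \o face (widen_ord (leqnSn k) i)) *~ (-1) ^+ i +
      u (front s) *~ (-1) ^+ k.
    by rewrite -[LHS](congr1 (@^~ s) du) /dV big_ord_recr frontE.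
  have dcE : dV c s = (\sum_(i < k) u (s \o face (widen_ord (leqnSn k) i)) *~ (-1) ^+ i) * f (s (@vertex R k k)) t +
      (u (front s) * f (s (@vertex R k k')) t) *~ (-1) ^+ k.
    rewrite /dV big_ord_recr cmax mulr_suml; congr (_ + _); apply: eq_bigr => i _.
    by rewrite ci mulrzAl.
  rewrite dcE; move: (\sum_(i < k) _) duE => S duE.
  have SE : S = l%:Z * a' s - u (front s) *~ (-1) ^+ k by rewrite duE addrK.
  have sq : (-1) ^+ k * (-1) ^+ k = 1 :> int.
    by rewrite -exprD addnn -mul2n exprM sqrrN expr1n.
  rewrite SE !mulrzz; move: sq; move: ((-1) ^+ k) => e sq.
  move: (u (front s)) (f _ t) (f _ t) (a' s) => U A B C.
  transitivity (e * e * (U * (B - A))); first by rewrite sq mul1r.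
  ring.
rewrite evB !evZ; apply: rpredB; first exact: dvdz_mulr.
by apply: dvdz_mull; exact: z_cycle.
Qed.

End EdgeTerm.

Section TopTorsion.
Variables (R : realType) (d : nat) (G : lieGroupType R d) (l k' : nat).
Local Notation k := (k'.+1).
Local Notation simplex := (simplex R).
Local Notation chains n X := (continuousType (simplex n) X).
Hypothesis l_prime : prime l.
Hypothesis G_acyclic : acyclic_from R k G.
Hypothesis G_conn : chain_connected R G.

Lemma div_continuous : continuous (fun p : (G * G)%type => (p.1 * p.2^-1)%g).
Proof.
apply: mul_cts; first exact: fst_prod_cts.
by apply: inv_cts; exact: snd_prod_cts.
Qed.

Definition divc : continuousType (G * G)%type G := mkcts div_continuous.

Lemma mull_continuous (g : G) : continuous (fun h : G => (g * h)%g).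
Proof. by apply: mul_cts; [exact: cst_cts|exact: id_cts]. Qed.

Definition lmulc (g : G) : continuousType G G := mkcts (@mull_continuous g).

(** After the shear the back factor depends on the first coordinate alone, as (g h) h^-1 = g. Since
    [a] kills degenerate simplices, only the path that first goes up survives; along it the first
    coordinate stays at the initial vertex of [s] while [u] sees all of [t]. *)
Lemma ez_shear (u : chains k' G -> int) (a : chains k G -> int) (s : chains k G) (t : chains k' G) :
  normal a ->
  ez (ipull (shearc (idfun : continuousType G G)) (cup_fst u (ipull divc a))) s t =
  u (lmulc (s (@vertex R k 0)) \o t) * a s.
Proof.
move=> na.
set Phi := ipull _ _.
pose U (v : nat -> nat * nat) := u (fstc G G \o
  (shearc (idfun : continuousType G G) \o pairc (s \o affine k' (@vertex R k \o (fun i => (v i).1)))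
                (t \o affine k' (@vertex R k' \o (fun i => (v i).2))) : chains k' _)).
have crossE v : cross Phi s t v = U v * pull a s (@vertex R k \o (fun i => (v (k' + i)%N).1)).
  rewrite /cross /Phi /ipull /cup_fst /U /pull.
  set A := s \o affine (k' + k) _; set B := t \o affine (k' + k) _.
  have -> : (fstc G G \o ((shearc idfun \o pairc A B : chains (k' + k) _) \o affine k' (vertex R (k' + k)) : chains k' _)) =
    fstc G G \o (shearc idfun \o pairc ((A : chains (k' + k) G) \o affine k' (vertex R (k' + k))) ((B : chains (k' + k) G) \o affine k' (vertex R (k' + k))) : chains k' _) :> chains k' G.
    exact/continuousEP.
  have -> : divc \o ((shearc idfun \o pairc A B : chains (k' + k) _) \o affine k (vertex R (k' + k) \o addn k') : chains k _) =
      (A : chains (k' + k) G) \o affine k (vertex R (k' + k) \o addn k') :> chains k G.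
    by apply/continuousEP => x; exact: mulgK.
  rewrite /A /B !comp_affine2; congr (_ * _).
    congr (u (fstc G G \o (shearc _ \o pairc _ _ : chains k' _))); apply: eq_comp_affine => i ik /=.
      by rewrite affine_vertex (minn_idPl _)// (leq_trans ik) ?leq_addr.
    by rewrite affine_vertex (minn_idPl _)// (leq_trans ik) ?leq_addr.
  congr (a _); apply: eq_comp_affine => i ik /=.
  by rewrite affine_vertex (minn_idPl _)// leq_add2l.
rewrite /ez shuffle_up_first; first last.
- move=> v _ [i /andP[ki ik] vi]; rewrite crossE (na _ _ _ (i - k')%N) ?mulr0//; first by lia.
  by rewrite /= addnS subnKC// vi.
- by rewrite addnC; exact: tail_free_cross.
(* A product of consecutive integers is even. *)
have -> : (-1) ^+ (k * k') = 1 :> int.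
  by rewrite -signr_odd oddM /= andbC andbN expr0.
rewrite mulr1z crossE; congr (_ * _).
  congr (u _); apply/continuousEP => x /=; rewrite /mkcts /=; congr (_ * _)%g.
    have E : affine k' (@vertex R k \o (fun i => (i - k')%N)) = affine k' (fun _ => @vertex R k 0).
      by apply: eq_affine => i ik /=; congr (vertex _ _ _); lia.
    have E2 y : affine k' (fun _ => @vertex R k 0) y = @vertex R k 0.
      apply: simplex_eq; rewrite affineE -scaler_suml.
      by have := sum_coords y; rewrite /coords => ->; rewrite scale1r.
    by congr (s _); rewrite -[RHS](E2 x) -E.
  have E : affine k' (@vertex R k' \o (fun i => minn i k')) = affine k' (@vertex R k').
    by apply: eq_affine => i ik /=; rewrite (minn_idPl ik).
  by congr (t _); rewrite -[RHS](affine_id x) -E.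
rewrite -[RHS]pull_vertex; congr (pull a s _); apply/funext => i /=.
by rewrite addKn.
Qed.

Lemma cobMz n (X : topologicalType) (c : int) (phi : chains n X -> int) :
  cob l phi -> cob l (fun s => c * phi s).
Proof.
move=> [b [e [bb ->]]]; exists (fun s => c * b s), (fun s => c * e s); split.
  case: n b bb {e phi} => [|n] b /=; first by move=> ->; apply/funext => s; exact: mulr0.
  by move=> [p ->]; exists (fun s => c * p s); rewrite !coboundaryE dVZ.
by apply/funext => s; rewrite !fct_addE mulrDr mulrCA.
Qed.

Lemma cob_ev n (X : topologicalType) (T : Type) (z : seq (int * T)) (F : T -> chains n X -> int) (c : T -> int) :
  (forall s, cob l (F s)) -> cob l (fun t => ev z (fun s => F s t * c s)).
Proof.
move=> cF; elim: z => [|p z IH].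
  rewrite (_ : (fun t => _) = 0); first exact: cob0.
  by apply/funext => t; rewrite /ev big_nil.
rewrite (_ : (fun t => _) = (fun t => p.1 * c p.2 * F p.2 t) + (fun t => ev z (fun s => F s t * c s))).
  by apply: cobD => //; exact: cobMz.
by apply/funext => t; rewrite fct_addE /ev big_cons; congr (_ + _); ring.
Qed.

Lemma is_coboundary_cocycle n (X : topologicalType) (b : chains n X -> int) :
  is_coboundary b -> dV b = 0.
Proof.
case: n b => [|n] b /=; first by move=> ->; exact: dV0.
by move=> [p ->]; rewrite coboundaryE dVdV.
Qed.

Lemma SdZ n (X : topologicalType) (c : int) (phi : chains n X -> int) :
  Sd (fun s => c * phi s) = fun s => c * Sd phi s.
Proof.
rewrite (_ : (fun s => c * phi s) = phi *~ c).
  by rewrite (additiveMz (@SdB R _ n X)); apply/funext => s; rewrite fct_mulrzE mulrzz mulrC.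
by apply/funext => s; rewrite fct_mulrzE mulrzz mulrC.
Qed.

Lemma cocycle_Sd n (X : topologicalType) (phi : chains n.+1 X -> int) :
  dV phi = 0 -> phi - Sd phi = dV (Sh phi).
Proof. by move=> dphi; rewrite Sh_homotopy dphi Sh0 add0r. Qed.

Lemma no_top_torsion (a a' : chains k G -> int) (u : chains k' G -> int) :
  dV a = 0 -> ~ cob l a -> dV u = (fun s => l%:Z * a' s) -> exists e, a' = dV e.
Proof.
move=> da na du.
have l0 : l%:Z != 0 by rewrite -lt0n prime_gt0.
have da' : dV a' = 0.
  apply/funext => s; have := congr1 (@^~ s) (dVdV u).
  by rewrite du dVZ => /eqP; rewrite mulf_eq0 (negbTE l0) => /eqP.
have na1 : ~ cob l (Sd a).
  move=> ca; apply: na; rewrite -(subrK (Sd a) a); apply: cobD => //.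
  by rewrite cocycle_Sd//; exact: cob_dV.
(* Subdividing makes [u] and [a] vanish on degenerate simplices and alters cocycles only by
   coboundaries. *)
pose u1 := Sd u; pose a1 := Sd a; pose a1' := Sd a'.
have du1 : dV u1 = (fun s => l%:Z * a1' s) by rewrite dV_Sd du SdZ.
have da1 : dV a1 = 0.
  by rewrite dV_Sd da -[X in Sd X](subrr 0) SdB subrr.
have [z [zd za]] := dual_chain l_prime na1.
pose M := ipull divc a1.
have dM : dV M = 0 by rewrite dV_ipull da1.
have [N dPhi] := dV_cup_fst dM du1.
have c1 := shear_diff_cob l_prime zd G_acyclic G_conn dPhi.
have [Z dZ ZP] := edge_term 1%g G_conn zd du1 dM.
(* [u1] is a cocycle modulo [l], so a left translation changes it by a coboundary modulo [l]; this
   turns the sheared term into [ev z a1 * u1]. *)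
have c2 : cob l (fun t : chains k' G => ev z (fun s => (u1 (lmulc (s (@vertex R k 0)) \o t) - u1 t) * a1 s)).
  apply: (@cob_ev _ _ _ z (fun s t => u1 (lmulc (s (@vertex R k 0)) \o t) - u1 t)) => s.
  pose M1 := ipull (mkcts (@lie_mul_continuous R d G) \o pairc (sndc G G) (fstc G G)) u1.
  have dM1 : dV M1 = fun r => l%:Z * ipull (mkcts (@lie_mul_continuous R d G) \o pairc (sndc G G) (fstc G G)) a1' r.
    by rewrite dV_ipull du1.
  have := homotopy_cob 1%g (s (@vertex R k 0)) G_conn dM1.
  congr (cob _ _); apply/funext => t; rewrite fct_subE.
  congr (u1 _ - u1 _); apply/continuousEP => x //=.
  exact: mul1g.
have [r|c3 c3P] := @dvdz_fun l _ (fun t => ev z (fun s => u1 (front s) * ez M (edge s) t) - Z t).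
  exact: ZP.
have [b [c [bb bcE]]] : cob l ((fun t : chains k' G => ev z a1 * u1 t) - Z).
  rewrite (_ : _ - Z = shear_diff z (idfun : continuousType G G) (cup_fst u1 M) -
    (fun t : chains k' G => ev z (fun s => (u1 (lmulc (s (@vertex R k 0)) \o t) - u1 t) * a1 s)) +
    (fun t : chains k' G => l%:Z * c3 t)).
    by apply: cobD; [apply: cobB|exact: cobZ].
  rewrite -c3P; apply/funext => t; rewrite fct_subE fct_addE fct_subE /shear_diff.
  rewrite (_ : (fun s => _ - ez (cup_fst u1 M) s t) =
    (fun s : chains k G => u1 (lmulc (s (@vertex R k 0)) \o t) * a1 s) - (fun s => u1 (front s) * ez M (edge s) t)); last first.
    apply/funext => s; rewrite ez_shear; last exact: normal_Sd.
    by rewrite ez_cup_fst//; exact: normal_Sd.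
  rewrite (_ : (fun s : chains k G => (_ - u1 t) * a1 s) =
    (fun s : chains k G => u1 (lmulc (s (@vertex R k 0)) \o t) * a1 s) - (fun s => u1 t * a1 s)); last first.
    by apply/funext => s; rewrite fct_subE mulrBl.
  by rewrite !evB evZ; ring.
have main : (fun s => ev z a1 * a1' s) = dV c.
  apply/funext => s; apply: (mulfI l0).
  have := congr1 (fun f => dV f s) bcE.
  rewrite dVB dZ subr0 dVD (is_coboundary_cocycle bb) add0r !dVZ du1 => <-.
  by rewrite mulrCA.
have [[x y] /= xy] : exists xy : int * int, xy.1 * ev z a1 + xy.2 * l%:Z = 1.
  have [x [y xy]] := Bezoutz (ev z a1) l; exists (x, y); rewrite /= xy.
  have : coprimez (ev z a1) l by rewrite coprimez_sym coprimezE prime_coprime// -dvdzE.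
  by rewrite /coprimez => /eqP.
(* The Bezout relation writes [a1'] through [ev z a1 * a1'] and [l * a1'], the coboundaries of [c]
   and [u1]; [Sh a'] accounts for the passage from [a'] to [a1']. *)
exists ((fun s => x * c s) + (fun s => y * u1 s) + Sh a').
rewrite !dVD -cocycle_Sd// !dVZ -main du1; apply/funext => s.
rewrite !fct_addE -[(- Sd a') s]/(- a1' s) -[X in - X]mul1r -xy.
by ring.
Qed.

End TopTorsion.

(** * The index of a multiple *)

Section IndexArithmetic.
Variable A : zmodType.
Implicit Types (b c x y : A).

Lemma eq_coset b x y :
  coset (cyclic_subgroup b) x = coset (cyclic_subgroup b) y <-> exists z : int, x - y = b *~ z.
Proof.
split=> [E|[z xyz]].
  have : coset (cyclic_subgroup b) x x by exists 0; [exists 0; rewrite ?mulr0z|rewrite addr0].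
  by rewrite E => -[_ [z _ <-] <-]; exists z; rewrite addrAC subrr add0r.
have -> : x = y + b *~ z by rewrite -xyz addrC subrK.
apply/seteqP; split=> w [_ [t _ <-] <-].
  by exists (b *~ (z + t)); [exists (z + t)|rewrite mulrzDr addrA].
by exists (b *~ (t - z)); [exists (t - z)|rewrite mulrzBr addrACA subrr addr0 addrC].
Qed.

Lemma has_index_class b m : has_index (cyclic_subgroup b) m ->
  exists f : A -> 'I_m, (forall i, exists x, f x = i) /\
    forall x y, f x = f y <-> exists z : int, x - y = b *~ z.
Proof.
move=> /card_set_bijP[g [gm ginj gsurj]].
have gP x : (g (coset (cyclic_subgroup b) x) < m)%N.
  exact: (gm (coset (cyclic_subgroup b) x) (ex_intro2 _ _ x I erefl)).
exists (fun x => Ordinal (gP x)); split=> [i|x y].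
  have [|_ [x _ <-] gi] := gsurj i; first exact: ltn_ord.
  by exists x; exact/val_inj.
rewrite -eq_coset; split=> [/(congr1 val)/= E|E]; last by apply/val_inj; rewrite /= E.
by apply: ginj => //; rewrite inE; [exists x|exists y].
Qed.

(** Two of the [m.+1] multiples of [x] from 0 to [m] lie in the same coset, so a positive multiple
    of [x] by at most [m] falls into the cyclic subgroup; the factorial makes the bound uniform in
    [x]. *)
Lemma has_index_exponent b m N : has_index (cyclic_subgroup b) m -> b *+ N = 0 ->
  forall x, x *+ (N * m`!) = 0.
Proof.
move=> /has_index_class[f [_ fE]] bN x.
have : ~~ injectiveb (fun i : 'I_m.+1 => f (x *+ i)).
  apply/injectiveP => /leq_card; by rewrite !card_ord ltnn.
case/injectivePn => i [j ij /fE[z]].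
wlog ltji : i j z ij / (j < i)%N => [H E|E].
  have [ji|ij'] := ltnP j i; first exact: (H i j z ij ji E).
  apply: (H j i (- z)); first by rewrite eq_sym.
    by rewrite ltn_neqAle ij' andbT; apply: contra ij => /eqP e; apply/eqP/val_inj.
  by rewrite mulrNz -E opprB.
have d0 : (0 < i - j)%N by rewrite subn_gt0.
have /dvdnP[q ->] : (i - j %| m`!)%N.
  by apply: dvdn_fact; rewrite d0/= (leq_trans (leq_subr _ _))// -ltnS ltn_ord.
have -> : (N * (q * (i - j)) = (i - j) * (N * q))%N by lia.
rewrite mulrnA mulrnBr ?(ltnW ltji)// E mulrnA.
by rewrite !pmulrn -[b *~ z *~ N]mulrzA [(z * _)%R]mulrC mulrzA -[b *~ N]pmulrn bN !mul0rz.
Qed.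

(** Let [n] be the least exponent, [l] a prime factor and [q] the cofactor. Some [x] has
    [x *+ q <> 0]; it is not divisible by [l], or [n] would not annihilate, and [x *+ q] is the
    required torsion element. *)
Lemma exponent_torsion N b : (forall x, x *+ N.+1 = 0) -> b != 0 ->
  exists l x y, [/\ prime l, forall w, x <> w *+ l, y != 0 & y *+ l = 0].
Proof.
move=> xN b0.
have exN : exists n, (0 < n)%N && `[< forall x, x *+ n = 0 >].
  by exists N.+1; exact/asboolP.
have [n /andP[n0 /asboolP xn] nmin] := ex_minnP exN.
have n1 : (1 < n)%N.
  by rewrite ltn_neqAle n0 andbT; apply: contra b0 => /eqP n1; rewrite -(xn b) -n1.
have lP := pdiv_prime n1; set l := pdiv n in lP.
have [q nE] := dvdnP (pdiv_dvd n).
have [x xq] : exists x, x *+ q <> 0.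
  apply: contrapT => nx; have /nmin : (0 < q)%N && `[< forall x, x *+ q = 0 >].
    apply/andP; split; first by move: n0; rewrite nE muln_gt0 => /andP[].
    by apply/asboolP => x; apply: contrapT => xq; apply: nx; exists x.
  apply/negP; rewrite -ltnNge [ltnRHS]nE -/l ltn_Pmulr ?prime_gt1//.
  by move: n0; rewrite nE muln_gt0 => /andP[].
exists l, x, (x *+ q); split=> //; first 2 last.
- by rewrite -mulrnA -nE.
- by move=> w xw; apply: xq; rewrite xw -mulrnA mulnC -nE.
- exact/eqP.
Qed.

Lemma index_multiple c n m : (0 < n)%N -> (forall z : int, c *~ z = 0 -> z = 0) ->
  has_index (cyclic_subgroup (c *+ n)) m -> (n %| m)%N.
Proof.
move=> n0 c_inf /has_index_class[f [fs fE]].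
pose r i := projT1 (cid (fs i)); have rK i : f (r i) = i := projT2 (cid (fs i)).
pose rel := [rel i j : 'I_m | `[< exists z : int, r i - r j = c *~ z >]].
have relE i j : rel i j -> exists z : int, r i - r j = c *~ z by move=> /asboolP.
have eqr : {in [set: 'I_m]%SET & &, equivalence_rel rel}.
  move=> i j k _ _ _; split=> [|/asboolP[z zE]]; first by apply/asboolP; exists 0; rewrite /= addrN mulr0z.
  apply/asboolP/asboolP => -[t tE].
    by exists (t - z); rewrite mulrzBr -tE -zE opprB [RHS]addrC addrA subrK.
  by exists (t + z); rewrite mulrzDr -tE -zE [RHS]addrC addrA subrK.
have := @card_uniform_partition _ n _ [set: 'I_m]%SET _ (equivalence_partitionP eqr).
rewrite cardsT card_ord => -> //; first exact: dvdn_mull.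
move=> _ /imsetP[i _ ->].
rewrite (_ : [set _ in _ | _]%SET = [set f (r i + c *+ nat_of_ord j) | j : 'I_n]%SET).
  rewrite card_imset ?card_ord// => j j' /fE[z].
  rewrite opprD addrACA subrr add0r => /eqP.
  rewrite !pmulrn -mulrzBr -mulrzA -subr_eq0 -mulrzBr => /eqP/c_inf/eqP.
  rewrite subr_eq0 => /eqP jj; apply/val_inj => /=.
  have /eqP : (j%:Z = j' %[mod n])%Z.
    by apply/eqP; rewrite eqz_mod_dvd jj dvdz_mulr.
  by rewrite !modz_nat eqz_nat !modn_small// => /eqP.
apply/setP => y; rewrite !inE; apply/asboolP/imsetP => [[z zE]|[j _ yE]].
  have nz : n%:Z != 0 by rewrite eqz_nat -lt0n.
  (* As [r y] equals [r i - c *~ z], its coset is determined by [- z] modulo [n]. *)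
  have jn : (`|((- z) %% n)%Z| < n)%N.
    by rewrite -ltz_nat gez0_abs ?modz_ge0// ltz_pmod.
  exists (Ordinal jn) => //; rewrite -(rK y); apply/fE; exists ((- z) %/ n)%Z.
  rewrite opprD addrA -[r y - r i]opprB zE !pmulrn -mulrNz -mulrzBr -mulrzA; congr (c *~ _).
  by rewrite /= gez0_abs ?modz_ge0// {1}(divz_eq (- z) n) addrK mulrC.
have /fE[z zE] : f (r y) = f (r i + c *+ j) by rewrite rK.
exists (- (j%:Z + n%:Z * z)).
rewrite mulrNz mulrzDr mulrzA -!pmulrn -zE.
by rewrite [r i + _ *+ _]addrC opprD opprB -addrA addKr.
Qed.

End IndexArithmetic.

Local Open Scope quotient_scope.

(** * From cochains to cohomology classes, and the conclusion *)

Section CohomologyClasses.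
Variable R : realType.
Local Notation simplex := (simplex R).
Local Notation chains n X := (continuousType (simplex n) X).
Implicit Types X : topologicalType.

Lemma cocycle_dV n X (z : cocycles R n X) : dV (z : chains n X -> int) = 0.
Proof. by rewrite -coboundaryE; apply/eqP; rewrite -cocycleE; exact: cocycle_valP. Qed.

Lemma dV_cocycle n X (phi : chains n X -> int) : dV phi = 0 -> phi \in @cocycle R n X.
Proof. by move=> dphi; rewrite cocycleE coboundaryE dphi. Qed.

Lemma eq_class n X (z w : cocycles R n X) :
  \pi_(cohomology R n X) z = \pi_(cohomology R n X) w <->
  is_coboundary ((z : chains n X -> int) - (w : chains n X -> int)).
Proof.
split=> [/eqP|zw].
  by rewrite -[_ == _]Quotient.idealrBE => /asboolP.
by apply/eqP; rewrite -[_ == _]Quotient.idealrBE; exact/asboolP.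
Qed.

Lemma class_ind n X (P : cohomology R n X -> Prop) :
  (forall z : cocycles R n X, P (\pi_(cohomology R n X) z)) -> forall c, P c.
Proof. by move=> Pz c; rewrite -(reprK c). Qed.

Lemma cocycle_valMn n X (z : cocycles R n X) N :
  (z *+ N : cocycles R n X) = (z : chains n X -> int) *+ N :> (chains n X -> int).
Proof. exact: (raddfMn (\val : cocycles R n X -> (chains n X -> int))). Qed.

Lemma class_Mn n X (z : cocycles R n X) N :
  \pi_(cohomology R n X) z *+ N = \pi_(cohomology R n X) (z *+ N).
Proof. by rewrite raddfMn. Qed.

Lemma class_eq0 n X (z : cocycles R n X) :
  \pi_(cohomology R n X) z = 0 <-> is_coboundary (z : chains n X -> int).
Proof.
by rewrite -(raddf0 \pi_(cohomology R n X)) eq_class /= subr0.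
Qed.

Lemma vanishing_acyclic k X :
  (forall j : nat, (k < j)%N -> forall b : cohomology R j X, b = 0) -> acyclic_from R k X.
Proof.
move=> H0 j F kj dF.
have /class_eq0[E] := H0 j.+1 kj (\pi_(cohomology R j.+1 X) (Cocycle (dV_cocycle dF))).
by rewrite coboundaryE => FE; exists E.
Qed.

Lemma path_chain_connected (U : topologicalType) : path_connected R U -> chain_connected R U.
Proof.
move=> Upc P Pc y y' Py; have [g [gc g0 g1]] := Upc y y'.
have ccts : continuous (fun s : simplex 1 => coords s ord0 ord_max) by exact: coords_cts.
have c01 (s : simplex 1) : `[0, 1]%classic (coords s ord0 ord_max).
  rewrite /= in_itv /= coords_ge0 -(sum_coords s) big_ord_recr /= lerDr.
  by apply: sumr_ge0 => i _; exact: coords_ge0.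
have gcts : continuous (g \o (fun s : simplex 1 => coords s ord0 ord_max)).
  move=> s A /= nA; have /subspace_continuousP /(_ _ (c01 s)) := gc.
  move=> /(_ A nA) /= /(ccts s); rewrite /= !nbhs_filterE /=.
  by apply: filterS => t; apply; exact: c01.
have : P (g (coords (@vertex R 1 0) ord0 ord_max)) -> P (g (coords (@vertex R 1 1) ord0 ord_max)).
  exact: Pc (mkcts gcts).
by rewrite !coords_vertex /= g0 g1; exact.
Qed.

End CohomologyClasses.

Section Translations.
Variables (R : realType) (d : nat) (G : lieGroupType R d) (k : nat).
Local Notation simplex := (simplex R).
Local Notation chains n X := (continuousType (simplex n) X).
Hypothesis G_conn : chain_connected R G.

Lemma transl_cob h (psi : chains k G -> int) : dV psi = 0 ->
  is_coboundary (ipull (transl h) psi - psi).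
Proof.
move=> dpsi; apply: cob_0.
pose M := ipull (mkcts (@lie_mul_continuous R d G)) psi.
have dM : dV M = (fun s => 0 * (fun _ => 0) s).
  by rewrite dV_ipull dpsi; apply/funext => s; rewrite mul0r.
have := homotopy_cob 1%g h G_conn dM; congr cob; apply/funext => s.
rewrite !fct_subE; congr (psi _ - psi _); apply/continuousEP => x //.
exact: mulg1.
Qed.

Lemma sum_transl_cob (r : seq G) (psi : chains k G -> int) : dV psi = 0 ->
  is_coboundary (\sum_(h <- r) (ipull (transl h^-1%g) psi - psi)).
Proof.
move=> dpsi; elim: r => [|h r IH]; first by rewrite big_nil; exact: is_coboundary0.
rewrite big_cons addrC -[X in _ + X]opprK; apply: is_coboundaryB => //.
rewrite -sub0r; apply: is_coboundaryB; first exact: is_coboundary0.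
exact: transl_cob.
Qed.

Lemma orbit_cob (U : topologicalType) (a : continuous_action G U) x y (phi : chains k U -> int) :
  chain_connected R U -> dV phi = 0 ->
  is_coboundary (ipull (orbit_map a y) phi - ipull (orbit_map a x) phi).
Proof.
move=> U_conn dphi; apply: cob_0.
pose M := ipull (mkcts (@act_continuous R d G U a)) phi.
have dM : dV M = (fun s => 0 * (fun _ => 0) s).
  by rewrite dV_ipull dphi; apply/funext => s; rewrite mul0r.
have := homotopy_cob x y U_conn dM; congr cob; apply/funext => s.
by rewrite !fct_subE; congr (phi _ - phi _); apply/continuousEP.
Qed.

Hypothesis G_acyclic : acyclic_from R k G.

Lemma invariant_divisible (hs : seq G) (phi : chains k G -> int) :
  uniq hs -> (1%g : G) \in hs ->
  (forall h, h \in hs -> (h^-1)%g \in hs) ->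
  (forall h h', h \in hs -> h' \in hs -> (h * h')%g \in hs) ->
  dV phi = 0 -> (forall h (s : chains k G), h \in hs -> phi (transl h \o s) = phi s) ->
  exists psi : chains k G -> int, dV psi = 0 /\ is_coboundary (phi - psi *+ size hs).
Proof.
move=> hs_uniq hs1 hsV hsM dphi iphi.
pose C : coefficients hs := @Coefficients _ _ _ hs int (fun _ => True) (fun _ v => v)
  I (fun _ _ _ _ => I) (fun _ _ _ => erefl) (fun _ => erefl) (fun _ _ _ => erefl)
  (fun _ _ _ _ => I).
have acC : acyclic_above k C.
  by move=> j F kj dF _; have [E dE] := G_acyclic kj dF; exists E.
have [N [Os [lam [Oo Oc lamP lamE]]]] := equivariant_cover hs1 hsV hsM.
have [| |psi [dpsi _ psiE]] := @equivariant_transfer _ _ _ hs hs_uniq hs1 hsV hsM N Os lam Oo Oc lamP lamE k C phi acC dphi.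
- by [].
- by move=> h s hh; exact: iphi.
exists psi; split=> //.
have -> : phi - psi *+ size hs = \sum_(h <- hs) (ipull (transl h^-1%g) psi - psi).
  rewrite sumrB; congr (_ - _); last by rewrite big_const_seq count_predT iter_addr_0.
  by apply/funext => s; rewrite fct_sumE psiE.
exact: sum_transl_cob.
Qed.

End Translations.

Section TopDegree.
Variables (R : realType) (d : nat) (G : lieGroupType R d).
Local Notation simplex := (simplex R).
Local Notation chains n X := (continuousType (simplex n) X).
Hypothesis G_conn : chain_connected R G.

Lemma unbounded_exponent k N : acyclic_from R k G ->
  (forall x : cohomology R k G, x *+ N.+1 = 0) -> forall b : cohomology R k G, b = 0.
Proof.
move=> G_acyclic xN b; apply/eqP/negPn/negP => b0.
have [l [x [y [lP xl /eqP y0 yl]]]] := exponent_torsion xN b0.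
have l0 : l%:Z != 0 by rewrite -lt0n prime_gt0.
move: x xl y y0 yl; apply: class_ind => a al; apply: class_ind => a' a'0.
rewrite class_Mn => /class_eq0; rewrite cocycle_valMn.
have lE (f : chains k G -> int) : f *+ l = fun s => l%:Z * f s.
  by apply/funext => s; rewrite pmulrn fct_mulrzE mulrzz mulrC.
rewrite lE; case: k G_acyclic xN b b0 a al a' a'0 lE => [|k'] G_acyclic xN b b0 a al a' a'0 lE.
  (* In degree 0 only the zero cochain is a coboundary, and integer-valued functions are
     torsion-free. *)
  move=> /= za; apply/a'0/class_eq0; apply/funext => s; apply: (mulfI l0).
  by rewrite mulr0 [LHS](congr1 (@^~ s) za).
move=> [u]; rewrite coboundaryE => du.
have [|e a'E] := no_top_torsion lP G_acyclic G_conn (cocycle_dV a) _ (esym du).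
  (* A coboundary modulo [l] that is a cocycle has a class divisible by [l]: the cochain [c] is
     closed because [l] cancels. *)
  move=> [p [c [pb aE]]].
  have dc : dV c = 0.
    apply/funext => s; apply: (mulfI l0); rewrite mulr0.
    have := congr1 (fun f => dV f s) aE.
    rewrite cocycle_dV dVD (is_coboundary_cocycle pb) add0r dVZ.
    by move=> <-.
  apply: (al (\pi_(cohomology R k'.+1 G) (Cocycle (dV_cocycle dc)))).
  rewrite class_Mn; apply/eq_class.
  by rewrite cocycle_valMn lE /= aE addrK.
by apply/a'0/class_eq0; rewrite a'E; exact: is_coboundary_dV.
Qed.

End TopDegree.

Local Open Scope fset_scope.

Theorem proposition3p2p1 (R : realType) (d : nat) (G : lieGroupType R d)
    (U : topologicalType) (act : continuous_action G U) (k m : nat) :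
  connected [set: G] ->
  path_connected R U ->
  (forall x : U, finite_set (stabiliser act x)) ->
  (exists b : cohomology R k G, b != 0) ->
  (forall j : nat, (k < j)%N -> forall b : cohomology R j G, b = 0) ->
  (exists a : cohomology R k U, exists x0 : U,
     has_index (cyclic_subgroup (pullback (orbit_map act x0) a)) m) ->
  forall x : U, (#|` fset_set (stabiliser act x)| %| m)%N.
Proof.
move=> /lie_chain_connected G_conn /path_chain_connected U_conn stab_fin [b0 b0n0].
move=> /vanishing_acyclic G_acyclic [+ [x0 +]] x; apply: class_ind => z.
rewrite pullback_pi => idx.
have stabP h : reflect (act h x = x) (h \in fset_set (stabiliser act x)).
  rewrite in_fset_set//; apply: (iffP idP) => [/set_mem|hx] //; exact/mem_set.
have [|||||psi [dpsi phi_psi]] := @invariant_divisible _ _ G k G_conn G_acyclic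
  (fset_set (stabiliser act x)) (ipull (orbit_map act x) z) (fset_uniq _).
- by apply/stabP; exact: act1.
- by move=> h /stabP hx; apply/stabP; rewrite -[X in act _ X]hx -actM mulVg act1.
- by move=> h h' /stabP hx /stabP hx'; apply/stabP; rewrite actM hx' hx.
- by rewrite dV_ipull cocycle_dV; apply/funext.
- move=> h s /stabP hx; congr (cocycle_val z _); apply/continuousEP => p.
  by rewrite -[LHS]/(act (s p * h)%g x) actM hx.
set n := size _ in phi_psi.
have n0 : (0 < n)%N.
  by rewrite /n -has_predT; apply/hasP; exists (1%g : G) => //; apply/stabP; exact: act1.
pose c := \pi_(cohomology R k G) (Cocycle (dV_cocycle dpsi)).
have bE : \pi_(cohomology R k G) (cocycle_pullback (orbit_map act x0) z) = c *+ n.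
  rewrite class_Mn; apply/eq_class; rewrite cocycle_valMn /=.
  have := is_coboundaryB phi_psi (orbit_cob act x0 x U_conn (cocycle_dV z)).
  by congr is_coboundary; rewrite opprB [LHS]addrC addrA subrK.
rewrite bE in idx; apply: (index_multiple n0 _ idx) => t ct.
(* A relation [c *~ t = 0] with [t] non-zero would bound the exponent of the whole group by the
   product of the absolute value of [t] and [m!], against [unbounded_exponent] and [b0n0]. *)
apply/eqP; rewrite -absz_eq0; apply/negPn/negP; rewrite -lt0n => t0.
have bt : c *+ n *+ `|t|%N = 0.
  rewrite -mulrnA mulnC mulrnA; case: t ct {t0} => t; rewrite ?NegzE ?mulrNz.
    by move=> ct; rewrite [c *+ _]ct mul0rn.
  by move=> /eqP; rewrite oppr_eq0 => /eqP /= ct; rewrite [c *+ _]ct mul0rn.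
have N0 : (0 < `|t| * m`!)%N by rewrite muln_gt0 t0 fact_gt0.
have := has_index_exponent idx bt; rewrite -(prednK N0).
by move=> /(unbounded_exponent G_conn G_acyclic)/(_ b0)/eqP; rewrite (negbTE b0n0).
Qed.
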